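(* Let $E,F,G$ be Banach spaces, $\alpha$ a uniform crossnorm and $(\pi_n)$ a sequence of partitions of $\mathbb R_{\ge0}$. Let $X\in D(\mathbb R_{\ge0},E)$ be a path with strong (resp. weak) $\alpha$-tensor quadratic variation ${}^\alpha[X,X]$ and finite 2-variation along $(\pi_n)$, and let $A\colon\mathbb R_{\ge0}\to F$ be a càdlàg path of finite variation. Assume that $(\pi_n)$ satisfies Condition (C) for $(A,X)$ and approximates $(A,X)$ from the left. Let $f\colon F\times E\to G$ be once Gâteaux differentiable in $a\in F$ and twice Gâteaux differentiable in $x\in E$, with $D_af\in C_{\mathcal K}(F\times E,\mathcal L(F,G))$, $D_xf\in C_{\mathcal K}(F\times E,\mathcal L(E,G))$, and such that $D_x^2f\colon F\times E\to\mathcal L(E\widehat\otimes E,G)$ extends to a function in $C_{\mathcal K}(F\times E,\mathcal L(E\widehat\otimes_\alpha E,G))$. Then the càdlàg path $f(A,X)$ admits a decomposition $$f(A_t,X_t)=Y_t+C_t+D_t,\qquad t\ge0,$$ where $Y_t=\int_0^tD_xf(A_{s-},X_{s-})\,\mathrm dX_s$ (Itô–Föllmer integral) is a càdlàg path having the strong (resp. weak) $\alpha$-tensor quadratic variation ${}^\alpha[Y,Y]_t=\int_0^tD_xf(A_{s-},X_{s-})^{\otimes2}\,\mathrm d\,{}^\alpha[X,X]_s$ along $(\pi_n)$, $C$ is a continuous path of finite variation, and $D$ is a purely discontinuous path of finite variation.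
   Context: Banach spaces are real. A uniform crossnorm $\alpha$ is an assignment of a reasonable crossnorm on $E\otimes F$ to every pair of Banach spaces $(E,F)$ (i.e. $\alpha(x\otimes y)\le\|x\|\|y\|$ and $x^*\otimes y^*$ is $\alpha$-bounded with norm $\le\|x^*\|\|y^*\|$) such that for all $T\in\mathcal L(E_1,E_2)$, $S\in\mathcal L(F_1,F_2)$, $T\otimes S$ extends to a bounded operator $E_1\widehat\otimes_\alpha F_1\to E_2\widehat\otimes_\alpha F_2$ with $\|T\otimes S\|\le\|T\|\|S\|$. $E\widehat\otimes_\alpha F$ is the $\alpha$-completion of $E\otimes F$, $E\widehat\otimes E$ the completed projective tensor product; bounded bilinear maps $E\times E\to G$ are identified with elements of $\mathcal L(E\widehat\otimes E,G)$; $T^{\otimes2}=T\otimes T$. $C_{\mathcal K}(S,S')$ is the set of functions $S\to S'$ whose restriction to each compact subset of $S$ is continuous. A partition of $\mathbb R_{\ge0}$ is $\pi=\{\,]t_i,t_{i+1}]:i\in\mathbb N\}$ with $0=t_0<t_1<\dots\to\infty$; for $t>0$, $\pi(t)=]\underline\pi(t),\overline\pi(t)]$ is the element of $\pi$ containing $t$. $D(\mathbb R_{\ge0},E)$ is the set of càdlàg $E$-valued paths; $\Delta X_t=X_t-X_{t-}$ ($t>0$), $\Delta X_0=0$; $\delta X_t(]r,s])=X_{s\wedge t}-X_{r\wedge t}$. Finite variation means finite total variation on compact intervals. A càdlàg path $D$ of finite variation is purely discontinuous if $D_t=D_0+\sum_{0<s\le t}\Delta D_s$ for all $t$. A càdlàg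 $X$ in $E$ has strong (weak) $\alpha$-tensor quadratic variation along $(\pi_n)$ if there is an $E\widehat\otimes_\alpha E$-valued càdlàg path ${}^\alpha[X,X]$ of finite variation with $\sum_{I\in\pi_n}\delta X_t(I)\otimes\delta X_t(I)\to{}^\alpha[X,X]_t$ in norm (weakly) for every $t\ge0$, and $\Delta\,{}^\alpha[X,X]_t=\Delta X_t\otimes\Delta X_t$ for all $t$. $X$ has finite 2-variation along $(\pi_n)$ if $\sup_n\sum_{I\in\pi_n}\|\delta X_t(I)\|^2<\infty$ for all $t\ge0$. Integrals $\int_0^t$ against finite variation paths are vector Stieltjes integrals over $]0,t]$. The Itô–Föllmer integral along $(\pi_n)$ is $\int_0^tD_xf(A_{s-},X_{s-})\,\mathrm dX_s=\lim_{n\to\infty}\sum_{]r,s]\in\pi_n}D_xf(A_r,X_r)(X_{s\wedge t}-X_{r\wedge t})$, the limit being in the norm (resp. weak) topology of $G$ when ${}^\alpha[X,X]$ is the strong (resp. weak) quadratic variation; under the present assumptions the limit exists, by the known Itô formula. For a càdlàg path $Z$ let $D(Z)=\{t:\Delta Z_t\ne0\}$, $D_\varepsilon(Z)=\{t:\|\Delta Z_t\|>\varepsilon\}$, $J_\varepsilon(Z)_t=\sum_{0<s\le t}\Delta Z_s1_{D_\varepsilon(Z)}(s)$, $O^+_t(Z,\pi)=\sup_{]r,s]\in\pi}\sup_{u,v\in]r,s]\cap[0,t]}\|Z_u-Z_v\|$. $(\pi_n)$ satisfies Condition (C) for $Z$ if: (C1) for all $t\ge0$, $\varepsilon>0$ there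 is $N$ such that $I\cap[0,t]\cap D_\varepsilon(Z)$ has at most one element for all $n\ge N$, $I\in\pi_n$; (C2) $\delta Z_t(\pi_n(s))\to\Delta Z_s$ for all $s\in D(Z)$, $t\ge s$; (C3) for all $t\ge 0$, $\varlimsup_{\varepsilon\downarrow0}\varlimsup_{n\to\infty}O^+_t(Z-J_\varepsilon(Z),\pi_n)=0$. $(\pi_n)$ approximates $Z$ from the left if $Z(\underline{\pi_n}(t))\to Z(t-)$ for all $t>0$. *)

(* Defs.v *)
From HB Require Import structures.
From mathcomp Require Import all_boot all_order all_algebra.
From mathcomp Require Import sesquilinear finmap.
From mathcomp Require Import all_classical all_reals all_analysis.

Set Implicit Arguments.
Unset Strict Implicit.
Unset Printing Implicit Defensive.

Import Order.TTheory GRing.Theory Num.Theory.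
Import numFieldNormedType.Exports.

Local Open Scope classical_set_scope.
Local Open Scope ring_scope.

Section bounded_operators.
Variables (R : realType) (V W : normedModType R).

Definition bop_pred : {pred V -> W} := fun T =>
  `[< linear T /\ exists M, forall x, `|T x| <= M * `|x| >].

Record bop := BOp { bop_fun :> V -> W; bop_funP : bop_fun \in bop_pred }.

HB.instance Definition _ := [isSub for bop_fun].
HB.instance Definition _ := [Choice of bop by <:].

Lemma bop_pred_closed : submod_closed bop_pred.
Proof.
split.
  apply/asboolP; split.
    by move=> a x y; rewrite -[RHS]/(a *: (0 : W) + 0) scaler0 addr0.
  by exists 0 => x; rewrite mul0r normr0.
move=> a S T /asboolP[linS [M SM]] /asboolP[linT [N TN]]; apply/asboolP; split.
  move=> b x y; rewrite -![(_ + _) _]/(a *: S _ + T _) linS linT.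
  by rewrite !scalerDr !scalerA (mulrC a b) addrACA.
exists (`|a| * M + N) => x; rewrite (le_trans (ler_normD _ _))// mulrDl.
by rewrite lerD// normrZ -mulrA ler_wpM2l.
Qed.

HB.instance Definition _ := GRing.isSubmodClosed.Build R (V -> W) bop_pred
  bop_pred_closed.
HB.instance Definition _ := [SubChoice_isSubLmodule of bop by <:].

Lemma bop_is_linear (T : bop) : linear T.
Proof. by case: T => T /= /asboolP[]. Qed.

HB.instance Definition _ (T : bop) :=
  GRing.isLinear.Build R V W _ (bop_fun T) (@bop_is_linear T).

Lemma bop_bounded (T : bop) : exists M, forall x, `|T x| <= M * `|x|.
Proof. by case: T => T /= /asboolP[]. Qed.

Lemma bopP (S T : bop) : (forall x, S x = T x) -> S = T.
Proof. by move=> ST; apply/val_inj/funext. Qed.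

Definition opnorm (T : bop) : R := sup [set `|T x| | x in [set x | `|x| <= 1]].

Lemma opnorm_has_sup (T : bop) :
  has_sup [set `|T x| | x in [set x | `|x| <= 1]].
Proof.
split; first by exists `|T 0|, 0 => //=; rewrite normr0.
have [M TM] := bop_bounded T; exists `|M| => _ /= [x x1 <-].
rewrite (le_trans (TM x))// (le_trans (ler_wpM2r _ (ler_norm M)))//.
by rewrite ler_piMr.
Qed.

Lemma opnorm_le (T : bop) x : `|T x| <= opnorm T * `|x|.
Proof.
have [->|x0] := eqVneq x 0; first by rewrite linear0 !normr0 mulr0.
have nx0 : 0 < `|x| by rewrite normr_gt0.
rewrite -ler_pdivrMr//; apply: sup_upper_bound; first exact: opnorm_has_sup.
exists (`|x|^-1 *: x); last first.
  by rewrite linearZ normrZ ger0_norm ?invr_ge0// mulrC.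
by rewrite /= normrZ ger0_norm ?invr_ge0// mulVf// gt_eqF.
Qed.

Lemma opnorm_lub (T : bop) M : 0 <= M -> (forall x, `|T x| <= M * `|x|) ->
  opnorm T <= M.
Proof.
move=> M0 TM; apply: ge_sup; first by case: (opnorm_has_sup T).
by move=> _ /= [x x1 <-]; rewrite (le_trans (TM x))// ler_piMr.
Qed.

Lemma opnorm_ge0 (T : bop) : 0 <= opnorm T.
Proof.
apply: (le_trans (normr_ge0 (T 0))).
apply: sup_upper_bound; first exact: opnorm_has_sup.
by exists 0; rewrite //= normr0.
Qed.

Lemma ler_opnormD (S T : bop) : opnorm (S + T) <= opnorm S + opnorm T.
Proof.
apply: opnorm_lub; first by rewrite addr_ge0// opnorm_ge0.
move=> x; rewrite mulrDl (le_trans (ler_normD _ _))// lerD//; exact: opnorm_le.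
Qed.

Lemma ler_opnormZ (a : R) (T : bop) : opnorm (a *: T) <= `|a| * opnorm T.
Proof.
apply: opnorm_lub; first by rewrite mulr_ge0// opnorm_ge0.
by move=> x; rewrite normrZ -mulrA ler_wpM2l// opnorm_le.
Qed.

Lemma opnormZ (a : R) (T : bop) : opnorm (a *: T) = `|a| * opnorm T.
Proof.
apply/eqP; rewrite eq_le ler_opnormZ /=.
have [->|a0] := eqVneq a 0; first by rewrite normr0 mul0r opnorm_ge0.
rewrite -ler_pdivlMl ?normr_gt0// -normfV.
by rewrite (le_trans _ (ler_opnormZ _ _))// scalerA mulVf// scale1r.
Qed.

Lemma opnorm_eq0 (T : bop) : opnorm T = 0 -> T = 0.
Proof.
move=> T0; apply: bopP => x; apply/eqP; rewrite -normr_le0.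
by rewrite (le_trans (opnorm_le T x))// T0 mul0r.
Qed.

HB.instance Definition _ :=
  Lmodule_isNormed.Build R bop ler_opnormD opnormZ opnorm_eq0.

End bounded_operators.

Notation "''L' ( V , W )" := (bop V W)
  (at level 0, format "''L' ( V ,  W )") : type_scope.

(* The algebraic tensor product: x \ox y is evaluation at (x, y) on bilinear
   forms, and tensor E F is the linear span of these functionals.  Bilinear
   forms separate the elements of an algebraic tensor product of vector spaces,
   so this is the usual one. *)
Section tensor_product.
Variables (R : realType) (E F : normedModType R).

Local Notation form := {bilinear E -> F -> R^o}.

Definition tensor_pred : {pred form -> R^o} := fun u =>
  `[< exists s : seq (E * F), u = fun b => \sum_(p <- s) b p.1 p.2 >].

Record tensor := Tensor {
  tensor_fun :> form -> R^o;
  tensor_funP : tensor_fun \in tensor_pred }.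

HB.instance Definition _ := [isSub for tensor_fun].
HB.instance Definition _ := [Choice of tensor by <:].

Lemma tensor_pred_closed : submod_closed tensor_pred.
Proof.
split.
  by apply/asboolP; exists [::]; apply/funext => b; rewrite big_nil.
move=> a _ _ /asboolP[s ->] /asboolP[t ->]; apply/asboolP.
exists ([seq (a *: p.1, p.2) | p <- s] ++ t); apply/funext => b.
rewrite big_cat big_map !fctE /= scaler_sumr; congr (_ + _).
by apply: eq_bigr => p _; rewrite linearZl_LR.
Qed.

HB.instance Definition _ := GRing.isSubmodClosed.Build R (form -> R^o)
  tensor_pred tensor_pred_closed.
HB.instance Definition _ := [SubChoice_isSubLmodule of tensor by <:].

Lemma elt_subproof (x : E) (y : F) : (fun b : form => b x y) \in tensor_pred.
Proof.
by apply/asboolP; exists [:: (x, y)]; apply/funext => b; rewrite big_seq1.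
Qed.

Definition elt x y : tensor := Tensor (elt_subproof x y).

End tensor_product.

Notation "x \ox y" := (elt x y) (at level 40, left associativity) : ring_scope.

Section tensor_operators.
Variables (R : realType) (E1 E2 F1 F2 : normedModType R).
Variables (T : 'L(E1, E2)) (S : 'L(F1, F2)).

Definition pull_form (b : {bilinear E2 -> F2 -> R^o}) (x : E1) (y : F1) : R^o :=
  b (T x) (S y).

Lemma pull_form_bilinear b : bilinear_for *:%R *:%R (pull_form b).
Proof.
split=> [y|x] a u v; rewrite /pull_form linearP ?linearPl//.
by rewrite linearPr.
Qed.

HB.instance Definition _ b := bilinear_isBilinear.Build R E1 F1 R^o *:%R *:%R
  (pull_form b) (pull_form_bilinear b).

Lemma tensor_map_subproof (u : tensor E1 F1) :
  (fun b => u (pull_form b)) \in @tensor_pred R E2 F2.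
Proof.
case: u => /= _ /asboolP[s ->]; apply/asboolP.
exists [seq (T p.1, S p.2) | p <- s].
by apply/funext => b; rewrite big_map.
Qed.

Definition tensor_map (u : tensor E1 F1) : tensor E2 F2 :=
  Tensor (tensor_map_subproof u).

Lemma tensor_map_elt x y : tensor_map (x \ox y) = T x \ox S y.
Proof. exact/val_inj. Qed.

Lemma tensor_map_is_linear : linear tensor_map.
Proof. by move=> a u v; apply/val_inj. Qed.

HB.instance Definition _ :=
  GRing.isLinear.Build R _ _ _ tensor_map tensor_map_is_linear.

End tensor_operators.

Section tensor_functionals.
Variables (R : realType) (E F : normedModType R).
Variables (phi : 'L(E, R^o)) (psi : 'L(F, R^o)).

Definition prod_form (x : E) (y : F) : R^o := phi x * psi y.

Lemma prod_form_bilinear : bilinear_for *:%R *:%R prod_form.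
Proof.
split=> [y|x] a u v; rewrite /prod_form linearP.
  by rewrite mulrDl -scalerAl.
by rewrite mulrDr -scalerAr.
Qed.

HB.instance Definition _ := bilinear_isBilinear.Build R E F R^o *:%R *:%R
  prod_form prod_form_bilinear.

Definition tensor_functional (u : tensor E F) : R := u prod_form.

Lemma tensor_functional_elt x y : tensor_functional (x \ox y) = phi x * psi y.
Proof. by []. Qed.

End tensor_functionals.

Record reasonable_crossnorm (R : realType) (E F : normedModType R)
    (nu : tensor E F -> R) : Prop := ReasonableCrossnorm {
  crossnormD : forall u v, nu (u + v) <= nu u + nu v;
  crossnormZ : forall (a : R) u, nu (a *: u) = `|a| * nu u;
  crossnorm_eq0 : forall u, nu u = 0 -> u = 0;
  crossnorm_elt : forall x y, nu (x \ox y) <= `|x| * `|y|;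
  crossnorm_dual : forall (phi : 'L(E, R^o)) (psi : 'L(F, R^o)) u,
    `|tensor_functional phi psi u| <= `|phi| * `|psi| * nu u }.

(* A completion of (V, nu); it is unique up to isometric isomorphism, and
   statements are made for an arbitrary one. *)
Record completion (R : realType) (V : lmodType R) (nu : V -> R) := Completion {
  cpl_sort :> completeNormedModType R;
  cpl_inj : {linear V -> cpl_sort};
  cpl_norm : forall u, `|cpl_inj u| = nu u;
  cpl_dense : dense (range cpl_inj) }.

Section extension.
Variables (R : realType) (V : lmodType R) (nu : V -> R) (C : completion nu).
Variables (W : completeNormedModType R) (g : {linear V -> W}) (M : R).
Hypothesis gM : forall u, `|g u| <= M * nu u.
Hypothesis M0 : 0 <= M.
Local Notation i := (cpl_inj C).

Let M1 : 0 < M + 1. Proof. by rewrite ltr_wpDl. Qed.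
Let M2 : 0 < 2 * M + 1. Proof. by rewrite ltr_wpDl// mulr_ge0. Qed.

Let approx x e : 0 < e -> exists u, `|x - i u| < e.
Proof.
move=> e0; have [|y [xy [u _ iu]]] := @cpl_dense _ _ _ C (ball x e) _ (ball_open x e).
  by exists x; exact: ballxx.
by exists u; rewrite iu; rewrite -ball_normE in xy.
Qed.

Let g_lip u v : `|g u - g v| <= M * `|i u - i v|.
Proof. by rewrite -!linearB cpl_norm. Qed.

Let limit x : exists w, forall u, `|g u - w| <= M * `|i u - x|.
Proof.
pose P := [set A : set W |
  exists2 e, 0 < e & forall u, `|x - i u| < e -> A (g u)].
have FP : ProperFilter P.
  apply: Build_ProperFilter_ex => [A [e e0 eA]|].
    by have [u /eA] := approx x e0; exists (g u).
  split; first by exists 1.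
    move=> A B [a a0 aA] [b b0 bB]; exists (Num.min a b); first by rewrite lt_min a0.
    by move=> u; rewrite lt_min => /andP[/aA ? /bB].
  by move=> A B AB [e e0 eA]; exists e => // u /eA /AB.
have /cauchy_cvg/cvg_ex[/= w Pw] : cauchy P.
  apply: cauchy_exP => e e0.
  have d0 : 0 < e / (2 * M + 1) by rewrite divr_gt0.
  have [u xu] := approx x d0; exists (g u); exists (e / (2 * M + 1)) => // v xv.
  rewrite -ball_normE /=; apply: (le_lt_trans (g_lip _ _)).
  have : `|i u - i v| <= 2 * (e / (2 * M + 1)).
    rewrite (le_trans (ler_distD x _ _))// mulr_natl mulr2n.
    by rewrite lerD ?(distrC _ x)// ltW.
  move=> /(ler_wpM2l M0) /le_lt_trans; apply.
  by rewrite !mulrA ltr_pdivrMr// (mulrC M) (mulrC e) ltr_pM2r// ltrDl.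
exists w => u; apply/ler_addgt0Pr => e e0.
have d0 : 0 < e / (M + 1) by rewrite divr_gt0.
have [a a0 aP] : P (ball w (e / (M + 1))) by apply: Pw; exact: nbhsx_ballx.
have [|v] := approx x (e := Num.min a (e / (M + 1))); first by rewrite lt_min a0.
rewrite lt_min => /andP[/aP]; rewrite -ball_normE /= => wv xv.
rewrite (le_trans (ler_distD (g v) _ _))//.
have -> : M * `|i u - x| + e = M * (`|i u - x| + e / (M + 1)) + e / (M + 1).
  rewrite mulrDr -addrA; congr (_ + _).
  by rewrite -[X in _ + X]mul1r -mulrDl mulrC divfK// gt_eqF.
rewrite lerD//; last by rewrite distrC ltW.
rewrite (le_trans (g_lip _ _))// ler_wpM2l//.
by rewrite (le_trans (ler_distD x _ _))// lerD// ltW.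
Qed.

Lemma completion_extend : exists U : 'L(C, W),
  (forall u, U (i u) = g u) /\ `|U| <= M.
Proof.
have [U Ug] := choice limit.
have small (y : W) K : 0 <= K -> (forall e, 0 < e -> `|y| <= K * e) -> y = 0.
  move=> K0 yK; apply/eqP; rewrite -normr_le0; apply/ler_addgt0Pr => e e0.
  have K1 : 0 < K + 1 by rewrite ltr_wpDl.
  rewrite add0r (le_trans (yK (e / (K + 1)) _)) ?divr_gt0//.
  by rewrite mulrA ler_pdivrMr// mulrC ler_wpM2l ?ltW// ltrDl.
have linU : linear U.
  move=> a x y; apply/eqP; rewrite -subr_eq0; apply/eqP.
  apply: (small _ (2 * M * (`|a| + 1))) => [|e e0].
    by rewrite !mulr_ge0// addr_ge0.
  have [u xu] := approx x e0; have [v yv] := approx y e0.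
  have -> : U (a *: x + y) - (a *: U x + U y) =
      - (g (a *: u + v) - U (a *: x + y)) + (a *: (g u - U x) + (g v - U y)).
    rewrite (linearP g) opprB scalerBr.
    by rewrite (addrACA (a *: g u)) -opprD subrKA.
  have E1 : `|g (a *: u + v) - U (a *: x + y)| <= M * ((`|a| + 1) * e).
    rewrite (le_trans (Ug _ _))// ler_wpM2l// (linearP i) opprD addrACA -scalerBr.
    rewrite (le_trans (ler_normD _ _))// normrZ mulrDl mul1r.
    by rewrite lerD ?ler_wpM2l// distrC ltW.
  have E2 : `|a *: (g u - U x) + (g v - U y)| <= M * ((`|a| + 1) * e).
    rewrite (le_trans (ler_normD _ _))// normrZ mulrDl mul1r mulrDr mulrCA.
    rewrite lerD ?ler_wpM2l// (le_trans (Ug _ _))// ler_wpM2l//.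
      by rewrite distrC ltW.
    by rewrite distrC ltW.
  rewrite (le_trans (ler_normD _ _))// normrN (le_trans (lerD E1 E2))//.
  by rewrite -mulr2n -[leLHS]mulr_natl !mulrA.
have bndU x : `|U x| <= M * `|x|.
  apply/ler_addgt0Pr => e e0.
  have d0 : 0 < e / (2 * M + 1) by rewrite divr_gt0.
  have [u xu] := approx x d0.
  rewrite -[U x](subrK (g u)) (le_trans (ler_normD _ _))// distrC.
  have A1 : `|g u - U x| <= M * (e / (2 * M + 1)).
    by rewrite (le_trans (Ug _ _))// ler_wpM2l// distrC ltW.
  have A2 : `|g u| <= M * (`|x| + e / (2 * M + 1)).
    rewrite (le_trans (gM _))// ler_wpM2l// -(cpl_norm C) -[i u](subrK x).
    by rewrite (le_trans (ler_normD _ _))// addrC lerD// distrC ltW.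
  rewrite (le_trans (lerD A1 A2))// mulrDr addrCA lerD2l -mulr2n -[leLHS]mulr_natl.
  rewrite !mulrA ler_pdivrMr//.
  by rewrite mulrDr mulr1 (mulrC e) lerDl ltW.
have Ubop : U \in @bop_pred R C W by apply/asboolP; split => //; exists M.
exists (BOp Ubop); split => [u|/=]; last exact: opnorm_lub.
apply/eqP; rewrite eq_sym -subr_eq0 -normr_le0.
by rewrite (le_trans (Ug _ _))// subrr normr0 mulr0.
Qed.

Lemma completion_ext (U U' : 'L(C, W)) : (forall u, U (i u) = U' (i u)) -> U = U'.
Proof.
move=> UU'; apply: bopP => x; apply/eqP; rewrite -subr_eq0 -normr_le0.
apply/ler_addgt0Pr => e e0; rewrite add0r.
have K0 : 0 < `|U - U'| + 1 by rewrite ltr_wpDl.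
have [u xu] := approx x (divr_gt0 e0 K0).
have -> : U x - U' x = (U - U') (x - i u).
  by rewrite linearB -[X in _ = _ - X]/(U (i u) - U' (i u)) UU' subrr subr0.
rewrite (le_trans (opnorm_le _ _))// (le_trans (ler_wpM2l _ (ltW xu))) ?opnorm_ge0//.
by rewrite mulrA ler_pdivrMr// mulrC ler_pM2l// lerDl.
Qed.

End extension.

Definition crossnorm_family (R : realType) :=
  forall E F : completeNormedModType R, tensor E F -> R.

(* uniform_map says that T \ox S has norm at most `|T| * `|S| on the algebraic
   tensor product; tensor_opP below gives the extension to the completions, with
   the same bound. *)
Record uniform_crossnorm (R : realType) (alpha : crossnorm_family R) : Prop :=
    UniformCrossnorm {
  uniform_reasonable : forall E F : completeNormedModType R,
    reasonable_crossnorm (@alpha E F);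
  uniform_map : forall (E1 E2 F1 F2 : completeNormedModType R)
      (T : 'L(E1, E2)) (S : 'L(F1, F2)) (u : tensor E1 F1),
    alpha _ _ (tensor_map T S u) <= `|T| * `|S| * alpha _ _ u }.

(* the extension of T \ox S to the completions: it exists by tensor_opP and is
   unique by completion_ext *)
Definition tensor_op (R : realType) (alpha : crossnorm_family R)
    (E1 E2 F1 F2 : completeNormedModType R)
    (C1 : completion (@alpha E1 F1)) (C2 : completion (@alpha E2 F2))
    (T : 'L(E1, E2)) (S : 'L(F1, F2)) : 'L(C1, C2) :=
  xget 0 [set U : 'L(C1, C2) |
    forall u, U (cpl_inj C1 u) = cpl_inj C2 (tensor_map T S u)].

Lemma tensor_opP (R : realType) (alpha : crossnorm_family R)
    (E1 E2 F1 F2 : completeNormedModType R)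
    (C1 : completion (@alpha E1 F1)) (C2 : completion (@alpha E2 F2))
    (T : 'L(E1, E2)) (S : 'L(F1, F2)) : uniform_crossnorm alpha ->
  (forall u, tensor_op C1 C2 T S (cpl_inj C1 u) =
             cpl_inj C2 (tensor_map T S u)) /\
  `|tensor_op C1 C2 T S| <= `|T| * `|S|.
Proof.
move=> alphaU; have alphaM u :
    `|(cpl_inj C2 \o tensor_map T S) u| <= `|T| * `|S| * @alpha E1 F1 u.
  by rewrite /= cpl_norm; exact: uniform_map.
have TS0 : 0 <= `|T| * `|S| by rewrite mulr_ge0.
have [U [UE UM]] := completion_extend C1 alphaM TS0.
rewrite /tensor_op; case: xgetP => [U' _ U'E|/(_ U)//].
split=> //; apply: opnorm_lub => [|x]; first by rewrite mulr_ge0.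
have -> : U' = U; last first.
  by rewrite (le_trans (opnorm_le _ _))// ler_wpM2r.
by apply: (@completion_ext _ _ _ C1 C2) => u; rewrite U'E UE.
Qed.

(* Paths on [0, +oo[ are functions on R whose values at negative times are
   never used. *)
Section paths.
Variables (R : realType) (V : normedModType R).
Implicit Type X : R -> V.

Definition cadlag X :=
  (forall t, 0 <= t -> X x @[x --> t^'+] --> X t) /\
  (forall t, 0 < t -> cvg (X x @[x --> t^'-])).

Definition left_lim X (t : R) : V := lim (X x @[x --> t^'-]).

Definition jump X (t : R) : V := if 0 < t then X t - left_lim X t else 0.

(* increment over ]r, s] of the path stopped at t *)
Definition incr X (t r s : R) : V := X (Num.min s t) - X (Num.min r t).

Definition total_var X (a b : R) : \bar R :=
  ereal_sup [set (let Y := X \o nth b (a :: s) in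
                  \sum_(0 <= n < size s) `|Y n.+1 - Y n|)%:E
            | s in itv_partition a b].

Definition finite_variation X := forall t, 0 <= t -> (total_var X 0 t < +oo)%E.

Definition big_jumps X (e : R) : set R := [set t | e < `|jump X t|].

(* for a cadlag path the sum is finite when 0 < e *)
Definition jump_part X (e t : R) : V :=
  \sum_(s \in [set s | 0 < s <= t] `&` big_jumps X e) jump X s.

(* The jumps on ]0, t] are summed as an unordered (possibly uncountable) family:
   the limit is along the finite subsets of R, directed by inclusion. *)
Definition purely_discontinuous X :=
  [/\ cadlag X, finite_variation X &
  forall t, 0 <= t ->
    (fun J : {fset R} => \sum_(s <- J | 0 < s <= t) jump X s) @
      filter_from [set: {fset R}] (fun J => [set K | (J `<=` K)%fset])
    --> X t - X 0].

End paths.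

Section time_partitions.
Variable R : realType.

Record time_partition := TimePartition {
  part_pt :> nat -> R;
  part_pt0 : part_pt 0%N = 0;
  part_pt_lt : forall i, part_pt i < part_pt i.+1;
  part_pt_cvg : part_pt @ \oo --> +oo }.

Implicit Type p : time_partition.

(* the index of the element ]p i, p i.+1] that contains t, for 0 < t *)
Definition part_idx p (t : R) : nat := xget 0%N [set i | p i < t <= p i.+1].

Definition lower_pt p t : R := p (part_idx p t).
Definition upper_pt p t : R := p (part_idx p t).+1.

(* Sum of S r s over the elements ]r, s] of p; it is only applied to summands
   that vanish for large r. *)
Definition part_sum (W : normedModType R) p (S : R -> R -> W) : W :=
  limn (fun N => \sum_(0 <= i < N) S (p i) (p i.+1)).

Variable V : normedModType R.
Implicit Type Z : R -> V.

(* 0 is added so that the supremum is 0, rather than -oo, when t = 0. *)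
Definition oscillation Z p (t : R) : \bar R :=
  ereal_sup ([set 0%E] `|` [set x | exists i u v,
    [/\ p i < u <= p i.+1, p i < v <= p i.+1, u <= t, v <= t &
        x = `|Z u - Z v|%:E]]).

Variable pi : nat -> time_partition.

Definition condition_C1 Z := forall t e, 0 <= t -> 0 < e ->
  \forall n \near \oo, forall i u v,
    big_jumps Z e u -> big_jumps Z e v -> u <= t -> v <= t ->
    pi n i < u <= pi n i.+1 -> pi n i < v <= pi n i.+1 -> u = v.

Definition condition_C2 Z := forall s t, jump Z s != 0 -> s <= t ->
  incr Z t (lower_pt (pi n) s) (upper_pt (pi n) s) @[n --> \oo] --> jump Z s.

Definition condition_C3 Z := forall t, 0 <= t ->
  limf_esup (fun e => limn_esup (fun n =>
    oscillation (Z \- jump_part Z e) (pi n) t)) 0^'+ = 0%E.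

Definition condition_C Z := [/\ condition_C1 Z, condition_C2 Z & condition_C3 Z].

Definition approx_left Z := forall t, 0 < t ->
  Z (lower_pt (pi n) t) @[n --> \oo] --> left_lim Z t.

Definition finite_2variation Z := forall t, 0 <= t ->
  (ereal_sup [set (part_sum (pi n) (fun r s => `|incr Z t r s| ^+ 2 : R^o))%:E
             | n in [set: nat]] < +oo)%E.

End time_partitions.

(* the topology, norm or weak, in which quadratic variations and integrals
   converge *)
Variant mode := Strong | Weak.

Definition cvg_mode (R : realType) (V : normedModType R) (m : mode)
    (u : nat -> V) (l : V) : Prop :=
  match m with
  | Strong => u n @[n --> \oo] --> l
  | Weak => forall phi : 'L(V, R^o), phi (u n) @[n --> \oo] --> phi l
  end.

Definition tensor_qv (R : realType) (alpha : crossnorm_family R)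
    (E : completeNormedModType R) (EE : completion (@alpha E E)) (m : mode)
    (pi : nat -> time_partition R) (X : R -> E) (Q : R -> EE) : Prop :=
  [/\ cadlag Q, finite_variation Q,
      forall t, 0 <= t -> cvg_mode m (fun n =>
        part_sum (pi n) (fun r s => cpl_inj EE (incr X t r s \ox incr X t r s)))
        (Q t) &
      forall t, 0 <= t -> jump Q t = cpl_inj EE (jump X t \ox jump X t)].

(* Stieltjes integral over ]0, t] of an operator-valued H against a path g of
   finite variation: the extension of the integral of step functions to the
   Bochner integrable functions with respect to the variation measure |dg|. *)
Section stieltjes.
Variables (R : realType) (V W : normedModType R).

Record step := Step { step_l : R; step_r : R; step_op : 'L(V, W) }.

Definition step_fun (h : seq step) (x : R) : 'L(V, W) :=
  \sum_(k <- h | step_l k < x <= step_r k) step_op k.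

Definition step_int (h : seq step) (g : R -> V) : W :=
  \sum_(k <- h) step_op k (g (step_r k) - g (step_l k)).

Definition variation_measure (g : R -> V)
    (mu : {measure set (measurableTypeR R) -> \bar R}) :=
  forall a b : R, 0 <= a -> a <= b -> mu `]a, b]%classic = total_var g a b.

Definition is_stieltjes (g : R -> V) (H : R -> 'L(V, W)) (t : R) (I : W) :=
  exists mu : {measure set (measurableTypeR R) -> \bar R},
  variation_measure g mu /\
  exists h : nat -> seq step,
  [/\ forall n, all (fun k => [&& 0 <= step_l k, step_l k <= step_r k & step_r k <= t]) (h n),
      forall n, measurable_fun (`]0, t]%classic : set (measurableTypeR R))
        (fun s => `|H s - step_fun (h n) s| : measurableTypeR R),
      (\int[mu]_(s in `]0%R, t]) `|H s - step_fun (h n) s|%:E)%E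
        @[n --> \oo] --> 0%E &
      step_int (h n) g @[n --> \oo] --> I].

End stieltjes.

(* Y is the Ito-Foellmer integral of K(A-, X-) against X *)
Definition ito_follmer (R : realType) (E F G : normedModType R) (m : mode)
    (pi : nat -> time_partition R) (K : F * E -> 'L(E, G))
    (A : R -> F) (X : R -> E) (Y : R -> G) : Prop :=
  forall t, 0 <= t -> cvg_mode m
    (fun n => part_sum (pi n) (fun r s => K (A r, X r) (incr X t r s))) (Y t).

(* T is the Gateaux derivative of f at x.  For W = 'L(E, G) the difference
   quotients converge in operator norm. *)
Definition gateaux (R : realType) (V W : normedModType R) (f : V -> W) (x : V)
    (T : 'L(V, W)) : Prop :=
  forall v, is_derive x v f (T v).

Definition compactly_continuous (S S' : topologicalType) (f : S -> S') : Prop :=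
  forall K : set S, compact K -> {within K, continuous f}.

(* Main.v *)
Require Import Defs.
From HB Require Import structures.
From mathcomp Require Import all_boot all_order all_algebra.
From mathcomp Require Import sesquilinear finmap.
From mathcomp Require Import all_classical all_reals all_analysis.
From mathcomp Require Import measurable_realfun.
From mathcomp Require Import ring lra.

Set Implicit Arguments.
Unset Strict Implicit.
Unset Printing Implicit Defensive.

Import Order.TTheory GRing.Theory Num.Theory.
Import numFieldNormedType.Exports.

Local Open Scope classical_set_scope.
Local Open Scope ring_scope.

(** Put Z = (A, X) and let I = ]r, s] run through the n-th partition.  Taylor's
    formula gives
      df(Z)(I) - Dxf(Z_r) dX(I) = Daf(Z_r) dA(I) + 1/2 D2f(Z_r) dX(I)^{(x)2} + rem(I).
    Summed over I, the first two terms on the right converge to the Stieltjes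
    integrals of Daf(Z_-) and 1/2 D2f(Z_-) against A and [X,X], because a cadlag
    integrand is, up to e, constant between finitely many times, and the partition
    intervals around these times contribute nothing in the limit.  The remainders
    converge in norm to the sum over the jumps: only finitely many intervals
    contain a big jump, and on the others rem(I) is small compared with
    |dA(I)| + |dX(I)|^2.  Hence the Ito-Foellmer sums converge to Y = f(Z) - B with
    B of finite variation, and B splits into its jump sum D and a continuous C.

    For the quadratic variation of Y, put rho(I) = dY(I) - Dxf(Z_r) dX(I).  The
    sums of |rho(I)| are bounded, so it is enough that the maximum of |rho(I)|
    tends to 0; then the sums of dY(I)^{(x)2} and (Dxf(Z_r) dX(I))^{(x)2} have the
    same limit.  Along an ultrafilter the end points of a bad sequence of intervals
    converge.  If their limits differ, approximation from the left forces Z, hence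
    also Y, to be constant in between; so in all cases dY(I) and Dxf(Z_r) dX(I)
    either both tend to 0 or both tend to the jump of Y at one time. *)

(** * Functionals, operators and modes of convergence *)

(** The weak mode shapes the argument. In it the sums of the squares of dX(I) converge only weakly,
    and operators that vary with I need not respect such a limit. A Riemann sum is therefore
    compared with finitely many fixed operators applied to increments in t of the sums of squares:
    fixed bounded operators preserve weak convergence, and the rest of the error is small in norm.

    The derivatives are continuous on compact sets only. The closed ranges of A and X over [0, t]
    are compact, and so are the sets of segments between their points, on which the mean value
    theorem evaluates the derivatives. Continuity of f on compact sets is drawn from the expansion
    itself.

    Functionals that attain the norm of a given vector reduce the mean value estimates and the
    uniqueness of weak limits to the real line. The Stieltjes integrals all come from one
    construction and are afterwards used only through a local estimate: over an interval where the
    integrand stays within e of its initial value, the integral differs from that value applied to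
    the increment by at most e times the variation. Jumps, variation and convergence of Riemann sums
    follow from it. *)

Section hahn_banach.
Variables (R : realType) (V : normedModType R).
Implicit Type G : set (V * R).

Let good G :=
  (forall a p q, G p -> G q -> G (a *: p.1 + q.1, a * p.2 + q.2)) /\
  (forall p, G p -> p.2 <= `|p.1|).

(** The one-dimensional step of the Hahn-Banach theorem: the value [c] at [y] has to lie between the
    lower bounds collected in [S] and the upper bounds of [S_ub]; it is taken to be the supremum of
    the lower ones. *)
Let good_extend G y : good G -> G (0, 0) ->
  exists G', [/\ good G', G `<=` G' & exists c, G' (y, c)].
Proof.
move=> [Glin Gle] G0.
pose S := [set p.2 - `|p.1 - y| | p in G].
have S_ub q : G q -> ubound S (`|q.1 + y| - q.2).
  move=> Gq _ [p Gp <-]; rewrite lerBlDr addrAC lerBrDr.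
  have := Gle _ (Glin 1 _ _ Gp Gq); rewrite /= scale1r mul1r => /le_trans.
  apply; rewrite (_ : p.1 + q.1 = (q.1 + y) + (p.1 - y)) ?ler_normD//.
  by rewrite addrACA subrr addr0 addrC.
have supS : has_sup S by split; [exists (0 - `|0 - y|), (0, 0)|exists (`|0 + y| - 0); exact: S_ub G0].
pose c := sup S.
have c1 p : G p -> p.2 - c <= `|p.1 - y|.
  by move=> Gp; rewrite lerBlDr -lerBlDl; apply: ub_le_sup; [case: supS|exists p].
have c2 p : G p -> p.2 + c <= `|p.1 + y|.
  by move=> Gp; rewrite -lerBrDl; apply: ge_sup; [case: supS|exact: S_ub].
exists [set u | exists a p, G p /\ u = (p.1 + a *: y, p.2 + a * c)]; split.
- split=> [k _ _ [a [p [Gp ->]]] [b [q [Gq ->]]]|_ [a [p [Gp ->]]]] /=.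
    exists (k * a + b), (k *: p.1 + q.1, k * p.2 + q.2); split; first exact: Glin.
    congr (_, _) => /=; last by ring.
    by rewrite scalerDr scalerDl scalerA addrACA.
  have [a0|a0|->] := ltgtP a 0; last by rewrite scale0r mul0r !addr0 Gle.
  - have := c1 _ (Glin (- a)^-1 _ _ Gp G0); rewrite /= !addr0.
    have na : 0 < - a by rewrite oppr_gt0.
    rewrite -(ler_pM2l na) mulrBr mulrA divff ?gt_eqF// mul1r mulNr opprK.
    move=> /le_trans; apply; rewrite -{1}(gtr0_norm na) -normrZ scalerBr scalerA.
    by rewrite divff ?gt_eqF// scale1r scaleNr opprK.
  - have := c2 _ (Glin a^-1 _ _ Gp G0); rewrite /= !addr0.
    rewrite -(ler_pM2l a0) mulrDr mulrA divff ?gt_eqF// mul1r.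
    move=> /le_trans; apply; rewrite -{1}(gtr0_norm a0) -normrZ scalerDr scalerA.
    by rewrite divff ?gt_eqF// scale1r.
- by move=> [p r] Gp; exists 0, (p, r); rewrite /= scale0r mul0r !addr0.
- by exists c, 1, (0, 0); rewrite /= scale1r mul1r !add0r.
Qed.

(* Functionals dominated by the norm are represented by their graphs, to which
   Zorn's lemma for inclusion applies. *)
Lemma norming_functional (x0 : V) :
  exists2 phi : 'L(V, R^o), phi x0 = `|x0| & forall x, `|phi x| <= `|x|.
Proof.
pose L : set (V * R) := [set (a *: x0, a * `|x0|) | a in [set: R]].
have goodL : good L.
  split=> [k _ _ [a _ <-] [b _ <-]|_ [a _ <-]] /=; last first.
    by rewrite normrZ ler_wpM2r// ler_norm.
  by exists (k * a + b) => //=; rewrite scalerDl scalerA mulrDl mulrA.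
(* Goodness is required of the union with the line [L], so that the empty chain, whose union is
   empty, is admissible too. *)
have [|A [[Alin Ale] Amax]] := @Zorn_bigcup _ [set G | good (G `|` L)].
  move=> F FP Ftot; split.
  - move=> a p q [[X FX Xp]|Lp] [[Y FY Yq]|Lq].
    + have [XY|YX] := Ftot _ _ FX FY.
        have [|h|h] := (FP _ FY).1 a p q _ (or_introl Yq); last by right.
          by left; exact: XY.
        by left; exists Y.
      have [|h|h] := (FP _ FX).1 a p q (or_introl Xp); last by right.
        by left; exact: YX.
      by left; exists X.
    + have [h|h] := (FP _ FX).1 a p q (or_introl Xp) (or_intror Lq); last by right.
      by left; exists X.
    + have [h|h] := (FP _ FY).1 a p q (or_intror Lp) (or_introl Yq); last by right.
      by left; exists Y.
    + by right; exact: goodL.1.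
  - by move=> p [[X FX Xp]|/goodL.2//]; apply: (FP _ FX).2; left.
pose M := A `|` L.
have M0 : M (0, 0) by right; exists 0 => //; rewrite scale0r mul0r.
have Mtot y : exists r, M (y, r).
  have [G' [goodG' MG' [c G'c]]] := good_extend y (conj Alin Ale) M0.
  apply: contrapT => /forallNP nM.
  apply: (Amax G').
    split; first by move=> x Ax; apply: MG'; left.
    by move=> /(_ _ G'c) Ac; apply: (nM c); left.
  suff GL : G' `|` L = G' by rewrite /= GL.
  by apply/seteqP; split=> [x [//|Lx]|x]; [apply: MG'; right|left].
have Mle p q : M p -> M q -> p.1 = q.1 -> p.2 <= q.2.
  move=> Mp Mq pq; have := Ale _ (Alin (-1) _ _ Mq Mp).
  by rewrite /= pq scaleN1r addNr normr0 mulN1r addrC subr_le0.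
have Muniq y r s : M (y, r) -> M (y, s) -> r = s.
  by move=> Mr Ms; apply: le_anti; rewrite (Mle _ _ Mr Ms)// (Mle _ _ Ms Mr).
have [phi Mphi] := choice Mtot.
have phi_lin : linear (phi : V -> R^o).
  move=> a x y; have := Alin a _ _ (Mphi x) (Mphi y).
  by move=> /= /(Muniq _ _ _ (Mphi _)).
have phi_le x : `|phi x| <= `|x|.
  rewrite ler_norml (Ale _ (Mphi x)) andbT lerNl -normrN.
  have := Alin (-1) _ _ (Mphi x) M0.
  by rewrite /= !addr0 scaleN1r mulN1r => /Ale.
have phi_bop : (phi : V -> R^o) \in @bop_pred R V R^o.
  by apply/asboolP; split => //; exists 1 => x; rewrite mul1r.
exists (BOp phi_bop) => //=; apply: (Muniq _ _ _ (Mphi _)).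
by right; exists 1 => //; rewrite scale1r mul1r.
Qed.

End hahn_banach.

Section operators_and_modes.
Variables (R : realType).
Implicit Types V W U : normedModType R.

Lemma bopD V W (T : 'L(V, W)) x y : T (x + y) = T x + T y.
Proof. exact: linearD. Qed.

Lemma bopN V W (T : 'L(V, W)) x : T (- x) = - T x.
Proof. exact: linearN. Qed.

Lemma bopB V W (T : 'L(V, W)) x y : T (x - y) = T x - T y.
Proof. exact: linearB. Qed.

Lemma bop0 V W (T : 'L(V, W)) : T 0 = 0.
Proof. exact: linear0. Qed.

Lemma bopZ V W (T : 'L(V, W)) (a : R) x : T (a *: x) = a *: T x.
Proof. exact: linearZ. Qed.

Lemma bop_continuous V W (T : 'L(V, W)) : continuous T.
Proof.
have K0 : 0 < opnorm T + 1 by rewrite ltr_wpDl// opnorm_ge0.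
move=> x; apply/cvgrPdist_le => e e0; near=> y; rewrite -bopB.
rewrite (le_trans (opnorm_le _ _))//.
apply: (@le_trans _ _ ((opnorm T + 1) * `|x - y|)).
  by rewrite ler_wpM2r// lerDl.
rewrite -ler_pdivlMl// mulrC; near: y.
apply: (@cvgr_dist_le _ _ _ (nbhs x) _ id x); first exact: cvg_id.
by rewrite divr_gt0.
Unshelve. all: by end_near. Qed.

Lemma bop_comp_subproof U V W (T : 'L(V, W)) (S : 'L(U, V)) :
  T \o S \in @bop_pred R U W.
Proof.
apply/asboolP; split=> [a x y /=|]; first by rewrite !linearP.
exists (opnorm T * opnorm S) => x /=; rewrite (le_trans (opnorm_le _ _))//.
by rewrite -mulrA ler_wpM2l ?opnorm_ge0// opnorm_le.
Qed.

Definition bop_comp U V W (T : 'L(V, W)) (S : 'L(U, V)) : 'L(U, W) :=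
  BOp (bop_comp_subproof T S).

Lemma cvg_mode_norm V m (u : nat -> V) l : u n @[n --> \oo] --> l ->
  cvg_mode m u l.
Proof.
case: m => //= ul phi.
by apply: continuous_cvg ul; exact: bop_continuous.
Qed.

Lemma cvg_modeD V m (u v : nat -> V) k l : cvg_mode m u k -> cvg_mode m v l ->
  cvg_mode m (fun n => u n + v n) (k + l).
Proof.
case: m => /= [|uk vl phi]; first exact: cvgD.
by under eq_fun do rewrite bopD; rewrite bopD; apply: cvgD; [exact: uk|exact: vl].
Qed.

Lemma cvg_mode_bop V W m (T : 'L(V, W)) (u : nat -> V) l : cvg_mode m u l ->
  cvg_mode m (fun n => T (u n)) (T l).
Proof.
case: m => /= [|ul phi]; last exact: (ul (bop_comp phi T)).
by apply: continuous_cvg; exact: bop_continuous.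
Qed.

Lemma cvg_modeN V m (u : nat -> V) k : cvg_mode m u k ->
  cvg_mode m (fun n => - u n) (- k).
Proof.
case: m => /= [|uk phi]; first exact: cvgN.
by under eq_fun do rewrite bopN; rewrite bopN; apply: cvgN; exact: uk.
Qed.

Lemma cvg_modeB V m (u v : nat -> V) k l : cvg_mode m u k -> cvg_mode m v l ->
  cvg_mode m (fun n => u n - v n) (k - l).
Proof. by move=> uk /cvg_modeN; exact: cvg_modeD. Qed.

(** Weak limits are unique because some functional attains the norm of [k - l]. *)
Lemma cvg_mode_unique V m (u : nat -> V) k l : cvg_mode m u k -> cvg_mode m u l ->
  k = l.
Proof.
case: m => /= [|uk ul]; first exact: cvg_unique.
have [phi phikl _] := norming_functional (k - l).
apply/eqP; rewrite -subr_eq0 -normr_le0 -phikl bopB subr_le0.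
by rewrite (cvg_unique _ (uk phi) (ul phi)).
Qed.

(** This treats both modes at once: for each tolerance, the error splits into a sequence [a] that is
    null in the mode [m] and a part that is small in norm. The sequence may depend on the
    tolerance. *)
Lemma cvg_mode_approx V m (u : nat -> V) l :
  (forall e, 0 < e -> exists2 a, cvg_mode m a 0 &
    \forall n \near \oo, `|u n - l - a n| <= e) -> cvg_mode m u l.
Proof.
case: m => /= H => [|phi]; apply/cvgrPdist_le => e e0.
  have [a a0 ua] := H (e / 2) ltac:(by rewrite divr_gt0).
  near=> n; rewrite distrC -[_ - _](subrK (a n)).
  rewrite (le_trans (ler_normD _ _))// [e]splitr lerD//; first by near: n.
  by rewrite -[a n]subr0 -normrN opprB; near: n; apply: cvgr_dist_le => //; rewrite divr_gt0.
have K0 : 0 < opnorm phi + 1 by rewrite ltr_wpDl// opnorm_ge0.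
have [a a0 ua] := H (e / 2 / (opnorm phi + 1)) ltac:(by rewrite !divr_gt0).
have {}a0 := a0 phi; rewrite bop0 in a0.
near=> n; rewrite distrC -bopB -[_ - _](subrK (a n)) bopD.
rewrite (le_trans (ler_normD _ _))// [e]splitr lerD//.
  rewrite (le_trans (opnorm_le _ _))//.
  apply: (@le_trans _ _ ((opnorm phi + 1) * `|u n - l - a n|)).
    by rewrite ler_wpM2r// lerDl.
  by rewrite -ler_pdivlMl// mulrC; near: n.
by rewrite -[phi _]subr0 -normrN opprB; near: n; apply: cvgr_dist_le => //; rewrite divr_gt0.
Unshelve. all: by end_near. Qed.

End operators_and_modes.

Section functional_separation.
Variables (R : realType) (V : normedModType R).

Lemma functional_ext (x y : V) : (forall l : 'L(V, R^o), l x = l y) -> x = y.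
Proof.
move=> lxy; apply/eqP; rewrite -subr_eq0 -normr_eq0.
by have [l <- _] := norming_functional (x - y); rewrite bopB lxy subrr.
Qed.

Lemma functionalZ (l : 'L(V, R^o)) (a : R) (x : V) : l (a *: x) = a * l x.
Proof. exact: bopZ. Qed.

End functional_separation.

(* Vector identities become ring identities once every functional is applied to
   both sides. *)
Ltac vring := apply: functional_ext => ?;
  rewrite ?(bopB, bopD, bopN, functionalZ, bop0); ring.

(** * Cadlag paths and total variation *)

Section real_induction.
Variable R : realType.
Implicit Types (V W : normedModType R) (P : R -> Prop).

(** Real induction. The supremum of the initial segments on which [P] holds belongs to them by the
    third hypothesis, and the second one goes beyond it. *)
Lemma real_ind P : P 0 ->
  (forall x, 0 <= x -> P x -> exists2 d, 0 < d & forall y, x < y < x + d -> P y) ->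
  (forall x, 0 < x -> (forall y, 0 <= y < x -> P y) -> P x) ->
  forall t, 0 <= t -> P t.
Proof.
move=> P0 Pr Pl t t0; apply: contrapT => nPt.
pose S := [set x | 0 <= x /\ forall y, 0 <= y <= x -> P y].
have S0 : S 0 by split => // y y0; rewrite -(le_anti y0).
have St x : S x -> x <= t.
  by move=> [x0 Sx]; rewrite leNgt; apply/negP => /ltW tx; apply/nPt/Sx; rewrite t0.
have supS : has_sup S by split; [exists 0|exists t].
have s0 : 0 <= sup S by apply: sup_upper_bound.
have Plt y : 0 <= y < sup S -> P y.
  move=> /andP[y0 ys]; have [|x [x0 Sx]] := @sup_adherent _ S (sup S - y) _ supS.
    by rewrite subr_gt0.
  by rewrite opprB addrC subrK => /ltW yx; apply: Sx; rewrite y0.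
have Ps : P (sup S).
  move: s0; rewrite le_eqVlt => /predU1P[<-//|s0]; exact: Pl.
have [d d0 Pd] := Pr _ s0 Ps.
have : S (sup S + d / 2).
  split=> [|y /andP[y0 yd]]; first by rewrite addr_ge0// divr_ge0// ltW.
  have [ys|ys|->//] := ltgtP y (sup S); first by apply: Plt; rewrite y0.
  apply: Pd; rewrite ys/= (le_lt_trans yd)// ltrD2l; lra.
move=> /(sup_upper_bound supS); apply/negP; rewrite -ltNge; lra.
Qed.

Lemma cvg_rightP V (X : R -> V) t l : X x @[x --> t^'+] --> l <->
  forall e, 0 < e -> exists2 d, 0 < d & forall x, t < x < t + d -> `|l - X x| <= e.
Proof.
split=> [/cvgrPdist_le H e e0|H].
  have /nbhs_ballP[d d0 td] := H _ e0; exists d => // x /andP[tx xd].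
  by apply: td => //; rewrite /ball/= ltr_distlC; apply/andP; split; lra.
apply/cvgrPdist_le => e /H[d d0 td]; apply/nbhs_ballP; exists d => // x.
by rewrite /ball/= ltr_distlC => /andP[_ xd] tx; apply: td; rewrite tx.
Qed.

Lemma cvg_leftP V (X : R -> V) t l : X x @[x --> t^'-] --> l <->
  forall e, 0 < e -> exists2 d, 0 < d & forall x, t - d < x < t -> `|l - X x| <= e.
Proof.
split=> [/cvgrPdist_le H e e0|H].
  have /nbhs_ballP[d d0 td] := H _ e0; exists d => // x /andP[tx xd].
  by apply: td => //; rewrite /ball/= ltr_distlC; apply/andP; split; lra.
apply/cvgrPdist_le => e /H[d d0 td]; apply/nbhs_ballP; exists d => // x.
by rewrite /ball/= ltr_distlC => /andP[xd _] tx; apply: td; rewrite tx xd.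
Qed.

Lemma cadlag_left V (X : R -> V) t : cadlag X -> 0 < t ->
  X x @[x --> t^'-] --> left_lim X t.
Proof. by move=> [_ Xl] /Xl. Qed.

Lemma left_limE V (X : R -> V) t l : X x @[x --> t^'-] --> l -> left_lim X t = l.
Proof. by move=> /cvg_lim; apply. Qed.

(** This replaces the choice of a finite subdivision of [0, t] into intervals on which [H] varies by
    at most [e]. The right end point [v] is excluded from the oscillation, since [H] may jump
    there. *)
Lemma cadlag_ind V (H : R -> V) e P : cadlag H -> 0 < e -> P 0 ->
  (forall u v, 0 <= u -> u < v -> (forall x, u <= x < v -> `|H x - H u| <= e) ->
    P u -> P v) ->
  forall t, 0 <= t -> P t.
Proof.
move=> cH e0 P0 Puv; apply: real_ind => // [x x0 Px|x x0 Px].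
  have /cvg_rightP/(_ _ e0)[d d0 xd] := cH.1 _ x0.
  exists d => // y /andP[xy yd]; apply: (Puv x) => // z.
  rewrite le_eqVlt => /andP[/predU1P[<- _|xz zy]]; first by rewrite subrr normr0 ltW.
  by rewrite distrC xd// xz (lt_trans zy).
have /cvg_leftP/(_ (e / 2)) [|d d0 xd] := cadlag_left cH x0; first by rewrite divr_gt0.
pose u := Num.max 0 (x - d / 2).
have u0 : 0 <= u by rewrite le_max lexx.
have ux : u < x by rewrite gt_max x0/=; lra.
have du z : u <= z < x -> x - d < z < x.
  by rewrite ge_max => /andP[/andP[_ h] ->]; rewrite andbT; lra.
apply: (Puv u) => // [z zx|]; last by apply: Px; rewrite u0.
rewrite -(subrK (left_lim H x) (H z)) -addrA (le_trans (ler_normD _ _))//.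
rewrite [e]splitr lerD//; first by rewrite distrC xd// du.
by rewrite xd// du// lexx.
Qed.

Lemma pair_left_lim V W (X : R -> V) (Y : R -> W) t : cadlag X -> cadlag Y ->
  0 < t -> left_lim (fun t => (X t, Y t)) t = (left_lim X t, left_lim Y t).
Proof.
by move=> cX cY t0; apply: left_limE; apply: cvg_pair; exact: cadlag_left.
Qed.

Lemma cadlag_pair V W (X : R -> V) (Y : R -> W) : cadlag X -> cadlag Y ->
  cadlag (fun t => (X t, Y t)).
Proof.
move=> cX cY; split=> t t0; first by apply: cvg_pair; [exact: cX.1|exact: cY.1].
apply/cvg_ex; exists (left_lim X t, left_lim Y t).
by apply: cvg_pair; exact: cadlag_left.
Qed.

End real_induction.

Section total_variation_of_vector_paths.
Variables (R : realType) (V : normedModType R).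
Implicit Types (g : R -> V) (w : R -> R).

Fixpoint vsum g a (s : seq R) : R :=
  if s is x :: s' then `|g x - g a| + vsum g x s' else 0.

Lemma vsumE g a b s :
  \sum_(0 <= n < size s)
    `|(g \o nth b (a :: s)) n.+1 - (g \o nth b (a :: s)) n| = vsum g a s.
Proof.
elim: s a => [|x s IH] a /=; first by rewrite big_nil.
by rewrite big_nat_recl// -IH.
Qed.

Lemma total_varE g a b :
  total_var g a b = ereal_sup [set (vsum g a s)%:E | s in itv_partition a b].
Proof.
rewrite /total_var; congr ereal_sup; apply/seteqP.
by split=> _ [s abs <-]; exists s => //; rewrite vsumE.
Qed.

Lemma vsum_cat g a s1 s2 : vsum g a (s1 ++ s2) = vsum g a s1 + vsum g (last a s1) s2.
Proof. by elim: s1 a => [|x s IH] a /=; rewrite ?add0r// IH addrA. Qed.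

Lemma vsum_ge0 g a s : 0 <= vsum g a s.
Proof. by elim: s a => //= x s IH a; rewrite addr_ge0. Qed.

(** A real-valued substitute for the total variation: any path whose increments dominate those of
    [g] serves, and no extended real number appears. *)
Definition control w g t :=
  forall a b, 0 <= a -> a <= b -> b <= t -> `|g b - g a| <= w b - w a.

Lemma control_mono w g t a b : control w g t -> 0 <= a -> a <= b -> b <= t ->
  w a <= w b.
Proof. by move=> cw a0 ab bt; rewrite -subr_ge0 (le_trans _ (cw a b _ _ _)). Qed.

Lemma controlW w g t t' : t' <= t -> control w g t -> control w g t'.
Proof. by move=> t't cw a b a0 ab bt'; apply: cw => //; exact: le_trans bt' _. Qed.

Lemma vsum_control w g t a s : control w g t -> 0 <= a -> path <%R a s ->
  last a s <= t -> vsum g a s <= w (last a s) - w a.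
Proof.
move=> cw; elim: s a => [|x s IH] a a0 /=; first by rewrite subrr.
move=> /andP[ax xs] st; have x0 : 0 <= x by rewrite (le_trans a0)// ltW.
have xt : x <= t.
  by apply: le_trans st; exact: (itv_partition_le (conj xs (eqxx _))).
rewrite -[leRHS](subrKA (w x)) addrC lerD//; first exact: IH.
by apply: cw => //; exact: ltW.
Qed.

Lemma control_finite_variation g : (forall t, 0 <= t -> exists w, control w g t) ->
  finite_variation g.
Proof.
move=> cg t t0; have [w cw] := cg _ t0; rewrite total_varE.
apply: (@le_lt_trans _ _ (w t - w 0)%:E); last exact: ltry.
apply: ge_ereal_sup => _ [s [s0 /eqP st] <-]; rewrite lee_fin -st.
by apply: vsum_control cw _ _ _ => //; rewrite st.
Qed.

Lemma total_var_ge g a b : a <= b -> (`|g b - g a|%:E <= total_var g a b)%E.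
Proof.
rewrite le_eqVlt total_varE => /predU1P[->|ab]; apply: ereal_sup_ubound.
  by exists [::] => //=; rewrite subrr normr0.
by exists [:: b]; [exact: itv_partition1|rewrite /= addr0].
Qed.

Lemma total_var_ge0 g a b : a <= b -> (0 <= total_var g a b)%E.
Proof. by move=> /(total_var_ge g); apply: le_trans; rewrite lee_fin. Qed.

(** Inserting the point [c] into a partition can only enlarge its sum, by the triangle
    inequality. *)
Lemma vsum_split g a b c s : itv_partition a b s -> a <= c -> c <= b ->
  exists s1 s2, [/\ itv_partition a c s1, itv_partition c b s2 &
    vsum g a s <= vsum g a s1 + vsum g c s2].
Proof.
elim: s a => [|x s IH] a [/= + sb] ac cb.
  move=> _; move/eqP : sb => ab; have ca : c = a by apply/le_anti; rewrite ac ab cb.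
  exists [::], [::]; rewrite ca addr0; split; [by split=> /=|by split=> //=; exact/eqP|by []].
move=> /andP[ax xs]; have [ca|ac'] := leP c a.
  have {}ca : c = a by apply/le_anti; rewrite ac ca.
  exists [::], (x :: s); rewrite ca add0r; split; first by split=> /=.
    by split=> //=; rewrite ax.
  by [].
have [xc|cx] := leP x c.
  have [s1 [s2 [[p1 l1] p2 le12]]] := IH x (conj xs sb) xc cb.
  exists (x :: s1), s2; split => //; first by split => //=; rewrite ax.
  by rewrite /= -addrA lerD2l.
exists [:: c], (x :: s); split; first exact: itv_partition1.
  by split=> //=; rewrite cx.
rewrite /= addr0 addrA lerD2r addrC.
by rewrite (le_trans _ (ler_normD _ _))// subrKA.
Qed.

(** Splitting a partition at [c] gives one inequality, concatenating two partitions the other.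
    Finiteness allows the extended reals to be subtracted. *)
Lemma total_varD g a b c : a <= c -> c <= b -> (total_var g a b < +oo)%E ->
  total_var g a b = (total_var g a c + total_var g c b)%E.
Proof.
move=> ac cb gab; apply/eqP; rewrite eq_le; apply/andP; split.
  rewrite [leLHS]total_varE; apply: ge_ereal_sup => _ [s abs <-].
  have [s1 [s2 [p1 p2 le12]]] := vsum_split g abs ac cb.
  apply: (@le_trans _ _ (vsum g a s1 + vsum g c s2)%:E); first by rewrite lee_fin.
  rewrite EFinD leeD// total_varE; apply: ereal_sup_ubound.
    by exists s1.
  by exists s2.
have sub s1 : itv_partition a c s1 ->
    ((vsum g a s1)%:E + total_var g c b <= total_var g a b)%E.
  move=> p1; rewrite addeC -leeBrDr// (total_varE g c b).
  apply: ge_ereal_sup => _ [s2 p2 <-]; rewrite leeBrDr// addeC total_varE.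
  apply: ereal_sup_ubound; exists (s1 ++ s2); first exact: itv_partition_cat p1 p2.
  by case: p1 => _ /eqP s1c; rewrite vsum_cat s1c.
have [s0 p0] : exists s0, itv_partition a c s0.
  move: ac; rewrite le_eqVlt => /predU1P[->|ac]; first by exists [::].
  by exists [:: c]; exact: itv_partition1.
have fcb : total_var g c b \is a fin_num.
  rewrite ge0_fin_numE ?total_var_ge0//; apply: le_lt_trans gab.
  apply: le_trans (sub _ p0); rewrite leeDr// lee_fin; exact: vsum_ge0.
rewrite -leeBrDr// [leLHS]total_varE; apply: ge_ereal_sup => _ [s1 p1 <-].
by rewrite leeBrDr// sub.
Qed.

Variable (g : R -> V).
Hypothesis gfv : finite_variation g.

Definition tv t : R := fine (total_var g 0 t).

Lemma total_var_tv a b : 0 <= a -> a <= b -> total_var g a b = (tv b - tv a)%:E.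
Proof.
move=> a0 ab; have b0 := le_trans a0 ab.
rewrite EFinB /tv !fineK ?ge0_fin_numE ?total_var_ge0 ?gfv//.
by rewrite (total_varD a0 ab (gfv b0)) addeAC subee ?add0e// ge0_fin_numE
  ?total_var_ge0 ?gfv.
Qed.

Lemma tv_control t : control tv g t.
Proof.
by move=> a b a0 ab _; rewrite -lee_fin -total_var_tv// total_var_ge.
Qed.

Lemma tv_mono a b : 0 <= a -> a <= b -> tv a <= tv b.
Proof. by move=> a0 ab; exact: (control_mono (@tv_control b)). Qed.

(** Take a partition of [a, a + 1] that nearly attains the variation, with first point [x]. If [b]
    lies between [a] and [x] and [g b] is close to [g a], replacing [a] by [b] hardly changes the
    sum, so almost all of the variation is found after [b]. *)
Lemma tv_right_continuous a : cadlag g -> 0 <= a -> tv x @[x --> a^'+] --> tv a.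
Proof.
move=> cg a0; apply/cvg_rightP => e e0.
have aa : a <= a + 1 by rewrite lerDl.
have e2 : 0 < e / 2 by rewrite divr_gt0.
have [s ps es] : exists2 s, itv_partition a (a + 1) s &
    tv (a + 1) - tv a - e / 2 <= vsum g a s.
  apply: contrapT => /forall2NP H.
  have : (total_var g a (a + 1) <= (tv (a + 1) - tv a - e / 2)%:E)%E.
    rewrite total_varE; apply: ge_ereal_sup => _ [s ps <-]; rewrite lee_fin.
    by case: (H s) => // /negP; rewrite -ltNge => /ltW.
  by rewrite total_var_tv// lee_fin; apply/negP; rewrite -ltNge ltrBlDr ltrDl.
case: s ps es => [/itv_partition_nil /eqP|x s [/= /andP[ax xs] sa]]; first by lra.
move=> es; have /cvg_rightP/(_ _ e2)[d d0 gd] := cg.1 _ a0.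
exists (Num.min d (x - a)) => [|b /andP[ab]]; first by rewrite lt_min d0 subr_gt0.
rewrite -ltrBlDl lt_min => /andP[bd bx].
have {bd}gab : `|g a - g b| <= e / 2 by apply: gd; rewrite ab -ltrBlDl.
have {}bx : b < x by lra.
rewrite distrC ger0_norm; last by rewrite subr_ge0 tv_mono// ltW.
have b0 : 0 <= b by rewrite (le_trans a0)// ltW.
have ba1 : b <= a + 1.
  by apply: le_trans (ltW bx) _; exact: (itv_partition_le (conj xs sa)).
have : `|g x - g b| + vsum g x s <= tv (a + 1) - tv b.
  rewrite -lee_fin -total_var_tv//.
  rewrite total_varE; apply: ereal_sup_ubound; exists (x :: s) => //.
  by split => //=; rewrite bx.
have := ler_distD (g b) (g x) (g a); rewrite (distrC (g b) (g a)).
move: es => /=; lra.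
Qed.

End total_variation_of_vector_paths.

Section variation_measure.
Variables (R : realType) (V : normedModType R) (g : R -> V).
Hypotheses (cg : cadlag g) (gfv : finite_variation g).

(** The variation function extended by a constant to negative times, because a Lebesgue-Stieltjes
    measure is built from a function on the whole line. *)
Definition tvp (t : R) : R := tv g (Num.max 0 t).

Lemma tvp_mono : {homo tvp : x y / x <= y}.
Proof.
move=> x y xy; apply: tv_mono => //; first by rewrite le_max lexx.
by rewrite ge_max !le_max lexx xy orbT.
Qed.

Lemma tvp_right_continuous : right_continuous tvp.
Proof.
move=> x; apply/cvg_rightP => e e0; have [x0|x0] := leP 0 x.
  have /cvg_rightP/(_ _ e0)[d d0 xd] := tv_right_continuous gfv cg x0.
  exists d => // y xy; have y0 : 0 <= y.
    by case/andP : xy => xy _; rewrite (le_trans x0)// ltW.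
  by rewrite /tvp !max_r// xd.
exists (- x) => [|y]; first by rewrite oppr_gt0.
rewrite subrr => /andP[_ y0]; rewrite /tvp !max_l; [|exact: ltW..].
by rewrite subrr normr0 ltW.
Qed.

HB.instance Definition _ := @isCumulative.Build R _ R tvp tvp_mono tvp_right_continuous.

Lemma variation_measure_exists : exists mu, variation_measure g mu.
Proof.
exists (lebesgue_stieltjes_measure tvp) => a b a0 ab.
rewrite /= /lebesgue_stieltjes_measure /measure_extension.
rewrite measurable_mu_extE/=; last exact: is_ocitv.
by rewrite wlength_itv_bnd// total_var_tv// /tvp !max_r// (le_trans a0).
Qed.

End variation_measure.

(** * Stieltjes integrals *)

Section step_functions.
Variables (R : realType) (V W : normedModType R).
Implicit Types (g : R -> V) (w : R -> R) (h : seq (step V W)).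

Definition steps_in (a b : R) h :=
  all (fun k => [&& a <= step_l k, step_l k <= step_r k & step_r k <= b]) h.

Lemma step_int_cat h1 h2 g : step_int (h1 ++ h2) g = step_int h1 g + step_int h2 g.
Proof. by rewrite /step_int big_cat. Qed.

Lemma step_fun_cat h1 h2 x : step_fun (h1 ++ h2) x = step_fun h1 x + step_fun h2 x.
Proof. by rewrite /step_fun big_cat. Qed.

Definition steps_opp h := [seq Step (step_l k) (step_r k) (- step_op k) | k <- h].

Lemma step_int_opp h g : step_int (steps_opp h) g = - step_int h g.
Proof. by rewrite /step_int big_map -sumrN. Qed.

Lemma step_fun_opp h x : step_fun (steps_opp h) x = - step_fun h x.
Proof. by rewrite /step_fun big_map -sumrN. Qed.

Lemma step_fun_cons k h x : step_fun (k :: h) x =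
  (if step_l k < x <= step_r k then step_op k else 0) + step_fun h x.
Proof. by rewrite /step_fun big_cons; case: ifP => // _; rewrite add0r. Qed.

Lemma step_int_cons k h g : step_int (k :: h) g =
  step_op k (g (step_r k) - g (step_l k)) + step_int h g.
Proof. by rewrite /step_int big_cons. Qed.

Lemma step_fun0 a b h x : steps_in a b h -> (x <= a) || (b < x) -> step_fun h x = 0.
Proof.
move=> + xab; elim: h => [_|k h IH /= /andP[/and3P[ak _ kb] /IH hx]].
  by rewrite /step_fun big_nil.
rewrite step_fun_cons hx addr0 ifF//; apply/negbTE/negP => /andP[kx xk].
case/orP : xab => [xa|bx].
  by have := lt_le_trans kx (le_trans xa ak); rewrite ltxx.
by have := lt_le_trans bx (le_trans xk kb); rewrite ltxx.
Qed.

(** Every step is cut at [c]. A step on the other side of [c] collapses to an empty one, so no case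
    distinction is made. *)
Let stepsL c h :=
  [seq Step (Num.min (step_l k) c) (Num.min (step_r k) c) (step_op k) | k <- h].
Let stepsR c h :=
  [seq Step (Num.max (step_l k) c) (Num.max (step_r k) c) (step_op k) | k <- h].

Let step_int_split c h g :
  step_int h g = step_int (stepsL c h) g + step_int (stepsR c h) g.
Proof.
have gc x : g (Num.min x c) + g (Num.max x c) = g x + g c.
  by case: leP => // _; rewrite addrC.
elim: h => [|k h IH]; first by rewrite /step_int !big_nil addr0.
rewrite !step_int_cons IH addrACA; congr (_ + _); rewrite /= -bopD.
by rewrite addrACA -opprD !gc opprD addrACA subrr addr0.
Qed.

Let step_funL c h x : x <= c -> step_fun (stepsL c h) x = step_fun h x.
Proof.
move=> xc; elim: h => [|k h IH]; first by rewrite /step_fun !big_nil.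
by rewrite !step_fun_cons IH/= gt_min le_min xc andbT (ltNge c) xc orbF.
Qed.

Let step_funR c h x : c < x -> step_fun (stepsR c h) x = step_fun h x.
Proof.
move=> xc; elim: h => [|k h IH]; first by rewrite /step_fun !big_nil.
by rewrite !step_fun_cons IH/= gt_max le_max xc andbT (leNgt x c) xc orbF.
Qed.

Let steps_inL a b c h : a <= c -> steps_in a b h -> steps_in a c (stepsL c h).
Proof.
move=> ac; elim: h => //= k h IH /andP[/and3P[ak kk kb] /IH ->].
rewrite andbT; apply/and3P; split; first by rewrite le_min ak ac.
  by rewrite le_min !ge_min kk lexx orbT.
by rewrite ge_min lexx orbT.
Qed.

Let steps_inR a b c h : c <= b -> steps_in a b h -> steps_in c b (stepsR c h).
Proof.
move=> ac; elim: h => //= k h IH /andP[/and3P[ak kk kb] /IH ->].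
rewrite andbT; apply/and3P; split; first by rewrite le_max lexx orbT.
  by rewrite ge_max !le_max kk lexx orbT.
by rewrite ge_max kb ac.
Qed.

Let endpoints_in (s : seq R) h :=
  all (fun k => (step_l k \in s) && (step_r k \in s)) h.

(** If [a] and [b] are the only end points, the step function is constant on []a, b]], with value
    [step_fun h b], and the integral is this value applied to the increment. *)
Let step_int_base h g w a b e : control w g b -> 0 <= a -> a <= b ->
  steps_in a b h -> endpoints_in [:: a; b] h ->
  (forall x, a < x <= b -> `|step_fun h x| <= e) ->
  `|step_int h g| <= e * (w b - w a).
Proof.
move=> cw a0 ab hab hE he.
have -> : step_int h g = step_fun h b (g b - g a).
  elim: h hab hE {he} => [|k h IH]; first by rewrite /step_int /step_fun !big_nil.
  move=> /= /andP[/and3P[ak kk kb] hab] /andP[/andP[kl kr] hE].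
  rewrite step_int_cons step_fun_cons IH//; congr (_ + _).
  move: kl kr; rewrite !inE => /orP[]/eqP kl /orP[]/eqP kr; rewrite kl kr in ak kk kb *.
  - rewrite subrr bop0; case: ifP => // /andP[ab' ba].
    by have := lt_le_trans ab' ba; rewrite ltxx.
  - rewrite lexx andbT; case: ltP => // ba.
    have abE : a = b by apply/le_anti; rewrite ab ba.
    by rewrite abE subrr bop0.
  - have abE : a = b by apply/le_anti; rewrite ab kk.
    by rewrite abE subrr bop0 ltxx.
  - by rewrite subrr bop0 ltxx.
move: ab; rewrite le_eqVlt => /predU1P[->|ab]; first by rewrite !subrr bop0 mulr0 normr0.
rewrite (le_trans (opnorm_le _ _))// ler_pM ?opnorm_ge0//.
  by apply: he; rewrite ab lexx.
by apply: cw => //; exact: ltW.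
Qed.

(** Induction on the possible end points. A point [c] inside the interval cuts the integral into two
    for which [c] is a boundary point; a point outside cannot be an end point unless it is [a] or
    [b]. *)
Let step_int_bound_ind g w e cs a b h : control w g b -> 0 <= a -> a <= b ->
  steps_in a b h -> endpoints_in [:: a, b & cs] h ->
  (forall x, a < x <= b -> `|step_fun h x| <= e) ->
  `|step_int h g| <= e * (w b - w a).
Proof.
elim: cs a b h => [|c cs IH] a b h cw a0 ab hab hE he; first exact: step_int_base cw _ _ hab hE he.
have [/andP[ac cb]|ncab] := boolP (a < c < b); last first.
  apply: (IH _ _ h) => //.
  elim: h hab hE {he} => //= k h IHh /andP[/and3P[ak kk kb] hab] /andP[/andP[kl kr] hE].
  rewrite IHh// andbT.
  suff H x : a <= x -> x <= b -> x \in [:: a, b, c & cs] -> x \in [:: a, b & cs].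
    by rewrite !H// ?(le_trans ak)// (le_trans kk).
  move=> ax xb; rewrite !inE => /or4P[->//|->|/eqP xc|->]; rewrite ?orbT//.
  move: ncab; rewrite negb_and -!leNgt -xc => /orP[xa|bx].
    have xE : x = a by apply/le_anti; rewrite ax xa.
    by rewrite xE eqxx.
  have xE : x = b by apply/le_anti; rewrite xb bx.
  by rewrite xE eqxx orbT.
rewrite (step_int_split c) (le_trans (ler_normD _ _))//.
have -> : e * (w b - w a) = e * (w c - w a) + e * (w b - w c) by ring.
rewrite lerD//; last first.
- apply: (IH _ _ (stepsR c h)) => //; [by rewrite (le_trans a0)// ltW|exact: ltW| | |].
  + by apply: steps_inR hab; exact: ltW.
  + elim: h hab hE {he} => //= k h IHh /andP[/and3P[ak kk kb] hab] /andP[/andP[kl kr] hE].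
    rewrite IHh// andbT.
    suff H x : x \in [:: a, b, c & cs] -> Num.max x c \in [:: c, b & cs] by rewrite !H.
    rewrite !inE => /or4P[/eqP->|/eqP->|/eqP->|xs].
    * by rewrite max_r ?eqxx// ltW.
    * by rewrite max_l ?eqxx ?orbT// ltW.
    * by rewrite maxxx eqxx.
    * by case: leP; rewrite ?eqxx// xs !orbT.
  + by move=> x /andP[cx xb]; rewrite step_funR// he// xb (lt_trans ac).
- apply: (IH _ _ (stepsL c h)) => //.
  + by apply: controlW cw; exact: ltW.
  + exact: ltW.
  + by apply: (steps_inL _ hab); exact: ltW.
  + elim: h hab hE {he} => //= k h IHh /andP[/and3P[ak kk kb] hab] /andP[/andP[kl kr] hE].
    rewrite IHh// andbT.
    suff H x : x \in [:: a, b, c & cs] -> Num.min x c \in [:: a, c & cs] by rewrite !H.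
    rewrite !inE => /or4P[/eqP->|/eqP->|/eqP->|xs].
    * by rewrite min_l ?eqxx// ltW.
    * by rewrite min_r ?eqxx ?orbT// ltW.
    * by rewrite minxx eqxx orbT.
    * by case: leP; rewrite ?eqxx ?orbT// xs !orbT.
  + by move=> x /andP[ax xc]; rewrite step_funL// he// ax (le_trans xc)// ltW.
Qed.

(** Steps may overlap and cancel, so the integral cannot be estimated term by term: all end points
    are used as cuts. *)
Lemma step_int_bound g w e a b h : control w g b -> 0 <= a -> a <= b ->
  steps_in a b h -> (forall x, a < x <= b -> `|step_fun h x| <= e) ->
  `|step_int h g| <= e * (w b - w a).
Proof.
move=> cw a0 ab hab he.
apply: (@step_int_bound_ind _ _ _ (map (@step_l _ _ _) h ++ map (@step_r _ _ _) h) _ _ h) => //.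
have : endpoints_in (map (@step_l _ _ _) h ++ map (@step_r _ _ _) h) h.
  elim: h {hab he} => //= k h IH; rewrite !inE !mem_cat !inE !eqxx !orbT/=.
  apply: sub_all IH => k' /=; rewrite !inE !mem_cat !inE.
  by case/andP => /orP[]-> /orP[]->; rewrite !orbT.
by apply: sub_all => k /=; rewrite !inE => /andP[-> ->]; rewrite !orbT.
Qed.

(** Separate bounds on the two sides of [c] are needed to isolate the increment of an integral after
    time [c]. *)
Lemma step_int_bound2 g w e1 e2 a c b h : control w g b -> 0 <= a -> a <= c -> c <= b ->
  steps_in a b h -> (forall x, a < x <= c -> `|step_fun h x| <= e1) ->
  (forall x, c < x <= b -> `|step_fun h x| <= e2) ->
  `|step_int h g| <= e1 * (w c - w a) + e2 * (w b - w c).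
Proof.
move=> cw a0 ac cb hab he1 he2; rewrite (step_int_split c) (le_trans (ler_normD _ _))//.
rewrite lerD//.
  apply: step_int_bound => //; first exact: controlW cw.
    exact: steps_inL hab.
  by move=> x /andP[ax xc]; rewrite step_funL// he1// ax.
apply: step_int_bound => //; first by rewrite (le_trans a0).
  exact: steps_inR hab.
by move=> x /andP[ax xc]; rewrite step_funR// he2// ax.
Qed.

Lemma steps_in_cat a b h1 h2 : steps_in a b h1 -> steps_in a b h2 ->
  steps_in a b (h1 ++ h2).
Proof. by rewrite /steps_in all_cat => -> ->. Qed.

Lemma steps_in_opp a b h : steps_in a b h -> steps_in a b (steps_opp h).
Proof. by rewrite /steps_in all_map; apply: sub_all. Qed.

Lemma steps_inW a b b' h : b <= b' -> steps_in a b h -> steps_in a b' h.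
Proof.
by move=> bb'; apply: sub_all => k /and3P[-> -> /le_trans ->].
Qed.

End step_functions.

Lemma cvg_seq_natSinv (R : realType) (W : completeNormedModType R) (u : nat -> W) K :
  0 <= K -> (forall n m, `|u n - u m| <= (n.+1%:R^-1 + m.+1%:R^-1) * K) ->
  cvg (u n @[n --> \oo]).
Proof.
move=> K0 uK; have K1 : 0 < 2 * (K + 1) by rewrite mulr_gt0// ltr_wpDl.
suff: cauchy (u n @[n --> \oo]) by exact: cauchy_cvg.
apply: cauchy_exP => e e0.
have [N _ NP] := near_infty_natSinv_lt (PosNum (divr_gt0 e0 K1)).
exists (u N); exists N => // n /= Nn; rewrite -ball_normE /=.
apply: (le_lt_trans (uK _ _)).
apply: (@le_lt_trans _ _ ((N.+1%:R^-1 + n.+1%:R^-1) * (K + 1))).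
  by rewrite ler_wpM2l// ?lerDl// addr_ge0// invr_ge0.
rewrite -ltr_pdivlMr ?ltr_wpDl//.
rewrite (_ : e / (K + 1) = e / (2 * (K + 1)) + e / (2 * (K + 1))); last first.
  by field; rewrite gt_eqF// ltr_wpDl.
by rewrite ltrD//; [exact: (NP N (leqnn N))|exact: (NP n Nn)].
Qed.

Section stieltjes_integral.
Variables (R : realType) (V : normedModType R) (W : completeNormedModType R).
Variables (g : R -> V) (w : R -> R) (H : R -> 'L(V, W)).
Hypotheses (cw : forall t, control w g t) (cH : cadlag H).

Lemma left_lim_near (U : normedModType R) (X : R -> U) s d c e : 0 < d ->
  cadlag X -> 0 < s -> (forall x, s - d < x < s -> `|X x - c| <= e) ->
  `|left_lim X s - c| <= e.
Proof.
move=> d0 cX s0 Xe; apply/ler_addgt0Pr => r r0.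
have /cvg_leftP/(_ _ r0)[d' d'0 Xr] := cadlag_left cX s0.
pose x := s - Num.min d d' / 2.
have dd : 0 < Num.min d d' by rewrite lt_min d0.
have [dm dm'] : Num.min d d' <= d /\ Num.min d d' <= d' by rewrite !ge_min !lexx orbT.
rewrite (le_trans (ler_distD (X x) _ _))// addrC lerD//.
  by apply: Xe; apply/andP; split; rewrite /x; lra.
by apply: Xr; apply/andP; split; rewrite /x; lra.
Qed.

(** On []u, v]] the constant [H u] is a good approximation, because a left limit taken there depends
    only on the values of [H] on [u, v[. *)
Lemma step_approx e t : 0 < e -> 0 <= t -> exists h : seq (step V W),
  steps_in 0 t h /\ forall s, 0 < s <= t -> `|left_lim H s - step_fun h s| <= e.
Proof.
move=> e0; move: t.
apply: (cadlag_ind cH e0) => [|u v u0 uv Hu [h [hu he]]].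
  by exists [::]; split => // s /andP[s0 /(lt_le_trans s0)]; rewrite ltxx.
exists (Step u v (H u) :: h); split=> [|s /andP[s0 sv]].
  rewrite /= u0 lexx (ltW uv)/=; apply: sub_all hu => k /and3P[-> ->] /= ku.
  exact: le_trans ku (ltW uv).
rewrite step_fun_cons/= sv andbT; have [us|su] := ltP u s; last first.
  by rewrite add0r he// s0.
rewrite (step_fun0 hu) ?us ?orbT// addr0.
apply: (@left_lim_near _ _ _ (s - u)) => //; first by rewrite subr_gt0.
by move=> x /andP[ux xs]; apply: Hu; rewrite (lt_le_trans xs sv) andbT; lra.
Qed.

(* With [I 0 = 0] this characterizes I as the integral of H_- dg; w controls the
   variation of g. *)
Definition sewing (I : R -> W) := forall e u v, 0 <= u -> u < v ->
  (forall x, u <= x < v -> `|H x - H u| <= e) ->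
  `|I v - I u - H u (g v - g u)| <= e * (w v - w u).

(** The integrals of uniform step approximations form a Cauchy sequence by [step_int_bound]. The
    approximations are chosen separately for each [t]; those for two different times are compared
    through the left limits of [H]. *)
Lemma stieltjes_exists : exists I : R -> W,
  [/\ I 0 = 0, sewing I & forall t, 0 <= t -> exists h : nat -> seq (step V W),
    [/\ forall n, steps_in 0 t (h n),
      forall n s, 0 < s <= t -> `|left_lim H s - step_fun (h n) s| <= n.+1%:R^-1 &
      step_int (h n) g @[n --> \oo] --> I t]].
Proof.
have /choice[h hP] (p : R * nat) : exists h : seq (step V W), 0 <= p.1 ->
    steps_in 0 p.1 h /\
    forall s, 0 < s <= p.1 -> `|left_lim H s - step_fun h s| <= p.2.+1%:R^-1.
  have [p0|p0] := leP 0 p.1; last by exists [::].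
  by have [h hP] := @step_approx p.2.+1%:R^-1 p.1 ltac:(by rewrite invr_gt0) p0; exists h.
have hin t n : 0 <= t -> steps_in 0 t (h (t, n)) by move=> /(hP (t, n))[].
have he t n s : 0 <= t -> 0 < s <= t -> `|left_lim H s - step_fun (h (t, n)) s| <= n.+1%:R^-1.
  by move=> /(hP (t, n))[_ /=]; exact.
have hh t u n m s : 0 <= t -> 0 <= u -> 0 < s <= t -> s <= u ->
    `|step_fun (h (t, n)) s - step_fun (h (u, m)) s| <= n.+1%:R^-1 + m.+1%:R^-1.
  move=> t0 u0 /andP[s0 st] su; rewrite (le_trans (ler_distD (left_lim H s) _ _))//.
  by rewrite lerD// ?he ?s0// distrC he// s0.
have cauchyI t : 0 <= t -> cvg (step_int (h (t, n)) g @[n --> \oo]).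
  move=> t0; apply: (@cvg_seq_natSinv _ _ _ (w t - w 0)) => [|n m].
    by rewrite subr_ge0 (control_mono (@cw t)).
  rewrite -step_int_opp -step_int_cat.
  apply: step_int_bound => //; first exact: steps_in_cat (hin _ _ t0) (steps_in_opp (hin _ _ t0)).
  by move=> s /andP[s0 st]; rewrite step_fun_cat step_fun_opp hh// s0.
exists (fun t => lim (step_int (h (t, n)) g @[n --> \oo])); split.
- have -> : (fun n => step_int (h (0, n)) g) = (fun=> 0); last exact: lim_cst.
  apply/funext => n; apply/eqP; rewrite -normr_le0.
  rewrite -[leRHS](mul0r (w 0 - w 0)); apply: step_int_bound => //; first exact: hin.
  by move=> x /andP[x0 /(lt_le_trans x0)]; rewrite ltxx.
- move=> e u v u0 uv Hu; have v0 : 0 <= v by rewrite (le_trans u0)// ltW.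
  (* Up to [u] two approximations of the same left limits are subtracted; on []u, v]] an
     approximation is compared with the constant [H u], which costs a further [e]. *)
  have bnd n : `|step_int (h (v, n)) g - step_int (h (u, n)) g - H u (g v - g u)| <=
      (n.+1%:R^-1 + n.+1%:R^-1) * (w u - w 0) + (n.+1%:R^-1 + e) * (w v - w u).
    have -> : step_int (h (v, n)) g - step_int (h (u, n)) g - H u (g v - g u) =
        step_int (h (v, n) ++ steps_opp (h (u, n) ++ [:: Step u v (H u)])) g.
      rewrite step_int_cat step_int_opp step_int_cat step_int_cons /step_int/=.
      by rewrite big_nil addr0 opprD addrA.
    apply: step_int_bound2 => //; first exact: ltW.
    + apply: steps_in_cat; first exact: hin.
      apply/steps_in_opp/steps_in_cat; first exact: steps_inW (ltW uv) (hin _ _ u0).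
      by rewrite /= u0 lexx (ltW uv).
    + move=> x /andP[x0 xu]; rewrite step_fun_cat step_fun_opp step_fun_cat.
      rewrite step_fun_cons/= (ltNge u) xu/= /step_fun big_nil !addr0 hh//.
      by rewrite x0 (le_trans xu)// ltW.
    + move=> x /andP[ux xv]; rewrite step_fun_cat step_fun_opp step_fun_cat.
      rewrite step_fun_cons/= ux xv/= (step_fun0 (hin u n u0)) ?ux ?orbT//.
      rewrite [step_fun [::] _]/step_fun big_nil addr0 add0r.
      rewrite (le_trans (ler_distD (left_lim H x) _ _))// lerD//.
        by rewrite distrC he// xv (le_lt_trans u0).
      apply: (@left_lim_near _ _ _ (x - u)) => //; first by rewrite subr_gt0.
        by rewrite (le_lt_trans u0).
      by move=> z /andP[uz zx]; apply: Hu; rewrite (lt_le_trans zx xv) andbT; lra.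
  have c1 : `|step_int (h (v, n)) g - step_int (h (u, n)) g - H u (g v - g u)|
      @[n --> \oo] --> `|lim (step_int (h (v, n)) g @[n --> \oo]) -
        lim (step_int (h (u, n)) g @[n --> \oo]) - H u (g v - g u)|.
    by apply: cvg_norm; apply: cvgB; [apply: cvgB; exact: cauchyI|exact: cvg_cst].
  have c2 : (n.+1%:R^-1 + n.+1%:R^-1) * (w u - w 0) + (n.+1%:R^-1 + e) * (w v - w u)
      @[n --> \oo] --> (0 + 0) * (w u - w 0) + (0 + e) * (w v - w u).
    have h0 := @cvg_harmonic R.
    by apply: cvgD; apply: cvgMl; apply: cvgD => //; exact: cvg_cst.
  rewrite addr0 mul0r add0r add0r in c2.
  by apply: (ler_cvg_to c1 c2); near=> n; exact: bnd.
- move=> t t0; exists (fun n => h (t, n)); split=> [n|n s st|]; first exact: hin.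
    exact: he.
  exact: cauchyI.
Unshelve. all: by end_near. Qed.

End stieltjes_integral.

Lemma cvg_dominated (R : realType) (V : normedModType R) (T : Type)
    (F : set_system T) {FF : Filter F} (f : T -> V) (h : T -> R) l :
  (\forall x \near F, `|f x - l| <= h x) -> h x @[x --> F] --> 0 -> f x @[x --> F] --> l.
Proof.
move=> fh /cvgr0Pnorm_le h0; apply/cvgrPdist_le => e e0.
near=> x; rewrite distrC (@le_trans _ _ (h x))//; first by near: x.
by rewrite (le_trans (ler_norm _))//; near: x; exact: h0.
Unshelve. all: by end_near. Qed.

Lemma bop_cvg (R : realType) (V W : normedModType R) (T : Type) (F : set_system T)
    {FF : Filter F} (S_ : T -> 'L(V, W)) (x_ : T -> V) (S : 'L(V, W)) (x : V) :
  S_ t @[t --> F] --> S -> x_ t @[t --> F] --> x -> S_ t (x_ t) @[t --> F] --> S x.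
Proof.
move=> SS xx.
apply: (@cvg_dominated _ _ _ _ _ _ (fun t => `|S_ t - S| * `|x_ t| + `|S| * `|x_ t - x|)).
  apply: nearW => t.
  rewrite (_ : S_ t (x_ t) - S x = (S_ t - S) (x_ t) + S (x_ t - x)).
    by rewrite (le_trans (ler_normD _ _))// lerD// opnorm_le.
  by rewrite bopB -[(S_ t - S) _]/(S_ t (x_ t) - S (x_ t)) addrA subrK.
rewrite -[0](addr0 0) -[X in X + _](mul0r `|x|) -[X in _ + X](mulr0 `|S|).
apply: cvgD; apply: cvgM; [|exact: cvg_norm|exact: cvg_cst|].
  by rewrite -[0](@normr0 _ 'L(V, W)) -(subrr S); apply: cvg_norm; apply: cvgB SS _; exact: cvg_cst.
by rewrite -[0](@normr0 _ V) -(subrr x); apply: cvg_norm; apply: cvgB xx _; exact: cvg_cst.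
Qed.

Lemma cadlag_bounded (R : realType) (V : normedModType R) (X : R -> V) t :
  cadlag X -> 0 <= t -> exists2 M, 0 <= M & forall x, 0 <= x <= t -> `|X x| <= M.
Proof.
move=> cX; move: t; apply: (cadlag_ind cX ltr01) => [|u v u0 uv Xuv [M M0 XM]].
  by exists `|X 0| => // x x0; rewrite -(le_anti x0).
exists (M + 1 + `|X v|) => [|x /andP[x0 xv]]; first by rewrite !addr_ge0.
have [xu|ux] := leP x u.
  by rewrite -addrA ler_wpDr ?addr_ge0// XM// x0.
move: xv; rewrite le_eqVlt => /predU1P[->|xv]; first by rewrite ler_wpDl// addr_ge0.
rewrite ler_wpDr// addrC -[X x](subrK (X u)) (le_trans (ler_normD _ _))// lerD//.
  by apply: Xuv; rewrite (ltW ux).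
by apply: XM; rewrite u0 lexx.
Qed.

Section sewing_consequences.
Variables (R : realType) (V : normedModType R) (W : completeNormedModType R).
Variables (g : R -> V) (w : R -> R) (H : R -> 'L(V, W)) (I : R -> W).
Hypotheses (cw : forall t, control w g t) (cH : cadlag H) (cg : cadlag g).
Hypothesis IH : sewing g w H I.

Let w_mono a b : 0 <= a -> a <= b -> w a <= w b.
Proof. by move=> a0 ab; exact: (control_mono (@cw b)). Qed.

Lemma sewing_control t : 0 <= t -> exists w', control w' I t.
Proof.
move=> t0; have [M M0 HM] := cadlag_bounded cH t0.
(* [2 * M] bounds the oscillation of [H], and [M] bounds the norm of [H a]. *)
exists (fun x => 3 * M * w x) => a b a0; rewrite le_eqVlt => /predU1P[->|ab] bt.
  by rewrite !subrr normr0.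
have aM : `|H a| <= M by rewrite HM// a0 (le_trans _ bt)// ltW.
have /IH : forall x, a <= x < b -> `|H x - H a| <= 2 * M.
  move=> x /andP[ax xb]; rewrite (le_trans (ler_normB _ _))// mulr_natl mulr2n lerD//.
  by rewrite HM// (le_trans a0 ax) (le_trans _ bt)// ltW.
move=> /(_ a0 ab) Iab; rewrite -[I b - I a](subrK (H a (g b - g a))).
rewrite (le_trans (ler_normD _ _))// -mulrBr.
rewrite (_ : 3 * M * (w b - w a) = 2 * M * (w b - w a) + M * (w b - w a)); last by ring.
rewrite lerD// (le_trans (opnorm_le _ _))// ler_pM// ?opnorm_ge0//.
by apply: cw => //; exact: ltW.
Qed.

Lemma sewing_finite_variation : finite_variation I.
Proof. exact/control_finite_variation/sewing_control. Qed.

(** Close to [s] on its left [H] is almost constant, so [I s - I u] is almost [H u (g s - g u)],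
    which tends to the left limit of [H] applied to the jump of [g]. *)
Lemma sewing_left s : 0 < s ->
  I u @[u --> s^'-] --> I s - left_lim H s (jump g s).
Proof.
move=> s0; have Hg : H u (g s - g u) @[u --> s^'-] --> left_lim H s (jump g s).
  rewrite /jump s0; apply: bop_cvg; first exact: cadlag_left.
  by apply: cvgB; [exact: cvg_cst|exact: cadlag_left].
apply/cvg_leftP => e e0; have e2 : 0 < e / 2 by rewrite divr_gt0.
have K0 : 0 < w s - w 0 + 1 by rewrite ltr_wpDl// subr_ge0 w_mono// ltW.
(* Chosen so that [e1] times the variation up to [s] is at most [e / 2]; the added 1 keeps the
   denominator positive. *)
pose e1 := e / 2 / (w s - w 0 + 1); have e10 : 0 < e1 by rewrite !divr_gt0.
have /cvg_leftP/(_ _ e2)[d d0 Hd] := Hg.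
have /cvg_leftP/(_ (e1 / 2))[|d' d'0 Hd'] := cadlag_left cH s0; first by rewrite divr_gt0.
exists (Num.min s (Num.min d d')) => [|u /andP[]]; first by rewrite !lt_min s0 d0.
rewrite ltrBlDl -ltrBlDr !lt_min => /andP[su /andP[ud ud']] us.
have u0 : 0 <= u by lra.
have Iu : `|I s - I u - H u (g s - g u)| <= e / 2.
  have /IH : forall x, u <= x < s -> `|H x - H u| <= e1.
    move=> x /andP[ux xs]; rewrite (le_trans (ler_distD (left_lim H s) _ _))//.
    by rewrite [e1]splitr lerD// ?(distrC (H x)) Hd'//; apply/andP; split; lra.
  move=> /(_ u0 us) /le_trans; apply.
  apply: (@le_trans _ _ (e1 * (w s - w 0 + 1))); last by rewrite divfK// gt_eqF.
  rewrite ler_wpM2l// ?(ltW e10)//; have := w_mono (lexx 0) u0; lra.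
rewrite (_ : _ - I u = (I s - I u - H u (g s - g u)) -
    (left_lim H s (jump g s) - H u (g s - g u))); last first.
  by rewrite opprB addrA subrK addrAC.
rewrite (le_trans (ler_normB _ _))// [e]splitr lerD// Hd//; apply/andP; split; lra.
Qed.

Lemma sewing_right a : 0 <= a -> I u @[u --> a^'+] --> I a.
Proof.
move=> a0; have Hg : H a (g u - g a) @[u --> a^'+] --> 0.
  rewrite -(bop0 (H a)) -(subrr (g a)); apply: bop_cvg; first exact: cvg_cst.
  by apply: cvgB; [exact: cg.1|exact: cvg_cst].
apply/cvg_rightP => e e0; have e2 : 0 < e / 2 by rewrite divr_gt0.
have aa : a <= a + 1 by rewrite lerDl.
have K0 : 0 < w (a + 1) - w a + 1 by rewrite ltr_wpDl// subr_ge0 w_mono.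
pose e1 := e / 2 / (w (a + 1) - w a + 1); have e10 : 0 < e1 by rewrite !divr_gt0.
have /cvg_rightP/(_ _ e2)[d d0 Hd] := Hg.
have /cvg_rightP/(_ _ e10)[d' d'0 Hd'] := cH.1 _ a0.
exists (Num.min 1 (Num.min d d')) => [|u /andP[au]]; first by rewrite !lt_min ltr01 d0.
rewrite -ltrBlDl !lt_min => /andP[u1 /andP[ud ud']].
have Iu : `|I u - I a - H a (g u - g a)| <= e / 2.
  have /IH : forall x, a <= x < u -> `|H x - H a| <= e1.
    move=> x /andP[]; rewrite le_eqVlt => /predU1P[<- _|ax xu].
      by rewrite subrr normr0 ltW.
    by rewrite distrC Hd'//; apply/andP; split; lra.
  move=> /(_ a0 au) /le_trans; apply.
  apply: (@le_trans _ _ (e1 * (w (a + 1) - w a + 1))); last by rewrite divfK// gt_eqF.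
  rewrite ler_wpM2l// ?(ltW e10)//.
  have : w u <= w (a + 1) by apply: w_mono; lra.
  lra.
rewrite distrC -(subrK (H a (g u - g a)) (I u - I a)) (le_trans (ler_normD _ _))//.
rewrite [e]splitr lerD// -normrN -sub0r Hd//; apply/andP; split; lra.
Qed.

Lemma sewing_cadlag : cadlag I.
Proof.
split=> [t|s s0]; first exact: sewing_right.
by apply/cvg_ex; exists (I s - left_lim H s (jump g s)); exact: sewing_left.
Qed.

Lemma sewing_jump s : 0 < s -> jump I s = left_lim H s (jump g s).
Proof. by move=> s0; rewrite {1}/jump s0 (left_limE (sewing_left s0)) subKr. Qed.

End sewing_consequences.

Section stieltjes_measurability.
Variables (R : realType) (V W : normedModType R).

(** The constant [T] makes the induction work: where the first step is active, its operator is
    absorbed into [T]. *)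
Lemma measurable_step_fun (h : seq (step V W)) (T : 'L(V, W)) :
  measurable_fun [set: measurableTypeR R]
    (fun s => `|T + step_fun h s| : measurableTypeR R).
Proof.
elim: h T => [|k h IH] T.
  rewrite (_ : (fun _ => _) = cst `|T|); first exact: measurable_cst.
  by apply/funext => s; rewrite /step_fun big_nil addr0.
rewrite (_ : (fun _ => _) = (fun s => if s \in `]step_l k, step_r k] then
  `|(T + step_op k) + step_fun h s| else `|T + step_fun h s|)).
  apply: measurable_fun_ifT => //.
  apply: (measurable_fun_bool true) => //; rewrite setTI.
  rewrite (_ : _ @^-1` _ = `]step_l k, step_r k]%classic).
    exact: measurable_itv.
  by apply/seteqP; split.
by apply/funext => s; rewrite step_fun_cons in_itv/=; case: ifP; rewrite ?add0r// addrA.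
Qed.

(** Uniform convergence on []0, t]], which has finite variation measure, gives convergence in the
    sense of Bochner. *)
Lemma is_stieltjesI (g : R -> V) (H K : R -> 'L(V, W)) (t : R) (I : W)
    (h : nat -> seq (step V W)) : cadlag g -> finite_variation g -> 0 <= t ->
  (forall s, 0 < s <= t -> K s = left_lim H s) ->
  (forall n, steps_in 0 t (h n)) ->
  (forall n s, 0 < s <= t -> `|left_lim H s - step_fun (h n) s| <= n.+1%:R^-1) ->
  step_int (h n) g @[n --> \oo] --> I -> is_stieltjes g K t I.
Proof.
move=> cg gfv t0 KH hin he hI; have [mu muE] := variation_measure_exists cg gfv.
exists mu; split => //; exists h.
have he' n s : 0 < s <= t -> `|K s - step_fun (h n) s| <= n.+1%:R^-1.
  by move=> st; rewrite KH// he.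
(* The norm is a pointwise limit of norms of step functions; no measurable structure on the
   operators is involved. *)
have mK n : measurable_fun (`]0, t]%classic : set (measurableTypeR R))
    (fun s => `|K s - step_fun (h n) s| : measurableTypeR R).
  apply: (@measurable_fun_cvg _ _ _ _
    (fun m s => `|0 + step_fun (h m ++ steps_opp (h n)) s|)).
    move=> m; apply: measurable_funTS; exact: measurable_step_fun.
  move=> s /=; rewrite in_itv/= => st.
  under eq_fun do rewrite add0r step_fun_cat step_fun_opp.
  apply: cvg_norm; apply: cvgB; last exact: cvg_cst.
  apply: cvg_dominated (@cvg_harmonic R); apply: nearW => m.
  by rewrite distrC he'.
have m0t : measurable (`]0%R, t]%classic : set (measurableTypeR R)).
  exact: measurable_itv.
split => //.
apply: (@squeeze_cvge _ _ _ _ (cst 0%E) _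
  (fun n => ((n.+1%:R^-1)%:E * mu `]0%R, t]%classic)%E)).
- apply: nearW => n; apply/andP; split.
    by apply: integral_ge0 => x _; rewrite lee_fin.
  rewrite -(integral_cst mu m0t).
  apply: ge0_le_integral => //.
  + apply/measurable_EFinP; exact: mK.
  + by move=> x; rewrite /= in_itv/= => xt; rewrite lee_fin he'.
- exact: cvg_cst.
- rewrite (muE _ _ (lexx 0) t0) (total_var_tv gfv (lexx 0) t0).
  rewrite (_ : (fun n => _) = (fun n => (n.+1%:R^-1 * (tv g t - tv g 0))%:E)).
    apply: cvg_EFin; first exact: nearW.
    rewrite -[X in _ --> X](mul0r (tv g t - tv g 0)).
    by apply: cvgMl; exact: cvg_harmonic.
  by apply/funext => n; rewrite EFinM.
Qed.

End stieltjes_measurability.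

Lemma lim_norm_le (R : realType) (V : normedModType R) (T : Type)
    (F : set_system T) {FF : ProperFilter F} (f : T -> V) l c e :
  f x @[x --> F] --> l -> (\forall x \near F, `|f x - c| <= e) -> `|l - c| <= e.
Proof.
move=> fl fc; apply/ler_addgt0Pr => r r0.
have /cvgrPdist_le/(_ _ r0) fr := fl.
have [x [fx fx']] := filter_ex (filterI fc fr).
by rewrite (le_trans (ler_distD (f x) _ _))// addrC lerD.
Qed.

(** * Sums of jumps *)

Section finite_subsets.
Variable R : realType.

Definition finsets : set_system {fset R} :=
  filter_from [set: {fset R}] (fun J => [set K | (J `<=` K)%fset]).

Global Instance finsets_filter : ProperFilter finsets.
Proof.
apply: filter_from_proper; last by move=> A _; exists A; rewrite /= fsubset_refl.
apply: filter_fromT_filter; first by exists fset0.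
by move=> A B /=; exists (A `|` B)%fset => P /=; rewrite fsubUset => /andP[].
Qed.

Lemma near_finsets (F : seq R) :
  \forall J \near finsets, forall x, x \in F -> x \in J.
Proof.
exists [fset x in F]%fset => // J /= /fsubsetP FJ x xF.
by apply: FJ; rewrite !inE.
Qed.

Lemma gap_right (F : seq R) a :
  exists2 d, 0 < d & forall x, x \in F -> a < x -> a + d <= x.
Proof.
elim: F => [|y F [d d0 IH]]; first by exists 1.
exists (if a < y then Num.min d (y - a) else d) => [|x].
  by case: ifP => // ay; rewrite lt_min d0 subr_gt0.
rewrite inE => /predU1P[->|xF] ax.
  by rewrite ax -lerBrDl ge_min lexx orbT.
apply: le_trans (IH _ xF ax); rewrite lerD2l; case: ifP => // _.
by rewrite ge_min lexx.
Qed.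

Lemma gap_left (F : seq R) a :
  exists2 d, 0 < d & forall x, x \in F -> x < a -> x <= a - d.
Proof.
have [d d0 dP] := gap_right [seq - x | x <- F] (- a).
exists d => // x xF xa; have := dP (- x); rewrite mem_map; last exact: oppr_inj.
by rewrite ltrN2 => /(_ xF xa); lra.
Qed.

End finite_subsets.

Definition within_itv (R : realType) (a b : R) (F : seq R) :=
  uniq F && all (fun x => a < x <= b) F.

Definition summable_jumps (R : realType) (V : normedModType R) (j : R -> V) :=
  forall t, 0 <= t ->
  exists M, forall F, within_itv 0 t F -> \sum_(s <- F) `|j s| <= M.

Section jump_sums.
Variables (R : realType) (G : completeNormedModType R) (j : R -> G).
Hypothesis js : summable_jumps j.

Let S t := [set \sum_(s <- F) `|j s| | F in within_itv 0 t].
Let w t := sup (S t).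

Let has_supS t : 0 <= t -> has_sup (S t).
Proof.
move=> t0; split; first by exists 0, [::] => //; rewrite big_nil.
by have [M MP] := js t0; exists M => _ [F Ft <-]; exact: MP.
Qed.


(** The Cauchy criterion: [F0] nearly attains the supremum [w t], so finite sets disjoint from it
    carry little. *)
Let jump_tail t e : 0 <= t -> 0 < e -> exists F0 : seq R, forall F, within_itv 0 t F ->
  (forall x, x \in F -> x \notin F0) -> \sum_(s <- F) `|j s| <= e.
Proof.
move=> t0 e0; have [_ [F0 /andP[uF0 aF0] <-] wF0] := sup_adherent e0 (has_supS t0).
exists F0 => F /andP[uF aF] FF0.
have : \sum_(s <- F0 ++ F) `|j s| <= w t.
  apply: sup_upper_bound; first exact: has_supS.
  exists (F0 ++ F) => //; rewrite /within_itv /= cat_uniq uF0 uF all_cat aF0 aF !andbT/=.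
  by rewrite -all_predC; apply/allP => x /FF0.
by rewrite big_cat/=; move: wF0; rewrite -/(w t); lra.
Qed.

Let psum t (J : {fset R}) := \sum_(s <- J | 0 < s <= t) j s.

Let cvg_psum t : 0 <= t -> cvg (psum t J @[J --> @finsets R]).
Proof.
move=> t0; suff: cauchy (psum t J @[J --> @finsets R]) by exact: cauchy_cvg.
apply: cauchy_exP => e e0; have e2 : 0 < e / 2 by rewrite divr_gt0.
have [F0 F0P] := jump_tail t0 e2; pose J0 := [fset x in F0]%fset.
exists (psum t J0); exists J0 => // J /= J0J; rewrite -ball_normE /= distrC.
apply: (@le_lt_trans _ _ (e / 2)); last by lra.
have -> : psum t J - psum t J0 = \sum_(s <- [seq s <- J | (0 < s <= t) && (s \notin J0)]) j s.
  have EJ0 : \sum_(s <- J | (0 < s <= t) && (s \in J0)) j s = psum t J0.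
    rewrite big_andbC -big_filter_cond /psum; apply: perm_big; apply: uniq_perm.
    - by rewrite filter_uniq// fset_uniq.
    - exact: fset_uniq.
    by move=> x; rewrite mem_filter andb_idr// => /(fsubsetP J0J).
  rewrite [psum t J]/psum (bigID (fun s => s \in J0)) big_filter EJ0 addrAC subrr.
  by rewrite add0r.
rewrite (le_trans (ler_norm_sum _ _ _))//; apply: F0P.
  rewrite /within_itv filter_uniq ?fset_uniq//=.
  by apply/allP => x; rewrite mem_filter => /andP[/andP[]].
by move=> x; rewrite mem_filter !inE => /andP[/andP[]].
Qed.

Let D t := lim (psum t J @[J --> @finsets R]).

(** Estimates of increments of [D] reduce to finite sums over []a, b]]. These may be assumed to
    contain [b], which singles out the jump at [b] when a left limit is computed. *)
Let D_incr a b c e : 0 <= a -> a <= b ->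
  (forall F, within_itv a b F -> (a < b -> b \in F) -> `|\sum_(s <- F) j s - c| <= e) ->
  `|D b - D a - c| <= e.
Proof.
move=> a0 ab Fe; have b0 := le_trans a0 ab.
apply: (@lim_norm_le _ _ _ (@finsets R) _ (fun J => psum b J - psum a J)).
  by apply: cvgB; [exact: (cvg_psum b0)|exact: (cvg_psum a0)].
near=> J.
have -> : psum b J - psum a J = \sum_(s <- [seq s <- J | a < s <= b]) j s.
  rewrite /psum big_filter (bigID (fun s => s <= a) (fun s => 0 < s <= b) _)/=.
  rewrite (_ : \sum_(s <- J | (0 < s <= b) && (s <= a)) j s = psum a J); last first.
    apply: eq_bigl => s; have [sa|] := leP s a; rewrite ?andbF// !andbT.
    by rewrite (le_trans sa ab) andbT.
  rewrite addrAC subrr add0r; apply: eq_bigl => s; rewrite -ltNge andbC andbA.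
  by have [as_|] := ltP a s; rewrite //= (le_lt_trans a0).
apply: Fe.
  rewrite /within_itv filter_uniq ?fset_uniq//=.
  by apply/allP => x; rewrite mem_filter => /andP[].
move=> ab'; rewrite mem_filter ab' lexx/=.
by near: J; apply: filterS (near_finsets [:: b]) => J; apply; rewrite inE.
Unshelve. all: by end_near. Qed.

(** Outside a finite set [F0] the jumps have total norm at most [e], and [F0] leaves a gap on either
    side of any given time. This yields right continuity and the left limit [D s - j s]. The
    variation is controlled by [w]. *)
Lemma jump_sum_exists : exists D : R -> G,
  [/\ D 0 = 0,
    forall t, 0 <= t -> (fun J : {fset R} => \sum_(s <- J | 0 < s <= t) j s) @ @finsets R --> D t,
    cadlag D, (forall s, 0 < s -> jump D s = j s) & finite_variation D].
Proof.
have Dright a e : 0 <= a -> 0 < e -> exists2 d, 0 < d & forall b, a < b < a + d -> `|D a - D b| <= e.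
  move=> a0 e0; have [F0 F0P] := jump_tail (ltac:(by rewrite addr_ge0) : 0 <= a + 1) e0.
  have [d d0 dP] := gap_right F0 a.
  exists (Num.min 1 d) => [|b /andP[ab]]; first by rewrite lt_min ltr01.
  rewrite -ltrBlDl lt_min => /andP[b1 bd].
  rewrite distrC -[_ - D a]subr0; apply: D_incr => //; first exact: ltW.
  move=> F /andP[uF /allP aF] _; rewrite subr0 (le_trans (ler_norm_sum _ _ _))//.
  apply: F0P => [|x xF].
    rewrite /within_itv uF; apply/allP => x /aF /andP[ax xb].
    by rewrite (le_lt_trans a0)//=; lra.
  by apply/negP => /dP; have /andP[ax xb] := aF _ xF; move=> /(_ ax); lra.
have Dleft s e : 0 < s -> 0 < e ->
    exists2 d, 0 < d & forall u, s - d < u < s -> `|D s - j s - D u| <= e.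
  move=> s0 e0; have [F0 F0P] := jump_tail (ltW s0) e0.
  have [d d0 dP] := gap_left F0 s.
  exists (Num.min s d) => [|u /andP[]]; first by rewrite lt_min s0.
  rewrite ltrBlDl -ltrBlDr lt_min => /andP[us ud] us'.
  have u0 : 0 <= u by lra.
  rewrite addrAC; apply: D_incr => //; first exact: ltW.
  move=> F /andP[uF /allP aF] /(_ us') sF.
  rewrite (bigD1_seq s)//= addrAC subrr add0r -big_filter.
  rewrite (le_trans (ler_norm_sum _ _ _))//.
  apply: F0P => [|x].
    rewrite /within_itv filter_uniq//=; apply/allP => x.
    by rewrite mem_filter => /andP[_ /aF /andP[ux ->]]; rewrite (le_lt_trans u0).
  rewrite mem_filter => /andP[xs /aF /andP[ux xs']].
  by apply/negP => /dP; rewrite lt_neqAle xs xs' => /(_ isT); lra.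
have Dl s : 0 < s -> D u @[u --> s^'-] --> D s - j s.
  by move=> s0; apply/cvg_leftP => e e0; exact: Dleft.
exists D; split.
- have -> : D = fun t => lim (psum t J @[J --> @finsets R]) by [].
  rewrite (_ : psum 0 = cst 0); first exact: lim_cst.
  apply/funext => J; rewrite /psum big1//= => x /andP[x0 /(lt_le_trans x0)].
  by rewrite ltxx.
- by move=> t /cvg_psum.
- split=> [t t0|s s0]; first by apply/cvg_rightP => e e0; exact: Dright.
  by apply/cvg_ex; exists (D s - j s); exact: Dl.
- by move=> s s0; rewrite /jump s0 (left_limE (Dl s s0)) subKr.
- apply: control_finite_variation => t t0; exists w => a b a0 ab bt.
  rewrite -[_ - D a]subr0; apply: D_incr => // F /andP[uF /allP aF] _.
  rewrite subr0 (le_trans (ler_norm_sum _ _ _))// lerBrDr -lerBrDl.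
  apply: ge_sup; first by case: (has_supS a0).
  move=> _ [F' /andP[uF' /allP aF'] <-]; rewrite lerBrDl -big_cat/=.
  apply: sup_upper_bound; first exact: has_supS (le_trans a0 ab).
  exists (F ++ F') => //; rewrite /within_itv /= cat_uniq uF uF'/= andbT.
  apply/andP; split.
    by apply/hasPn => x /aF' /andP[_ xa]; apply/negP => /aF /andP[]; lra.
  apply/allP => x; rewrite mem_cat => /orP[/aF|/aF'] /andP[ax xb].
    by rewrite (le_lt_trans a0).
  by rewrite ax (le_trans xb).
Qed.

End jump_sums.

Section cadlag_algebra.
Variables (R : realType) (V : normedModType R).
Implicit Types X Y : R -> V.

Lemma left_limD X Y t : cadlag X -> cadlag Y -> 0 < t ->
  left_lim (fun s => X s + Y s) t = left_lim X t + left_lim Y t.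
Proof. by move=> cX cY t0; apply: left_limE; apply: cvgD; exact: cadlag_left. Qed.

Lemma left_limB X Y t : cadlag X -> cadlag Y -> 0 < t ->
  left_lim (fun s => X s - Y s) t = left_lim X t - left_lim Y t.
Proof. by move=> cX cY t0; apply: left_limE; apply: cvgB; exact: cadlag_left. Qed.

Lemma cadlagD X Y : cadlag X -> cadlag Y -> cadlag (fun s => X s + Y s).
Proof.
move=> cX cY; split=> t t0; first by apply: cvgD; [exact: cX.1|exact: cY.1].
by apply/cvg_ex; exists (left_lim X t + left_lim Y t); apply: cvgD; exact: cadlag_left.
Qed.

Lemma cadlagB X Y : cadlag X -> cadlag Y -> cadlag (fun s => X s - Y s).
Proof.
move=> cX cY; split=> t t0; first by apply: cvgB; [exact: cX.1|exact: cY.1].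
by apply/cvg_ex; exists (left_lim X t - left_lim Y t); apply: cvgB; exact: cadlag_left.
Qed.

Lemma cadlag_cst (c : V) : cadlag (fun=> c).
Proof. by split=> t t0; [exact: cvg_cst|apply/cvg_ex; exists c; exact: cvg_cst]. Qed.

Lemma jumpD X Y t : cadlag X -> cadlag Y ->
  jump (fun s => X s + Y s) t = jump X t + jump Y t.
Proof.
rewrite /jump; case: ifP => [t0 cX cY|_ _ _]; last by rewrite addr0.
by rewrite left_limD// opprD addrACA.
Qed.

Lemma jumpB X Y t : cadlag X -> cadlag Y ->
  jump (fun s => X s - Y s) t = jump X t - jump Y t.
Proof.
rewrite /jump; case: ifP => [t0 cX cY|_ _ _]; last by rewrite subr0.
by rewrite left_limB// !opprD addrACA.
Qed.

Lemma jump_cst (c : V) t : jump (fun=> c) t = 0.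
Proof.
by rewrite /jump; case: ifP => // t0; rewrite (@left_limE _ _ _ _ c) ?subrr//; exact: cvg_cst.
Qed.

Lemma finite_variationD X Y : finite_variation X -> finite_variation Y ->
  finite_variation (fun s => X s + Y s).
Proof.
move=> fX fY; apply: control_finite_variation => t t0.
exists (fun s => tv X s + tv Y s) => a b a0 ab bt.
rewrite opprD addrACA (le_trans (ler_normD _ _))// opprD addrACA.
by rewrite lerD//; exact: tv_control ab bt.
Qed.

Lemma finite_variationB X Y : finite_variation X -> finite_variation Y ->
  finite_variation (fun s => X s - Y s).
Proof.
move=> fX fY; apply: control_finite_variation => t t0.
exists (fun s => tv X s + tv Y s) => a b a0 ab bt.
rewrite opprD addrACA (le_trans (ler_normD _ _))// opprD addrACA -opprD normrN.
by rewrite lerD//; exact: tv_control ab bt.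
Qed.

Lemma finite_variation_cst (c : V) : finite_variation (fun=> c).
Proof.
apply: control_finite_variation => t t0; exists (fun=> 0) => a b _ _ _.
by rewrite !subrr normr0.
Qed.

Lemma jump_control X w t u s : cadlag X -> control w X t -> 0 <= u -> u < s -> s <= t ->
  `|jump X s| <= w s - w u.
Proof.
move=> cX cw u0 us st; have s0 : 0 < s by rewrite (le_lt_trans u0).
rewrite /jump s0 -[X s - _]subr0.
have XX : X s - X x @[x --> s^'-] --> X s - left_lim X s.
  by apply: cvgB; [exact: cvg_cst|exact: cadlag_left].
apply: (@lim_norm_le _ _ _ _ _ _ _ 0 _ XX); near=> x; rewrite subr0.
have ux : u < x by near: x; exact: nbhs_left_gt.
have xs : x < s by near: x; exact: nbhs_left_lt.
apply: (@le_trans _ _ (w s - w x)).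
  by apply: cw => //; exact: le_trans u0 (ltW ux).
rewrite lerD2l lerN2; apply: (control_mono cw) => //; first exact: ltW.
by rewrite (le_trans (ltW xs)).
Unshelve. all: by end_near. Qed.

(** After sorting the times, each jump is bounded by the increment of [tv X] since the preceding
    time, and these increments telescope. *)
Lemma summable_jump X : cadlag X -> finite_variation X -> summable_jumps (jump X).
Proof.
move=> cX fX t t0; exists (tv X t - tv X 0) => F /andP[uF aF].
rewrite (perm_big (sort <=%R F))/=; last by rewrite perm_sym perm_sort.
have sF : path <%R 0 (sort <=%R F).
  rewrite path_min_sorted ?lt_sorted_uniq_le ?sort_uniq ?uF ?sort_le_sorted//.
  by rewrite all_sort; apply: sub_all aF => x /andP[].
have st : all (fun x => x <= t) (sort <=%R F).
  by rewrite all_sort; apply: sub_all aF => x /andP[].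
suff H s a : 0 <= a -> a <= t -> path <%R a s -> all (fun x => x <= t) s ->
  \sum_(x <- s) `|jump X x| <= tv X t - tv X a by exact: H.
elim: s a => [|x s IH] a a0 at_ /=; first by rewrite big_nil subr_ge0 tv_mono.
move=> /andP[ax xs] /andP[xt xst]; rewrite big_cons.
have x0 : 0 <= x by rewrite (le_trans a0)// ltW.
apply: (@le_trans _ _ ((tv X x - tv X a) + (tv X t - tv X x))); last by lra.
rewrite lerD//; last exact: IH.
by apply: (@jump_control _ _ t) => //; exact: tv_control.
Qed.

Lemma continuous_within_cadlag X : cadlag X -> (forall t, 0 < t -> jump X t = 0) ->
  {within `[0, +oo[, continuous X}.
Proof.
move=> cX X0; apply/continuous_within_itvcyP; split=> [t|]; last exact: cX.1.
rewrite in_itv/= andbT => t0; apply/left_right_continuousP; split; last first.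
  by apply: cX.1; exact: ltW.
have -> : X t = left_lim X t; last exact: cadlag_left.
by apply/eqP; rewrite -subr_eq0; have := X0 t t0; rewrite /jump t0 => ->.
Qed.

End cadlag_algebra.

(** The jump sum [D] starts at 0 and has exactly the jumps of [B], so [B - D] is continuous and
    takes over the initial value. *)
Lemma continuous_discontinuous_decomposition (R : realType)
    (V : completeNormedModType R) (B : R -> V) : cadlag B -> finite_variation B ->
  exists C D : R -> V, [/\ forall t, B t = C t + D t,
    {within `[0, +oo[, continuous C}, finite_variation C & purely_discontinuous D].
Proof.
move=> cB fB; have [D [D0 Dlim cD jD fD]] := jump_sum_exists (summable_jump cB fB).
exists (fun t => B t - D t), D; split=> [t|||]; first by rewrite subrK.
- apply: continuous_within_cadlag => [|t t0]; first exact: cadlagB.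
  by rewrite jumpB// jD// subrr.
- exact: finite_variationB.
- split => // t t0; rewrite D0 subr0; apply: cvg_trans (Dlim t t0).
  apply: near_eq_cvg; apply: nearW => J.
  by apply: eq_bigr => s /andP[s0 _]; rewrite jD.
Qed.

(** * Compactness and Taylor's formula *)

Section compact_ranges.
Variables (R : realType).

(** If a finite union belongs to an ultrafilter, so does one of its members. Membership is expressed
    by positions in [s], with any default value, since [I] carries no decidable equality. *)
Lemma ultra_has (T : Type) (I : Type) (F : set_system T) (UF : UltraFilter F)
    (s : seq I) (A : I -> set T) :
  F [set x | exists2 k, (k < size s)%N & forall y0, A (nth y0 s k) x] ->
  exists i, F (A i).
Proof.
elim: s => [|y s IH] Fs.
  by have [x [k]] := filter_ex Fs.
have [|Fn] := in_ultra_setVsetC (A y) UF; first by exists y.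
apply: IH; apply: filterS (filterI Fs Fn) => x [[k ks yk] nyx].
case: k => [|k] in ks yk; first by have := yk y.
by exists k.
Qed.

(** The range is totally bounded: each step of [cadlag_ind] adds only the two centres [X u] and
    [X v]. Hence an ultrafilter on the closure is Cauchy, and it converges by completeness. *)
Lemma cadlag_compact (V : completeNormedModType R) (X : R -> V) t : cadlag X ->
  0 <= t -> compact (closure [set X x | x in [set x | 0 <= x <= t]]).
Proof.
move=> cX t0; have tb e : 0 < e -> exists s : seq V,
    forall x, 0 <= x <= t -> exists2 y, y \in s & `|X x - y| <= e.
  move=> e0; move: t t0; apply: (cadlag_ind cX e0) => [|u v u0 uv Xuv [s sP]].
    exists [:: X 0] => x x0; exists (X 0); rewrite ?inE//.
    by rewrite -(le_anti x0) subrr normr0 ltW.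
  exists [:: X v, X u & s] => x /andP[x0].
  rewrite le_eqVlt => /predU1P[->|xv].
    by exists (X v); rewrite ?inE ?eqxx// subrr normr0 ltW.
  have [xu|ux] := leP x u.
    by have [|y ys yx] := sP x; [rewrite x0|exists y => //; rewrite !inE ys !orbT].
  by exists (X u); [rewrite !inE eqxx orbT|apply: Xuv; rewrite (ltW ux)].
rewrite compact_ultra => F UF FK.
have cF : cauchy F.
  apply: cauchy_exP => e e0; have e3 : 0 < e / 3 by rewrite divr_gt0.
  have [s sP] := tb _ e3.
  have [|y Fy] := @ultra_has _ _ F UF s (fun y => [set z | `|y - z| < e]).
    apply: filterS FK => z.
    move=> /(_ _ (nbhsx_ballx z _ e3))[_ [[x xt <-]]]; rewrite -ball_normE /= => zx.
    have [y ys yx] := sP _ xt; exists (index y s); first by rewrite index_mem.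
    move=> y0; rewrite nth_index// (le_lt_trans (ler_distD (X x) _ _))//.
    rewrite distrC in yx; rewrite distrC in zx; lra.
  by exists y; apply: filterS Fy => z; rewrite -ball_normE.
have Fl : cvg F by exact: cauchy_cvg.
exists (lim F); split => //.
exact: (@closed_cvg _ _ F _ id _ (@closed_closure _ _) FK _ Fl).
Qed.

Lemma cadlag_closure_left (V : normedModType R) (X : R -> V) t s : cadlag X -> 0 < s <= t ->
  closure [set X x | x in [set x | 0 <= x <= t]] (left_lim X s).
Proof.
move=> cX /andP[s0 st].
apply: (@closed_cvg _ _ _ _ X _ (@closed_closure _ _) _ _ (cadlag_left cX s0)).
near=> x; apply: subset_closure; exists x => //=; apply/andP; split.
  by near: x; exact: nbhs_left_ge.
by rewrite (le_trans _ st)//; near: x; exact: nbhs_left_le.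
Unshelve. all: by end_near. Qed.

(** The mean value theorem evaluates derivatives on segments, so these must stay in a compact set,
    where the derivatives are continuous. *)
Definition segments (V : normedModType R) (K : set V) : set V :=
  [set z | exists x y th, [/\ K x, K y, 0 <= th <= 1 & z = x + th *: (y - x)]].

Lemma sub_segments (V : normedModType R) (K : set V) : K `<=` segments K.
Proof. by move=> x Kx; exists x, x, 0; rewrite lexx ler01 scale0r addr0. Qed.

Lemma segments_compact (V : normedModType R) (K : set V) : compact K ->
  compact (segments K).
Proof.
move=> cK; pose p (u : (V * V) * R^o) := u.1.1 + u.2 *: (u.1.2 - u.1.1).
have -> : segments K = p @` ((K `*` K) `*` `[0, 1]%classic).
  apply/seteqP; split=> [_ [x [y [th [Kx Ky th01 ->]]]]|_ [[[x y] th] [[/= Kx Ky] th01] <-]].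
    by exists ((x, y), th) => //=; rewrite in_itv.
  by exists x, y, th; split => //; move: th01; rewrite in_itv.
apply: continuous_compact.
  apply: continuous_subspaceT => u; apply: cvgD.
    by apply: cvg_comp; [exact: cvg_fst|exact: cvg_fst].
  apply: cvgZ; first exact: cvg_snd.
  by apply: cvgB; apply: cvg_comp; [exact: cvg_fst|exact: cvg_snd|exact: cvg_fst|exact: cvg_fst].
apply: compact_setX; [exact: compact_setX|exact: segment_compact].
Qed.

Lemma compact_uniform (S W : normedModType R) (h : S -> W) (K : set S) e :
  compact K -> {within K, continuous h} -> 0 < e -> exists2 d, 0 < d &
  forall z z', K z -> K z' -> `|z - z'| <= d -> `|h z - h z'| <= e.
Proof.
move=> /compact_near_coveringP cK /subspace_continuousP hK e0.
pose P (d : R) (z : S) := forall z', K z' -> `|z - z'| <= d -> K z -> `|h z - h z'| <= e.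
have e2 : 0 < e / 2 by rewrite divr_gt0.
have : \forall d \near 0^'+, K `<=` P d.
  apply: cK => z Kz.
  have /cvgrPdist_le/(_ _ e2) := hK z Kz; rewrite near_withinE => /nbhs_ballP[d d0 hd].
  have d2 : 0 < d / 2 by rewrite divr_gt0.
  exists (ball z (d / 2), [set r : R | r < d / 2]) => /=.
    split; first exact: nbhsx_ballx.
    exact: nbhs_right_lt.
  move=> [z' r] [/= zz' rd] z'' Kz'' z'z'' Kz'.
  rewrite -ball_normE /= in zz'.
  rewrite (le_trans (ler_distD (h z) _ _))// [e]splitr lerD//.
    by rewrite distrC; apply: hd => //; rewrite -ball_normE /=; lra.
  apply: hd => //; rewrite -ball_normE /= (le_lt_trans (ler_distD z' _ _))//; lra.
move=> /(filterI (nbhs_right_gt 0))/filter_ex[d [d0 KP]].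
by exists d => // z z' Kz Kz' zz'; exact: KP.
Qed.

Lemma compact_norm_bound (S W : normedModType R) (h : S -> W) (K : set S) :
  compact K -> {within K, continuous h} -> exists2 M, 0 <= M & forall z, K z -> `|h z| <= M.
Proof.
move=> cK hK; have [M [_ MP]] := compact_bounded (continuous_compact hK cK).
exists (`|M| + 1) => [|z Kz]; first by rewrite addr_ge0.
have M1 : M < `|M| + 1 by rewrite ltr_pwDr// ler_norm.
by apply: (MP _ M1); exists z.
Qed.

Lemma compact_cvg (S W : normedModType R) (h : S -> W) (K : set S) (T : Type)
    (F : set_system T) {FF : Filter F} (z_ : T -> S) z :
  {within K, continuous h} -> K z -> (\forall t \near F, K (z_ t)) ->
  z_ t @[t --> F] --> z -> h (z_ t) @[t --> F] --> h z.
Proof.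
move=> /subspace_continuousP hK Kz Kz_ zz; apply: cvg_comp (hK z Kz).
move=> A /zz; apply: filterS2 Kz_ => t Kt; exact.
Qed.

End compact_ranges.

(** * Mean value estimates for Gateaux derivatives *)

Section gateaux_lines.
Variables (R : realType) (V G : normedModType R).

Lemma is_deriveP (U W : normedModType R) (F : U -> W) (x v : U) (d : W) :
  is_derive x v F d <-> h^-1 *: (F (h *: v + x) - F x) @[h --> (0 : R)^'] --> d.
Proof.
split=> [[dF <-]|Fd]; first exact: dF.
split; first by apply/cvg_ex; exists d.
exact: cvg_lim Fd.
Qed.

Lemma gateaux_line (F : V -> G) (DF : V -> 'L(V, G)) (l : 'L(G, R^o)) a v (th : R) :
  (forall x, gateaux F x (DF x)) ->
  is_derive th (1 : R) (fun s : R => l (F (a + s *: v)) : R) (l (DF (a + th *: v) v)).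
Proof.
move=> dF; apply/is_deriveP; have /is_deriveP := dF (a + th *: v) v.
move=> /(bop_cvg (cvg_cst l)).
apply: cvg_trans; apply: near_eq_cvg; apply: nearW => h.
rewrite bopZ bopB; congr (_ *: (l (F _) - _)).
by rewrite [h *: 1]mulr1 scalerDl addrCA.
Qed.

End gateaux_lines.

Section taylor.
Variables (R : realType) (V G : normedModType R).

(** The mean value theorem for the real function [psi], with [l] a functional that attains the norm
    of the left-hand side. *)
Lemma gateaux_taylor1 (F : V -> G) (DF : V -> 'L(V, G)) (L : 'L(V, G)) a v om :
  (forall x, gateaux F x (DF x)) ->
  (forall th : R, 0 <= th <= 1 -> `|DF (a + th *: v) - L| <= om) ->
  `|F (a + v) - F a - L v| <= om * `|v|.
Proof.
move=> dF DFL; have [l lE l1] := norming_functional (F (a + v) - F a - L v).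
pose psi (s : R) : R := l (F (a + s *: v)) - s * l (L v).
have dpsi th : is_derive th (1 : R) psi (l (DF (a + th *: v) v) - l (L v)).
  have dl := gateaux_line l a v th dF.
  apply: is_deriveB.
  by apply: is_derive_eq; rewrite scaler0 add0r -[_ *: _]/(_ * _) mulr1.
have [c c01] : exists2 c, c \in `]0, 1[ &
    psi 1 - psi 0 = (l (DF (a + c *: v) v) - l (L v)) * (1 - 0).
  apply: (MVT ltr01 (fun x _ => dpsi x)).
  by apply: derivable_within_continuous => x _; exact: (@ex_derive _ _ _ _ _ _ _ (dpsi x)).
rewrite /psi scale1r scale0r addr0 mul1r mul0r !subr0 mulr1 -!bopB.
rewrite (_ : F (a + v) - L v - F a = F (a + v) - F a - L v) ?lE; last by rewrite addrAC.
move=> ->; move: c01; rewrite in_itv/= => /andP[c0 c1].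
rewrite (le_trans (ler_norm _))// (le_trans (l1 _))//.
apply: le_trans (opnorm_le (DF (a + c *: v) - L) v) _.
by rewrite ler_wpM2r// DFL// (ltW c0) (ltW c1).
Qed.

Lemma bop_eval_subproof (v : V) : (fun T : 'L(V, G) => T v) \in @bop_pred R 'L(V, G) G.
Proof.
apply/asboolP; split => //; exists `|v| => T.
by rewrite mulrC; exact: opnorm_le.
Qed.

Definition bop_eval (v : V) : 'L('L(V, G), G) := BOp (bop_eval_subproof v).

(** The mean value theorem is used twice: the derivative of [psi] is the increment of [chi], and
    that of [chi] is the error of the second derivative. The outcome is [c] times this error with
    [0 < c < 1], hence the bound [k] and not half of it. *)
Lemma gateaux_taylor2 (F : V -> G) (DF : V -> 'L(V, G)) (DDF : V -> 'L(V, 'L(V, G)))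
    (B : G) a v k : (forall x, gateaux F x (DF x)) -> (forall x, gateaux DF x (DDF x)) ->
  (forall th : R, 0 <= th <= 1 -> `|DDF (a + th *: v) v v - B| <= k) ->
  `|F (a + v) - F a - DF a v - 2^-1 *: B| <= k.
Proof.
move=> dF dDF DDFB.
have [l lE l1] := norming_functional (F (a + v) - F a - DF a v - 2^-1 *: B).
pose psi (s : R) : R := l (F (a + s *: v)) - s * l (DF a v) - s ^+ 2 * (2^-1 * l B).
pose chi (s : R) : R := l (DF (a + s *: v) v) - s * l B.
have dpsi th : is_derive th (1 : R) psi (chi th - l (DF a v)).
  have dl := gateaux_line l a v th dF.
  rewrite (_ : chi th - _ = l (DF (a + th *: v) v) - l (DF a v) - th * l B); last first.
    by rewrite /chi addrAC.
  apply: is_deriveB.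
    apply: is_deriveB.
    by apply: is_derive_eq; rewrite scaler0 add0r -[_ *: _]/(_ * _) mulr1.
  apply: is_derive_eq; rewrite scaler0 add0r -![_ *: _]/(_ * _) mulr1.
  by field.
have dchi th : is_derive th (1 : R) chi (l (DDF (a + th *: v) v v) - l B).
  have dl : is_derive th (1 : R) (fun s : R => l (DF (a + s *: v) v) : R) (l (DDF (a + th *: v) v v)).
    exact: (gateaux_line (bop_comp l (bop_eval v)) a v th dDF).
  apply: is_deriveB.
  by apply: is_derive_eq; rewrite scaler0 add0r -[_ *: _]/(_ * _) mulr1.
have [c + psiE] : exists2 c, c \in `]0, 1[ &
    psi 1 - psi 0 = (chi c - l (DF a v)) * (1 - 0).
  apply: (MVT ltr01 (fun x _ => dpsi x)).
  by apply: derivable_within_continuous => x _; exact: (@ex_derive _ _ _ _ _ _ _ (dpsi x)).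
rewrite in_itv/= => /andP[c0 c1].
have [d + chiE] : exists2 d, d \in `]0, c[ &
    chi c - chi 0 = (l (DDF (a + d *: v) v v) - l B) * (c - 0).
  apply: (MVT c0 (fun x _ => dchi x)).
  by apply: derivable_within_continuous => x _; exact: (@ex_derive _ _ _ _ _ _ _ (dchi x)).
rewrite in_itv/= => /andP[d0 dc].
have -> : `|F (a + v) - F a - DF a v - 2^-1 *: B| = psi 1 - psi 0.
  rewrite -lE /psi !scale1r !scale0r addr0 expr1n expr0n/= !mul0r !mul1r !subr0.
  by rewrite !bopB bopZ -[_ *: l B]/(_ * _); ring.
rewrite psiE subr0 mulr1.
have -> : l (DF a v) = chi 0 by rewrite /chi scale0r addr0 mul0r subr0.
rewrite chiE subr0 (le_trans (ler_norm _))// normrM -bopB.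
have DB : `|l (DDF (a + d *: v) v v - B)| <= k.
  by rewrite (le_trans (l1 _))// DDFB// (ltW d0) ltW// (lt_trans dc).
rewrite (le_trans _ DB)// ler_piMr// gtr0_norm// ltW//.
Qed.

End taylor.

(** * Limits along partitions *)

Section partition_theory.
Variables (R : realType) (p : time_partition R).

Lemma part_pt_le i j : (i <= j)%N -> p i <= p j.
Proof.
move=> /subnK <-; elim: (j - i)%N => // k IH.
by rewrite addSn (le_trans IH)// ltW// part_pt_lt.
Qed.

Lemma part_pt_ge0 i : 0 <= p i.
Proof. by rewrite -(part_pt0 p) part_pt_le. Qed.

Lemma part_pt_unbounded t : exists N, t <= p N.
Proof.
have /cvgryPge/(_ t) := part_pt_cvg p.
by move=> /filter_ex[N tN]; exists N.
Qed.

Lemma part_idxP t : 0 < t -> p (part_idx p t) < t <= p (part_idx p t).+1.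
Proof.
move=> t0; rewrite /part_idx; case: xgetP => [i _ //|noi].
have exN : exists N, t <= p N := part_pt_unbounded t.
case: (ex_minnP exN) => -[|k] tk kmin.
  by move: tk; rewrite part_pt0 leNgt t0.
exfalso; apply: (noi k) => /=; rewrite tk andbT ltNge.
by apply/negP => /kmin; rewrite ltnn.
Qed.

Lemma part_idx_unique t i : p i < t <= p i.+1 -> part_idx p t = i.
Proof.
move=> /andP[it ti]; have t0 : 0 < t by rewrite (le_lt_trans _ it)// part_pt_ge0.
have /andP[jt tj] := part_idxP t0; apply/eqP; rewrite eqn_leq.
apply/andP; split; rewrite leqNgt; apply/negP => /part_pt_le.
  by rewrite leNgt (lt_le_trans jt ti).
by rewrite leNgt (lt_le_trans it tj).
Qed.

Lemma part_sumE (W : normedModType R) (S : R -> R -> W) t N : t <= p N ->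
  (forall i, t <= p i -> S (p i) (p i.+1) = 0) ->
  part_sum p S = \sum_(0 <= i < N) S (p i) (p i.+1).
Proof.
move=> tN St; apply: cvg_lim => //; apply: cvg_near_cst; exists N => // M /= NM.
have S0 : \sum_(N <= i < M) S (p i) (p i.+1) = 0.
  rewrite big_nat_cond big1// => i /andP[/andP[Ni _] _]; apply: St.
  by rewrite (le_trans tN)// part_pt_le.
by rewrite (big_cat_nat _ NM)//= S0 addr0.
Qed.

End partition_theory.

(** * End points of intervals along an ultrafilter *)

Section ultrafilter_limits.
Variables (R : realType).

Lemma ultra_fmap (T T' : Type) (f : T -> T') (U : set_system T) :
  UltraFilter U -> UltraFilter (f x @[x --> U]).
Proof.
move=> UU; split; first exact: fmap_proper_filter.
move=> G PG UG; apply/seteqP; split=> A; last exact: UG.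
move=> GA; have [//|nA] := in_ultra_setVsetC (f @^-1` A) UU.
have : G (A `&` ~` A) by apply: filterI => //; exact: UG.
by rewrite setICr => /filter_not_empty.
Qed.

(** Turns uniformity over all intervals into convergence: if [P] fails for arbitrarily large [n],
    there are an ultrafilter [U] that contains the set of bad [n] and a choice of a bad index [i n]
    for each of them. *)
Lemma near_not_ultra (P : nat -> nat -> Prop) :
  (forall U : set_system nat, UltraFilter U -> \oo `<=` U ->
    forall i : nat -> nat, (\forall n \near U, ~ P n (i n)) -> False) ->
  \forall n \near \oo, forall i, P n i.
Proof.
move=> H; apply: contrapT => nP; pose A := [set n | forall i, P n i].
have PF : ProperFilter (within (~` A) \oo).
  apply: Build_ProperFilter_ex => B wB; apply: contrapT => nB; apply: nP.
  have : \oo (fun n => ~ A n -> B n) := wB.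
  apply: filterS => n nAB; apply: contrapT => nAn; apply: nB; exists n.
  exact: nAB.
have [U [UU wU]] := ultraFilterLemma PF.
have ooU : \oo `<=` U by move=> B oB; apply: wU; apply: filterS oB => n Bn _.
have /choice[i iP] (n : nat) : exists i, ~ A n -> ~ P n i.
  have [An|/existsNP[i ni]] := pselect (A n); first by exists 0%N.
  by exists i.
apply: (H U UU ooU i); apply: wU.
by exists 0%N => // n _; exact: iP.
Qed.

Lemma ultra_segment (U : set_system nat) (x_ : nat -> R) t : UltraFilter U ->
  (\forall n \near U, 0 <= x_ n <= t) ->
  exists q, 0 <= q <= t /\ x_ n @[n --> U] --> q.
Proof.
move=> UU xt; have := @segment_compact R 0 t; rewrite compact_ultra.
move=> /(_ _ (ultra_fmap x_ UU)) []; last by move=> q [qt xq]; exists q; move: qt; rewrite /= in_itv.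
by apply: filterS xt => n; rewrite /= in_itv.
Qed.

Variables (V : normedModType R) (X : R -> V) (cX : cadlag X).
Variables (T : Type) (F : set_system T) (FF : ProperFilter F) (x_ : T -> R) (q : R).
Hypothesis xq : x_ n @[n --> F] --> q.

Lemma cadlag_cvg_left : 0 < q -> (\forall n \near F, x_ n < q) ->
  X (x_ n) @[n --> F] --> left_lim X q.
Proof.
move=> q0 xq'; apply: cvg_comp (cadlag_left cX q0).
by move=> A /xq; apply: filterS2 xq' => n nq; exact.
Qed.

Lemma cadlag_cvg_right : 0 <= q -> (\forall n \near F, q <= x_ n) ->
  X (x_ n) @[n --> F] --> X q.
Proof.
move=> q0 xq'; apply/cvgrPdist_le => e e0.
have /cvg_rightP/(_ _ e0)[d d0 Xd] := cX.1 _ q0.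
near=> n; have : q <= x_ n by near: n.
rewrite le_eqVlt => /predU1P[<-|qx]; first by rewrite subrr normr0 ltW.
apply: Xd; rewrite qx /=; near: n.
by apply: (cvgr_lt _ xq); rewrite ltrDl.
Unshelve. all: by end_near. Qed.

End ultrafilter_limits.

Section interval_limits.
Variables (R : realType) (VZ : normedModType R) (Z : R -> VZ).
Hypothesis cZ : cadlag Z.

(** The properties that transfer limits at the end points of intervals from [Z] to another path.
    They hold for compositions with [Z] and for the integral [Y]. *)
Definition adapted (V : normedModType R) (W : R -> V) :=
  [/\ cadlag W, forall u, 0 < u -> jump Z u = 0 -> jump W u = 0 &
    forall a b, 0 <= a -> (forall x, a <= x < b -> Z x = Z a) ->
      forall x, a <= x < b -> W x = W a].

Lemma adapted_self : adapted Z. Proof. by split. Qed.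

Lemma jump0_left_lim (V : normedModType R) (W : R -> V) u : 0 < u -> jump W u = 0 ->
  left_lim W u = W u.
Proof. by rewrite /jump => -> /eqP; rewrite subr_eq0 => /eqP ->. Qed.

Variable (pi : nat -> time_partition R).
Hypothesis aZ : approx_left pi Z.
Variables (U : set_system nat) (UU : UltraFilter U) (ooU : \oo `<=` U).
Variables (t : R) (i : nat -> nat).
Let r_ n := pi n (i n).
Let s_ n := Num.min (pi n (i n).+1) t.
Hypothesis it : \forall n \near U, r_ n < t.

(** A time [v] strictly between [r] and [s] lies in the chosen interval for [U]-almost all [n], so
    its lower point is [r_ n]. Thus [Z (r_ n)] tends to every left limit on []r, s[], and all of
    these agree; right continuity turns this into constancy of [Z]. *)
Let constant_between (r s : R) : 0 <= r -> r < s -> r_ n @[n --> U] --> r ->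
  s_ n @[n --> U] --> s ->
  (forall x, r <= x < s -> Z x = Z r) /\ Z (r_ n) @[n --> U] --> Z r.
Proof.
move=> r0 rs rr ss.
have Zr v : r < v < s -> Z (r_ n) @[n --> U] --> left_lim Z v.
  move=> /andP[rv vs]; have v0 : 0 < v by rewrite (le_lt_trans r0).
  have : Z (lower_pt (pi n) v) @[n --> U] --> left_lim Z v.
    by move=> B /(aZ v0); exact: ooU.
  apply: cvg_trans; apply: near_eq_cvg; near=> n.
  congr Z; rewrite /lower_pt (_ : part_idx (pi n) v = i n)//.
  apply: part_idx_unique; apply/andP; split.
    by near: n; apply: (cvgr_lt _ rr).
  apply: (@le_trans _ _ (s_ n)); last by rewrite ge_min lexx.
  by apply: ltW; near: n; apply: (cvgr_gt _ ss).
pose m := (r + s) / 2; have mrs : r < m < s by apply/andP; split; rewrite /m; lra.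
have Zc x : r <= x < s -> Z x = left_lim Z m.
  move=> /andP[rx xs]; apply/eqP; rewrite -subr_eq0 -normr_le0 distrC.
  apply/ler_addgt0Pr => e e0; rewrite add0r.
  have x0 : 0 <= x by rewrite (le_trans r0).
  have /cvg_rightP/(_ _ e0)[d d0 Zd] := cZ.1 _ x0.
  pose v := x + Num.min d (s - x) / 2.
  have dd : 0 < Num.min d (s - x) by rewrite lt_min d0 subr_gt0.
  have [dm dm'] : Num.min d (s - x) <= d /\ Num.min d (s - x) <= s - x.
    by rewrite !ge_min !lexx orbT.
  have vrs : r < v < s by apply/andP; split; rewrite /v; lra.
  have -> : left_lim Z m = left_lim Z v by exact: cvg_unique (Zr _ mrs) (Zr _ vrs).
  have vx : 0 < v - x by rewrite /v; lra.
  apply: (left_lim_near vx cZ); first by lra.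
  move=> y; rewrite subKr => /andP[xy yv]; rewrite distrC Zd// xy/=.
  by move: yv; rewrite /v; lra.
have Zrm : Z r = left_lim Z m by apply: Zc; rewrite lexx.
split=> [x xrs|]; first by rewrite Zrm Zc.
by rewrite Zrm; exact: Zr.
Unshelve. all: by end_near. Qed.

(* The limit times r <= s of the end points either coincide, or Z is constant on
   [r, s[ because approx_left identifies all left limits of Z on ]r, s[. *)
Lemma interval_limits :
  (forall (V : normedModType R) (W : R -> V), adapted W ->
    exists l : V, W (r_ n) @[n --> U] --> l /\ W (s_ n) @[n --> U] --> l) \/
  (exists w : R, [/\ 0 < w <= t, \forall n \near U, r_ n < w <= s_ n &
    forall (V : normedModType R) (W : R -> V), adapted W ->
      W (r_ n) @[n --> U] --> left_lim W w /\ W (s_ n) @[n --> U] --> W w]).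
Proof.
have r_0 n : 0 <= r_ n by exact: part_pt_ge0.
have [|r [/andP[r0 rt] rr]] := @ultra_segment _ U r_ t UU.
  by apply: filterS it => n /ltW ->; rewrite r_0.
have rs_ : \forall n \near U, r_ n < s_ n.
  by apply: filterS it => n rt'; rewrite lt_min rt' part_pt_lt.
have [|s [/andP[s0 st] ss]] := @ultra_segment _ U s_ t UU.
  apply: filterS rs_ => n rsn; rewrite (le_trans _ (ltW rsn))//=.
  by rewrite ge_min lexx orbT.
have rs : r <= s.
  by apply: (ler_cvg_to rr ss); apply: filterS rs_ => n /ltW.
move: rs; rewrite le_eqVlt => /predU1P[rs|rs].
  rewrite -rs in ss.
  (* [U] decides on which side of the common limit each end point lies. A jump can be seen only if
     they lie on different sides. *)
  have [rl|rg] := in_ultra_setVsetC [set n | r_ n < r] UU; last first.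
    have {}rg : \forall n \near U, r <= r_ n by apply: filterS rg => n /negP; rewrite -leNgt.
    left=> V W [cW _ _]; exists (W r); split; first exact: cadlag_cvg_right.
    apply: cadlag_cvg_right => //; apply: filterS2 rg rs_ => n rn /ltW; exact: le_trans.
  have r0' : 0 < r by have [n rn] := filter_ex rl; exact: le_lt_trans (r_0 n) rn.
  have [sl|sg] := in_ultra_setVsetC [set n | s_ n < r] UU.
    by left=> V W [cW _ _]; exists (left_lim W r); split; exact: cadlag_cvg_left.
  have {}sg : \forall n \near U, r <= s_ n by apply: filterS sg => n /negP; rewrite -leNgt.
  right; exists r; split; first by rewrite r0'.
    by apply: filterS2 rl sg => n /= -> ->.
  move=> V W [cW _ _]; split; first exact: cadlag_cvg_left.
  exact: cadlag_cvg_right.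
have [Zrs Zr] := constant_between r0 rs rr ss.
have Wrs (V : normedModType R) (W : R -> V) : adapted W ->
    W (r_ n) @[n --> U] --> W r /\ left_lim W s = W r.
  move=> [cW jW Wc]; split; last first.
    apply: left_limE; apply/cvg_leftP => e e0; exists (s - r); first by rewrite subr_gt0.
    move=> x; rewrite subKr => /andP[rx xs].
    have -> : W x = W r by apply: (Wc r s r0 Zrs); rewrite (ltW rx) xs.
    by rewrite subrr normr0 ltW.
  have [rl|rg] := in_ultra_setVsetC [set n | r_ n < r] UU; last first.
    apply: cadlag_cvg_right => //.
    by apply: filterS rg => n /negP; rewrite -leNgt.
  have r0' : 0 < r by have [n rn] := filter_ex rl; exact: le_lt_trans (r_0 n) rn.
  (* [Z (r_ n)] tends to [Z r], but also to the left limit of [Z] at [r], as [r_ n < r]. So [Z] does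
     not jump at [r], and neither does [W]. *)
  rewrite -(jump0_left_lim r0'); first exact: cadlag_cvg_left.
  apply: jW => //; rewrite /jump r0'; apply/eqP; rewrite subr_eq0; apply/eqP.
  exact: (cvg_unique _ Zr (cadlag_cvg_left cZ _ rr r0' rl)).
have [sl|sg] := in_ultra_setVsetC [set n | s_ n < s] UU.
  left=> V W aW; have [Wr Ws] := Wrs _ _ aW; exists (W r); split => //.
  rewrite -Ws; apply: cadlag_cvg_left => //; first by case: aW.
  exact: le_lt_trans rs.
have {}sg : \forall n \near U, s <= s_ n by apply: filterS sg => n /negP; rewrite -leNgt.
right; exists s; split; first by rewrite st andbT; exact: le_lt_trans rs.
  apply: filterS2 (cvgr_lt _ rr _ rs) sg => n /= -> ->//.
move=> V W aW; have [Wr Ws] := Wrs _ _ aW; rewrite Ws; split => //.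
by apply: cadlag_cvg_right => //; case: aW.
Qed.

End interval_limits.

Section partition_sums.
Variables (R : realType) (p : time_partition R) (V : normedModType R).
Implicit Types Xi : R -> R -> V.

Lemma sum_at_le (u c : R) N : 0 <= c ->
  \sum_(0 <= i < N) (if p i < u <= p i.+1 then c else 0) <= c.
Proof.
move=> c0; have [kN|kN] := ltnP (part_idx p u) N.
  rewrite (bigD1_seq (part_idx p u)) ?mem_index_iota ?iota_uniq//=.
  rewrite [X in _ + X]big1 ?addr0; first by case: ifP.
  by move=> i ik; case: ifP => // /part_idx_unique ki; rewrite ki eqxx in ik.
rewrite big_nat_cond big1// => i /andP[/andP[_ iN] _]; case: ifP => // /part_idx_unique ki.
by move: kN; rewrite ki leqNgt iN.
Qed.

Lemma part_sum_stopped (W : normedModType R) (F : R -> V -> W) Xi (u : R) N : u <= p N ->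
  (forall r, F r 0 = 0) -> (forall x, Xi x x = 0) ->
  part_sum p (fun r s => F r (Xi (Num.min r u) (Num.min s u))) =
  \sum_(0 <= i < N) F (p i) (Xi (Num.min (p i) u) (Num.min (p i.+1) u)).
Proof.
move=> uN F0 Xi0.
apply: (part_sumE uN) => i ui.
by rewrite !min_r ?Xi0// (le_trans ui)// ltW// part_pt_lt.
Qed.

End partition_sums.

(** * Riemann sums of operators against an abstract integrator *)

Section riemann_sums.
Variables (R : realType) (VZ V : normedModType R) (W : completeNormedModType R).
Variables (Z : R -> VZ) (pi : nat -> time_partition R) (m : mode).
Variables (H : R -> 'L(V, W)) (g : R -> V) (w : R -> R) (I : R -> W) (Xi : R -> R -> V).
Hypotheses (cH : cadlag H) (cw : forall t, control w g t).
Hypotheses (IH : sewing g w H I) (I0 : I 0 = 0).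
Hypothesis HL : forall u, 0 < u -> H (lower_pt (pi n) u) @[n --> \oo] --> left_lim H u.
Hypothesis HZ : forall u, 0 < u -> jump Z u = 0 -> jump H u = 0.
Hypothesis Xi0 : forall x, Xi x x = 0.

(* Xi x y is to be thought of as B y - B x or (X y - X x) \ox (X y - X x). *)
Let xi u r s := Xi (Num.min r u) (Num.min s u).
Let S n u := part_sum (pi n) (xi u).
Let N n u : R := part_sum (pi n) (fun r s => `|xi u r s| : R^o).
Let J n u := part_sum (pi n) (fun r s => H r (xi u r s)).

(** The only hypothesis that refers to the mode [m]; the others concern norms. *)
Hypothesis Sg : forall u v, 0 <= u -> u <= v ->
  cvg_mode m (fun n => S n v - S n u) (g v - g u).
Hypothesis Nbnd : forall t, 0 <= t -> exists M, forall n, N n t <= M.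
Let rn n u := lower_pt (pi n) u.
Let sn n u v := Num.min (upper_pt (pi n) u) v.
Hypothesis Xi_jump : forall u v, 0 < u -> u < v -> jump Z u != 0 ->
  Xi (rn n u) (sn n u v) - Xi (rn n u) u @[n --> \oo] --> 0.
Hypothesis Xi_cont : forall u, 0 < u -> jump Z u = 0 -> Xi (rn n u) u @[n --> \oo] --> 0.
Hypothesis Xi_bnd : forall t, 0 <= t -> exists M, forall x y, 0 <= x <= t -> 0 <= y <= t ->
  `|Xi x y| <= M.

(* The interval that contains u is cut at u.  Its contribution vanishes because
   either Z, hence H, is continuous at u, or both parts see the whole jump. *)
Let local_error (u v e : R) : 0 < u -> u < v -> 0 <= e -> exists er : nat -> R,
  [/\ er n @[n --> \oo] --> 0, forall n, 0 <= er n & forall n,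
    `|H (rn n u) - H u| * `|Xi (rn n u) (sn n u v) - Xi (rn n u) u| +
    e * (`|Xi (rn n u) u| - `|Xi (rn n u) (sn n u v)|) <= er n].
Proof.
move=> u0 uv e0; pose D n := `|Xi (rn n u) (sn n u v) - Xi (rn n u) u|.
(* Bounds the difference of norms in the second summand: without a jump of [Z] at [u] the first norm
   alone tends to 0, with a jump only the difference does. *)
pose E n := if jump Z u == 0 then `|Xi (rn n u) u| else D n.
have HLu : `|H (rn n u) - H u| @[n --> \oo] --> `|left_lim H u - H u|.
  by apply: cvg_norm; apply: cvgB (HL u0) _; exact: cvg_cst.
exists (fun n => `|H (rn n u) - H u| * D n + e * E n); split.
- rewrite -[0](addr0 0) -[X in _ + X](mulr0 e); apply: cvgD; last first.
    apply: cvgMr; rewrite /E; have [jZ|jZ] := eqVneq (jump Z u) 0.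
      by apply/norm_cvg0P; exact: Xi_cont.
    by apply/norm_cvg0P; exact: Xi_jump.
  have [jZ|jZ] := eqVneq (jump Z u) 0; last first.
    rewrite -(mulr0 `|left_lim H u - H u|).
    by apply: cvgM => //; apply/norm_cvg0P; exact: Xi_jump.
  have [M XiM] := Xi_bnd (ltW (lt_trans u0 uv)).
  apply: (@cvg_dominated _ _ _ _ _ _ (fun n => `|H (rn n u) - H u| * (M + M))).
    apply: nearW => n; rewrite subr0 normrM normr_id ler_wpM2l// normr_id.
    have /andP[ru us] := part_idxP (pi n) u0.
    have r0 : 0 <= rn n u by exact: part_pt_ge0.
    have rin : 0 <= rn n u <= v by rewrite r0 ltW// (lt_trans ru).
    have uin : 0 <= u <= v by rewrite !ltW.
    have sin : 0 <= sn n u v <= v.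
      by rewrite /sn le_min ge_min lexx orbT (ltW (lt_trans u0 uv)) part_pt_ge0.
    by rewrite (le_trans (ler_normB _ _))// lerD// XiM.
  rewrite -(mul0r (M + M)); apply: cvgMl.
  by have := HLu; rewrite (jump0_left_lim u0 (HZ u0 jZ)) subrr normr0.
- move=> n; have E0 : 0 <= E n by rewrite /E /D; case: ifP.
  by rewrite addr_ge0// mulr_ge0// /D.
- move=> n; rewrite lerD2l ler_wpM2l// /E; case: ifP => _.
    by rewrite gerBl.
  by rewrite /D distrC; exact: lerB_dist.
Qed.

(** Intervals to the left of [u] contribute equally at the times [u] and [v] and cancel. To the
    right of [u], [H] is within [e] of [H u]. Only the interval that contains [u] leaves the error
    [er]. *)
Let local_estimate (u v e : R) : 0 <= u -> u < v -> 0 <= e ->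
  (forall x, u <= x < v -> `|H x - H u| <= e) -> exists er : nat -> R,
  er n @[n --> \oo] --> 0 /\
  forall n, `|J n v - J n u - H u (S n v - S n u)| <= e * (N n v - N n u) + er n.
Proof.
move=> u0 uv e0 Hu.
have [er [er0 er_ge0 erP]] : exists er : nat -> R,
    [/\ er n @[n --> \oo] --> 0, forall n, 0 <= er n & forall n i, pi n i < u <= pi n i.+1 ->
    `|(H (pi n i) - H u) (xi v (pi n i) (pi n i.+1) - xi u (pi n i) (pi n i.+1))| <=
    e * (`|xi v (pi n i) (pi n i.+1)| - `|xi u (pi n i) (pi n i.+1)|) + er n].
  have [u0'|u0'] := ltP 0 u; last first.
    exists (fun=> 0); split=> // [|n i /andP[/lt_le_trans/(_ u0')]]; first exact: cvg_cst.
    by rewrite ltNge part_pt_ge0.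
  have [er [er0 er_ge0 erP]] := local_error u0' uv e0.
  exists er; split => // n i iu; have iE := part_idx_unique iu.
  have rE : rn n u = pi n i by rewrite /rn /lower_pt iE.
  have sE : sn n u v = Num.min (pi n i.+1) v by rewrite /sn /upper_pt iE.
  have /andP[ru us] := iu.
  have -> : xi v (pi n i) (pi n i.+1) = Xi (rn n u) (sn n u v).
    by rewrite /xi rE sE [Num.min (pi n i) v]min_l// ltW// (lt_trans ru).
  have -> : xi u (pi n i) (pi n i.+1) = Xi (rn n u) u.
    by rewrite /xi rE [Num.min (pi n i) u]min_l ?(ltW ru)// min_r.
  rewrite -rE (le_trans (opnorm_le _ _))//.
  rewrite -lerBlDl (le_trans _ (erP n))// lerD2l -mulrN opprB//.
exists er; split => // n.
have [K vK] := part_pt_unbounded (pi n) v.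
have uK : u <= pi n K by rewrite (le_trans _ vK)// ltW.
have JE x : x <= pi n K -> J n x = \sum_(0 <= i < K) H (pi n i) (xi x (pi n i) (pi n i.+1)).
  move=> xK; apply: (@part_sum_stopped _ (pi n) V W (fun r x => H r x)) => //.
  by move=> r; exact: bop0.
have SE x : x <= pi n K -> S n x = \sum_(0 <= i < K) xi x (pi n i) (pi n i.+1).
  by move=> xK; apply: (@part_sum_stopped _ (pi n) V V (fun r x => x)).
have NE x : x <= pi n K -> N n x = \sum_(0 <= i < K) `|xi x (pi n i) (pi n i.+1)|.
  move=> xK; apply: (@part_sum_stopped _ (pi n) V R^o (fun r x => `|x|)) => //.
  by move=> r; exact: normr0.
rewrite !JE// !SE// !NE// -!sumrB.
have -> : H u (\sum_(0 <= i < K) (xi v (pi n i) (pi n i.+1) - xi u (pi n i) (pi n i.+1))) =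
    \sum_(0 <= i < K) H u (xi v (pi n i) (pi n i.+1) - xi u (pi n i) (pi n i.+1)).
  exact: linear_sum.
rewrite -sumrB (le_trans (ler_norm_sum _ _ _))//.
apply: (@le_trans _ _ (\sum_(0 <= i < K)
  (e * (`|xi v (pi n i) (pi n i.+1)| - `|xi u (pi n i) (pi n i.+1)|) +
   (if pi n i < u <= pi n i.+1 then er n else 0)))).
  apply: ler_sum => i _; rewrite -bopB.
  have -> : H (pi n i) (xi v (pi n i) (pi n i.+1) - xi u (pi n i) (pi n i.+1)) -
      H u (xi v (pi n i) (pi n i.+1) - xi u (pi n i) (pi n i.+1)) =
      (H (pi n i) - H u) (xi v (pi n i) (pi n i.+1) - xi u (pi n i) (pi n i.+1)) by [].
  have ri := part_pt_lt (pi n) i.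
  case: ifP => [|/negbT]; first exact: erP.
  rewrite negb_and -leNgt -ltNge addr0 => /orP[ur|su].
    have -> : xi u (pi n i) (pi n i.+1) = 0.
      by rewrite /xi !min_r ?Xi0// (le_trans ur)// ltW.
    rewrite normr0 !subr0; have [vr|rv] := leP v (pi n i).
      have -> : xi v (pi n i) (pi n i.+1) = 0.
        by rewrite /xi !min_r ?Xi0// (le_trans vr)// ltW.
      by rewrite bop0 !normr0 mulr0.
    by rewrite (le_trans (opnorm_le _ _))// ler_wpM2r// Hu// ur.
  have -> : xi v (pi n i) (pi n i.+1) = xi u (pi n i) (pi n i.+1).
    have sv := lt_trans su uv; have ru := lt_trans ri su; have rv := lt_trans ru uv.
    by rewrite /xi !min_l ?(ltW su) ?(ltW sv) ?(ltW ru) ?(ltW rv).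
  by rewrite !subrr bop0 normr0 mulr0.
rewrite big_split/= -mulr_sumr lerD2l; exact: sum_at_le.
Qed.

(** Induction along the steps on which [H] varies by at most [e]. Each step adds to [a] the fixed
    operator [H u] applied to a sequence that is null in the mode [m], which is again null in that
    mode; [er] collects the norm errors of the cut intervals. *)
Let approximation e t : 0 < e -> 0 <= t -> exists a : nat -> W, exists er : nat -> R,
  [/\ cvg_mode m a 0, er n @[n --> \oo] --> 0 &
    forall n, `|J n t - I t - a n| <= e * (N n t + w t - w 0) + er n].
Proof.
move=> e0; move: t; apply: (cadlag_ind cH e0) => [|u v u0 uv Hu [a [er [a0 er0 Ja]]]].
  exists (fun=> 0), (fun=> 0); split=> [||n]; [by apply: cvg_mode_norm; exact: cvg_cst|exact: cvg_cst|].
  have K0 : 0 <= pi n 0%N by rewrite part_pt0.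
  have -> : J n 0 = 0.
    rewrite /J (@part_sum_stopped _ (pi n) V W (fun r x => H r x) Xi 0 0)//.
      by rewrite big_nil.
    by move=> r; exact: bop0.
  have -> : N n 0 = 0.
    rewrite /N (@part_sum_stopped _ (pi n) V R^o (fun r x => `|x|) Xi 0 0)//.
      by rewrite big_nil.
    by move=> r; exact: normr0.
  by rewrite I0 !subr0 normr0 add0r subrr mulr0 addr0.
have [er' [er'0 er'P]] := local_estimate u0 uv (ltW e0) Hu.
exists (fun n => a n + H u ((S n v - S n u) - (g v - g u))), (fun n => er n + er' n); split.
- have -> : (0 : W) = 0 + H u ((g v - g u) - (g v - g u)) by rewrite subrr bop0 addr0.
  apply: cvg_modeD => //; apply: cvg_mode_bop; apply: cvg_modeB.
    by apply: Sg => //; exact: ltW.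
  by apply: cvg_mode_norm; exact: cvg_cst.
- by rewrite -[0](addr0 0); exact: cvgD.
- move=> n.
  have -> : J n v - I v - (a n + H u ((S n v - S n u) - (g v - g u))) =
      (J n u - I u - a n) + ((J n v - J n u - H u (S n v - S n u)) -
      (I v - I u - H u (g v - g u))).
    rewrite [H u (_ - (g v - g u))]bopB.
    move: (J n v) (J n u) (I v) (I u) (a n) (H u _) (H u _) => x1 x2 x3 x4 x5 x6 x7.
    by vring.
  rewrite (le_trans (ler_normD _ _))//.
  apply: (@le_trans _ _ ((e * (N n u + w u - w 0) + er n) +
      ((e * (N n v - N n u) + er' n) + e * (w v - w u)))).
    apply: lerD; first exact: Ja.
    by apply: (le_trans (ler_normB _ _)); apply: lerD; [exact: er'P|exact: IH].
  by rewrite le_eqVlt; apply/orP; left; apply/eqP; ring.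
Qed.

Lemma riemann_sums_cvg t : 0 <= t -> cvg_mode m (fun n => J n t) (I t).
Proof.
move=> t0; apply: cvg_mode_approx => d d0; have [M NM] := Nbnd t0.
(* Bounds [N n t + w t - w 0] for all [n], so that the tolerance of [approximation] can be fixed
   before [n]. *)
pose K := `|M + w t - w 0| + 1; have K0 : 0 < K by rewrite ltr_wpDl.
have e0 : 0 < d / 2 / K by rewrite !divr_gt0.
have [a [er [a0 er0 Ja]]] := approximation e0 t0.
exists a => //; near=> n; rewrite (le_trans (Ja n))// [leRHS]splitr lerD//.
  apply: (@le_trans _ _ (d / 2 / K * K)); last by rewrite divfK// gt_eqF.
  rewrite ler_wpM2l// ?(ltW e0)// /K; have := NM n.
  have := ler_norm (M + w t - w 0); lra.
rewrite (le_trans (ler_norm _))//; near: n.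
by have /cvgr0Pnorm_le/(_ (d / 2)) := er0; apply; rewrite divr_gt0.
Unshelve. all: by end_near. Qed.

End riemann_sums.

(** * Elementary tensors and tensor squares of operators *)

Section tensor_elements.
Variables (R : realType).

Lemma tensor_sumE (E F : normedModType R) (u : tensor E F) :
  exists s : seq (E * F), forall b, u b = \sum_(p <- s) b p.1 p.2.
Proof. by case: u => u /= /asboolP[s ->]; exists s. Qed.

Variables (alpha : crossnorm_family R) (alphaU : uniform_crossnorm alpha).

Section completed.
Variables (E F : completeNormedModType R) (C : completion (@alpha E F)).

Definition tp (x : E) (y : F) : C := cpl_inj C (x \ox y).

Lemma tpDl x x' y : tp (x + x') y = tp x y + tp x' y.
Proof.
rewrite /tp -linearD; congr (cpl_inj C _); apply/val_inj/funext => b.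
exact: linearDl.
Qed.

Lemma tpDr x y y' : tp x (y + y') = tp x y + tp x y'.
Proof.
rewrite /tp -linearD; congr (cpl_inj C _); apply/val_inj/funext => b.
exact: linearDr.
Qed.

Lemma tpNl x y : tp (- x) y = - tp x y.
Proof.
rewrite /tp -linearN; congr (cpl_inj C _); apply/val_inj/funext => b.
exact: linearNl.
Qed.

Lemma tpNr x y : tp x (- y) = - tp x y.
Proof.
rewrite /tp -linearN; congr (cpl_inj C _); apply/val_inj/funext => b.
exact: linearNr.
Qed.


Lemma tp0l y : tp 0 y = 0.
Proof. by apply: (addrI (tp 0 y)); rewrite -tpDl !addr0. Qed.

Lemma tp_le x y : `|tp x y| <= `|x| * `|y|.
Proof.
by rewrite /tp cpl_norm; exact: (crossnorm_elt (uniform_reasonable alphaU E F)).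
Qed.

Lemma tpB x x' y y' : tp x y - tp x' y' = tp (x - x') y + tp x' (y - y').
Proof. by rewrite tpDl tpNl tpDr tpNr addrA subrK. Qed.

Lemma tp_cvg (T : Type) (FF : set_system T) {PF : Filter FF} (x_ : T -> E) (y_ : T -> F) x y :
  x_ t @[t --> FF] --> x -> y_ t @[t --> FF] --> y ->
  tp (x_ t) (y_ t) @[t --> FF] --> tp x y.
Proof.
move=> xx yy.
apply: (@cvg_dominated _ _ _ _ _ _ (fun t => `|x_ t - x| * `|y_ t| + `|x| * `|y_ t - y|)).
  apply: nearW => t; rewrite tpB (le_trans (ler_normD _ _))//.
  by apply: lerD; exact: tp_le.
have -> : (0 : R) = `|x - x| * `|y| + `|x| * `|y - y|.
  by rewrite !subrr !normr0 mul0r mulr0 addr0.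
apply: cvgD; apply: cvgM; [|exact: cvg_norm|exact: cvg_cst|].
  by apply: cvg_norm; apply: cvgB xx _; exact: cvg_cst.
by apply: cvg_norm; apply: cvgB yy _; exact: cvg_cst.
Qed.

End completed.

Section operators.
Variables (E G : completeNormedModType R).
Variables (EE : completion (@alpha E E)) (GG : completion (@alpha G G)).

Lemma tensor_op_tp (T S : 'L(E, G)) x y : tensor_op EE GG T S (tp EE x y) = tp GG (T x) (S y).
Proof. by have [-> _] := tensor_opP EE GG T S alphaU; rewrite tensor_map_elt. Qed.

Lemma tensor_op_le (T S : 'L(E, G)) : `|tensor_op EE GG T S| <= `|T| * `|S|.
Proof. by have [] := tensor_opP EE GG T S alphaU. Qed.

(** The product rule that makes the tensor square continuous in operator norm. It is checked on the
    dense algebraic tensors, which determine the extensions. *)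
Lemma tensor_opB (T S : 'L(E, G)) : tensor_op EE GG T T - tensor_op EE GG S S =
  tensor_op EE GG (T - S) T + tensor_op EE GG S (T - S).
Proof.
apply: (@completion_ext _ _ _ EE GG) => u.
have E1 := (tensor_opP EE GG T T alphaU).1 u.
have E2 := (tensor_opP EE GG S S alphaU).1 u.
have E3 := (tensor_opP EE GG (T - S) T alphaU).1 u.
have E4 := (tensor_opP EE GG S (T - S) alphaU).1 u.
rewrite -[LHS]/(tensor_op EE GG T T (cpl_inj EE u) - tensor_op EE GG S S (cpl_inj EE u)).
rewrite -[RHS]/(tensor_op EE GG (T - S) T (cpl_inj EE u) + tensor_op EE GG S (T - S) (cpl_inj EE u)).
rewrite E1 E2 E3 E4 -linearB -linearD; congr (cpl_inj GG _).
apply/val_inj/funext => b.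
have [s us] := tensor_sumE u.
rewrite -[LHS]/(u (pull_form T T b) - u (pull_form S S b)).
rewrite -[RHS]/(u (pull_form (T - S) T b) + u (pull_form S (T - S) b)).
rewrite !us -sumrB -big_split/=; apply: eq_bigr => p _.
rewrite /pull_form.
rewrite -[(T - S) p.1]/(T p.1 - S p.1) -[(T - S) p.2]/(T p.2 - S p.2).
by rewrite linearBl linearBr/= addrA subrK.
Qed.

Lemma tensor_op_cvg (T : Type) (F : set_system T) {FF : Filter F} (S_ : T -> 'L(E, G)) (S : 'L(E, G)) :
  S_ t @[t --> F] --> S ->
  tensor_op EE GG (S_ t) (S_ t) @[t --> F] --> tensor_op EE GG S S.
Proof.
move=> SS.
apply: (@cvg_dominated _ _ _ _ _ _ (fun t => `|S_ t - S| * `|S_ t| + `|S| * `|S_ t - S|)).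
  apply: nearW => t; rewrite tensor_opB (le_trans (ler_normD _ _))//.
  by apply: lerD; exact: tensor_op_le.
have -> : (0 : R) = `|S - S| * `|S| + `|S| * `|S - S|.
  by rewrite !subrr !normr0 mul0r mulr0 addr0.
apply: cvgD; apply: cvgM; [|exact: cvg_norm|exact: cvg_cst|].
  by apply: cvg_norm; apply: cvgB SS _; exact: cvg_cst.
by apply: cvg_norm; apply: cvgB SS _; exact: cvg_cst.
Qed.

End operators.

End tensor_elements.

(** * Functions of the path inside a compact box *)

Section compact_paths.
Variables (R : realType) (E F : completeNormedModType R).
Variables (A : R -> F) (X : R -> E) (pi : nat -> time_partition R).
Hypotheses (cA : cadlag A) (cX : cadlag X).
Let Z t := (A t, X t).

Definition path_hull (V : normedModType R) (B : R -> V) t :=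
  closure [set B x | x in [set x | 0 <= x <= t]].

(** A product of two hulls and not the hull of the pair, because the Taylor expansion changes one
    coordinate after the other. The closures take in the left limits. *)
Definition box t : set (F * E) := path_hull A t `*` path_hull X t.

Lemma box_compact t : 0 <= t -> compact (box t).
Proof. by move=> t0; apply: compact_setX; exact: cadlag_compact. Qed.

Lemma path_in_box t s : 0 <= s <= t -> box t (Z s).
Proof. by move=> st; split => /=; apply: subset_closure; exists s. Qed.

Lemma left_lim_in_box t s : 0 < s <= t -> box t (left_lim A s, left_lim X s).
Proof. by move=> st; split; exact: cadlag_closure_left. Qed.

Lemma left_lim_pair s : 0 < s -> left_lim Z s = (left_lim A s, left_lim X s).
Proof. exact: pair_left_lim. Qed.

Lemma cadlag_Z : cadlag Z. Proof. exact: cadlag_pair. Qed.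

Lemma jump_pair s : jump Z s = (jump A s, jump X s).
Proof. by rewrite /jump; case: ifP => // s0; rewrite left_lim_pair. Qed.

Variables (W : normedModType R) (h : F * E -> W).
Hypothesis ch : compactly_continuous h.

Lemma compose_right t : 0 <= t -> h (Z x) @[x --> t^'+] --> h (Z t).
Proof.
move=> t0; have t1 : 0 <= t + 1 by rewrite addr_ge0.
apply: (compact_cvg (ch (box_compact t1))).
- by apply: path_in_box; rewrite t0 lerDl ler01.
- near=> x; apply: path_in_box; apply/andP; split.
    by apply: (le_trans t0); near: x; exact: nbhs_right_ge.
  by near: x; apply: nbhs_right_le; rewrite ltrDl.
- exact: cadlag_Z.1.
Unshelve. all: by end_near. Qed.

Lemma compose_left t : 0 < t -> h (Z x) @[x --> t^'-] --> h (left_lim A t, left_lim X t).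
Proof.
move=> t0; apply: (compact_cvg (ch (box_compact (ltW t0)))).
- by apply: left_lim_in_box; rewrite t0 lexx.
- near=> x; apply: path_in_box; apply/andP; split.
    by near: x; exact: nbhs_left_ge.
  by near: x; exact: nbhs_left_le.
- by rewrite -left_lim_pair//; exact: cadlag_left cadlag_Z t0.
Unshelve. all: by end_near. Qed.

Lemma compose_left_lim t : 0 < t -> left_lim (h \o Z) t = h (left_lim A t, left_lim X t).
Proof. by move=> t0; apply: left_limE; exact: compose_left. Qed.

Lemma compose_cadlag : cadlag (h \o Z).
Proof.
split=> t t0; first exact: compose_right.
by apply/cvg_ex; eexists; exact: compose_left.
Qed.

Lemma compose_jump0 t : 0 < t -> jump Z t = 0 -> jump (h \o Z) t = 0.
Proof.
move=> t0 /(jump0_left_lim t0); rewrite left_lim_pair// => Zt.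
by rewrite /jump t0 compose_left_lim// Zt subrr.
Qed.

Lemma compose_adapted : adapted Z (h \o Z).
Proof.
split; [exact: compose_cadlag|exact: compose_jump0|move=> a b a0 Zc x xab].
by rewrite /= (Zc x xab).
Qed.

Hypothesis aZ : approx_left pi Z.

Lemma compose_approx_left t : 0 < t ->
  (h \o Z) (lower_pt (pi n) t) @[n --> \oo] --> left_lim (h \o Z) t.
Proof.
move=> t0; rewrite compose_left_lim//.
apply: (compact_cvg (ch (box_compact (ltW t0)))).
- by apply: left_lim_in_box; rewrite t0 lexx.
- apply: nearW => n; apply: path_in_box; rewrite part_pt_ge0/=.
  by have /andP[/ltW] := part_idxP (pi n) t0.
- by rewrite -left_lim_pair//; exact: aZ.
Qed.

End compact_paths.

(** * The Taylor remainder, of first order in a and second order in x *)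

Section taylor_remainder.
Variables (R : realType) (E F G : completeNormedModType R).
Variables (alpha : crossnorm_family R) (alphaU : uniform_crossnorm alpha).
Variables (EE : completion (@alpha E E)).
Variables (f : F * E -> G) (Daf : F * E -> 'L(F, G)) (Dxf : F * E -> 'L(E, G)).
Variables (Dxxf : F * E -> 'L(E, 'L(E, G))) (D2f : F * E -> 'L(EE, G)).
Hypothesis dfa : forall a x, gateaux (fun b => f (b, x)) a (Daf (a, x)).
Hypothesis dfx : forall a x, gateaux (fun y => f (a, y)) x (Dxf (a, x)).
Hypothesis dfxx : forall a x, gateaux (fun y => Dxf (a, y)) x (Dxxf (a, x)).
Hypotheses (cDaf : compactly_continuous Daf) (cDxf : compactly_continuous Dxf).
Hypothesis cD2f : compactly_continuous D2f.
Hypothesis D2fE : forall p y z, D2f p (cpl_inj EE (y \ox z)) = Dxxf p y z.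

Definition remainder (z z' : F * E) : G :=
  f z' - f z - Daf z (z'.1 - z.1) - Dxf z (z'.2 - z.2)
  - 2^-1 *: D2f z (tp EE (z'.2 - z.2) (z'.2 - z.2)).

Lemma remainder_diag z : remainder z z = 0.
Proof. by rewrite /remainder !subrr tp0l !bop0 scaler0 !subr0. Qed.

Variables (KA : set F) (KX : set E).
Hypotheses (cKA : compact KA) (cKX : compact KX).
Let K' := segments KA `*` segments KX.

Let cK' : compact K'. Proof. by apply: compact_setX; exact: segments_compact. Qed.

(** The first coordinate moves while the second is held at its final value, then the second moves
    while the first is held at its initial value. In the maximum norm, all points on the way are at
    most as far from [z] as [z'] is. *)
Lemma remainder_core z z' k : KA z.1 -> KX z.2 -> KA z'.1 -> KX z'.2 ->
  (forall y, K' y -> `|y - z| <= `|z' - z| ->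
    `|Daf y - Daf z| <= k /\ `|D2f y - D2f z| <= k) ->
  `|remainder z z'| <= k * (`|z'.1 - z.1| + `|z'.2 - z.2| ^+ 2).
Proof.
case: z z' => [a x] [a' x'] /= Ka Kx Ka' Kx' Dk.
have nth (V : normedModType R) (v : V) (th : R) : 0 <= th <= 1 -> `|th *: v| <= `|v|.
  by move=> /andP[t0 t1]; rewrite normrZ ger0_norm// ler_piMl.
have seg1 (V : normedModType R) (KV : set V) u u' (th : R) : KV u -> KV u' -> 0 <= th <= 1 ->
    segments KV (u + th *: (u' - u)).
  by move=> Ku Ku' th01; exists u, u', th.
have H1 : `|f (a', x') - f (a, x') - Daf (a, x) (a' - a)| <= k * `|a' - a|.
  have := @gateaux_taylor1 R F G (fun b => f (b, x')) (fun b => Daf (b, x')) (Daf (a, x)) a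
    (a' - a) k (fun b => dfa b x'); rewrite /= [a + (a' - a)]addrC subrK; apply => th th01.
  apply: (Dk (_, _) _ _).1; first by split => /=; [exact: seg1|exact: sub_segments].
  rewrite -[_ - _]/(a + th *: (a' - a) - a, x' - x) -[X in _ <= X]/(`|(a' - a, x' - x)|).
  rewrite !prod_normE/= addrAC subrr add0r ge_max !le_max lexx orbT andbT.
  by rewrite nth.
have H2 : `|f (a, x') - f (a, x) - Dxf (a, x) (x' - x) -
    2^-1 *: D2f (a, x) (tp EE (x' - x) (x' - x))| <= k * `|x' - x| ^+ 2.
  have := @gateaux_taylor2 R E G (fun y => f (a, y)) (fun y => Dxf (a, y)) (fun y => Dxxf (a, y))
    (D2f (a, x) (tp EE (x' - x) (x' - x))) x (x' - x) (k * `|x' - x| ^+ 2) (dfx a) (dfxx a).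
  rewrite /= [x + (x' - x)]addrC subrK; apply => th th01.
  rewrite -D2fE.
  have -> : D2f (a, x + th *: (x' - x)) (cpl_inj EE ((x' - x) \ox (x' - x))) -
     D2f (a, x) (tp EE (x' - x) (x' - x)) =
     (D2f (a, x + th *: (x' - x)) - D2f (a, x)) (tp EE (x' - x) (x' - x)) by [].
  have Dk2 : `|D2f (a, x + th *: (x' - x)) - D2f (a, x)| <= k.
    apply: (Dk (_, _) _ _).2; first by split => /=; [exact: sub_segments|exact: seg1].
    rewrite -[_ - _]/(a - a, x + th *: (x' - x) - x) -[X in _ <= X]/(`|(a' - a, x' - x)|).
    rewrite !prod_normE/= [x + _]addrC addrK subrr normr0 ge_max le_max normr_ge0/=.
    by rewrite le_max nth// orbT.
  rewrite (le_trans (opnorm_le _ _))//.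
  apply: ler_pM => //; [exact: opnorm_ge0|by rewrite expr2; exact: tp_le].
rewrite /remainder/=.
have -> : f (a', x') - f (a, x) - Daf (a, x) (a' - a) - Dxf (a, x) (x' - x) -
    2^-1 *: D2f (a, x) (tp EE (x' - x) (x' - x)) =
    (f (a', x') - f (a, x') - Daf (a, x) (a' - a)) +
    (f (a, x') - f (a, x) - Dxf (a, x) (x' - x) -
    2^-1 *: D2f (a, x) (tp EE (x' - x) (x' - x))).
  move: (Daf (a, x) _) (Dxf (a, x) _) (D2f (a, x) _) => u1 u2 u3; vring.
by rewrite mulrDr (le_trans (ler_normD _ _))// lerD.
Qed.

Lemma remainder_small k : 0 < k -> exists2 d, 0 < d & forall z z',
  KA z.1 -> KX z.2 -> KA z'.1 -> KX z'.2 -> `|z' - z| <= d ->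
  `|remainder z z'| <= k * (`|z'.1 - z.1| + `|z'.2 - z.2| ^+ 2).
Proof.
move=> k0; have [d1 d10 Dd1] := compact_uniform cK' (cDaf cK') k0.
have [d2 d20 Dd2] := compact_uniform cK' (cD2f cK') k0.
exists (Num.min d1 d2) => [|z z' Ka Kx Ka' Kx' zz']; first by rewrite lt_min d10.
apply: remainder_core => // y Ky yz.
have Kz : K' z by split; exact: sub_segments.
move: (le_trans yz zz'); rewrite le_min => /andP[yz1 yz2].
by split; [exact: Dd1|exact: Dd2].
Qed.

Lemma remainder_bounded : exists2 L, 0 <= L & forall z z',
  KA z.1 -> KX z.2 -> KA z'.1 -> KX z'.2 ->
  `|remainder z z'| <= L * (`|z'.1 - z.1| + `|z'.2 - z.2| ^+ 2).
Proof.
have [M1 M10 DM1] := compact_norm_bound cK' (cDaf cK').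
have [M2 M20 DM2] := compact_norm_bound cK' (cD2f cK').
exists (2 * (M1 + M2)) => [|z z' Ka Kx Ka' Kx']; first by rewrite mulr_ge0// addr_ge0.
apply: remainder_core => // y Ky yz.
have Kz : K' z by split; exact: sub_segments.
split; rewrite (le_trans (ler_normB _ _))//.
  by have := DM1 _ Ky; have := DM1 _ Kz; lra.
by have := DM2 _ Ky; have := DM2 _ Kz; lra.
Qed.

(** The expansion of [f y - f z] is read backwards: the remainder is bounded by the increments, so
    every term tends to 0. *)
Lemma continuous_box : {within KA `*` KX, continuous f}.
Proof.
pose K := KA `*` KX; rewrite -/K.
apply/subspace_continuousP => z Kz; have [L L0 rL] := remainder_bounded.
pose da (y : F * E) := `|y.1 - z.1|; pose dx (y : F * E) := `|y.2 - z.2|.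
apply: (@cvg_dominated _ _ _ _ _ _ (fun y => L * (da y + dx y ^+ 2) + `|Daf z| * da y +
  `|Dxf z| * dx y + 2^-1 * (`|D2f z| * (dx y * dx y)))).
  near=> y; have Ky : K y by near: y; exact: withinT.
  rewrite (_ : f y - f z = remainder z y + Daf z (y.1 - z.1) + Dxf z (y.2 - z.2) +
      2^-1 *: D2f z (tp EE (y.2 - z.2) (y.2 - z.2))); last first.
    rewrite /remainder.
    move: (Daf z _) (Dxf z _) (D2f z _) => u1 u2 u3; vring.
  apply: (le_trans (ler_normD _ _)); apply: lerD; last first.
    rewrite normrZ ger0_norm ?invr_ge0// ler_wpM2l ?invr_ge0//.
    by rewrite (le_trans (opnorm_le _ _))// ler_wpM2l ?opnorm_ge0//; exact: tp_le.
  apply: (le_trans (ler_normD _ _)); apply: lerD; last exact: opnorm_le.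
  apply: (le_trans (ler_normD _ _)); apply: lerD; last exact: opnorm_le.
  by apply: rL; [exact: Kz.1|exact: Kz.2|exact: Ky.1|exact: Ky.2].
have da0 : da y @[y --> within K (nbhs z)] --> 0.
  rewrite -(@normr0 _ F) -(subrr z.1); apply: cvg_norm; apply: cvgB; last exact: cvg_cst.
  apply: (@cvg_comp _ _ _ id fst _ (nbhs z)); [exact: cvg_within|exact: cvg_fst].
have dx0 : dx y @[y --> within K (nbhs z)] --> 0.
  rewrite -(@normr0 _ E) -(subrr z.2); apply: cvg_norm; apply: cvgB; last exact: cvg_cst.
  apply: (@cvg_comp _ _ _ id snd _ (nbhs z)); [exact: cvg_within|exact: cvg_snd].
have -> : (0 : R) = L * (0 + 0 * 0) + `|Daf z| * 0 + `|Dxf z| * 0 + 2^-1 * (`|D2f z| * (0 * 0)).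
  by rewrite !(mulr0, addr0).
have dd0 : dx y * dx y @[y --> within K (nbhs z)] --> (0 * 0 : R) by exact: cvgM.
apply: cvgD; last by apply: cvgMr; apply: cvgMr; exact: dd0.
by apply: cvgD; [apply: cvgD|]; apply: cvgMr => //; apply: cvgD.
Unshelve. all: by end_near. Qed.

Lemma remainder_cvg (T : Type) (FF : set_system T) {PF : Filter FF} (z_ z'_ : T -> F * E) z z' :
  {within KA `*` KX, continuous f} ->
  (\forall t \near FF, (KA `*` KX) (z_ t)) -> (\forall t \near FF, (KA `*` KX) (z'_ t)) ->
  (KA `*` KX) z -> (KA `*` KX) z' -> z_ t @[t --> FF] --> z -> z'_ t @[t --> FF] --> z' ->
  remainder (z_ t) (z'_ t) @[t --> FF] --> remainder z z'.
Proof.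
move=> cf Kz_ Kz'_ Kz Kz' zz zz'.
have cK := compact_setX cKA cKX.
have c1 : (z'_ t).1 - (z_ t).1 @[t --> FF] --> z'.1 - z.1.
  by apply: cvgB; [exact: cvg_comp zz' cvg_fst|exact: cvg_comp zz cvg_fst].
have c2 : (z'_ t).2 - (z_ t).2 @[t --> FF] --> z'.2 - z.2.
  by apply: cvgB; [exact: cvg_comp zz' cvg_snd|exact: cvg_comp zz cvg_snd].
rewrite /remainder; apply: cvgB; [apply: cvgB; [apply: cvgB; [apply: cvgB|]|]|].
- exact: (compact_cvg cf).
- exact: (compact_cvg cf).
- by apply: bop_cvg c1; exact: (compact_cvg (cDaf cK)).
- by apply: bop_cvg c2; exact: (compact_cvg (cDxf cK)).
apply: cvgZr; apply: bop_cvg; first exact: (compact_cvg (cD2f cK)).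
exact: tp_cvg.
Qed.

End taylor_remainder.

Lemma near_all_seq (T : eqType) (S : Type) (FF : set_system S) {PF : Filter FF}
    (L : seq T) (P : S -> T -> Prop) :
  (forall x, x \in L -> \forall n \near FF, P n x) ->
  \forall n \near FF, forall x, x \in L -> P n x.
Proof.
elim: L => [|y L IH] LP; first exact: nearW.
have Py := LP y (mem_head _ _).
have PL : \forall n \near FF, forall x, x \in L -> P n x.
  by apply: IH => x xL; apply: LP; rewrite inE xL orbT.
apply: filterS2 Py PL => n Pny PnL x; rewrite inE => /predU1P[->//|]; exact: PnL.
Qed.

Lemma sum_reindex (R : realType) (W : zmodType) (p : time_partition R) (L : seq R)
    (t : R) K (c : nat -> W) : uniq L -> (forall x, x \in L -> 0 < x <= t) ->
  {in L &, injective (part_idx p)} -> t <= p K ->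
  \sum_(x <- L) c (part_idx p x) =
  \sum_(0 <= i < K | i \in [seq part_idx p x | x <- L]) c i.
Proof.
move=> uL Lt iL tK; rewrite -(big_map (part_idx p) xpredT c) -[RHS]big_filter.
apply: perm_big; apply: uniq_perm.
- by rewrite map_inj_in_uniq.
- by rewrite filter_uniq// iota_uniq.
move=> i; rewrite mem_filter mem_index_iota /=; apply/esym/andb_idr.
move=> /mapP[x xL ->]; have /andP[x0 xt] := Lt x xL.
have /andP[px _] := part_idxP p x0; rewrite ltnNge; apply/negP => /(part_pt_le p) Kx.
by have := le_lt_trans (le_trans tK Kx) px; rewrite ltNge xt.
Qed.

(** * Jumps and oscillations along the partitions *)

Section jumps_along_partitions.
Variables (R : realType) (V : normedModType R) (Z : R -> V).
Variables (pi : nat -> time_partition R).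
Hypothesis cZ : cadlag Z.

(** While [Z] stays within [e / 2] of [Z u] on [u, v[, no jump strictly between [u] and [v] exceeds
    [e]; each step adds only the time [v]. *)
Lemma big_jumps_finite e t : 0 < e -> 0 <= t ->
  exists J : seq R, forall w, 0 < w <= t -> e < `|jump Z w| -> w \in J.
Proof.
move=> e0; have e2 : 0 < e / 2 by rewrite divr_gt0.
move: t; apply: (cadlag_ind cZ e2) => [|u v u0 uv Zuv [J JP]].
  by exists [::] => w /andP[w0 /(lt_le_trans w0)]; rewrite ltxx.
exists (v :: J) => w /andP[w0 wv] ew; rewrite inE.
have [//|wv'] := eqVneq w v; apply: JP => //; rewrite w0/= leNgt; apply/negP => uw.
have {wv'}wv : w < v by rewrite lt_neqAle wv' wv.
have wu : 0 < w - u by rewrite subr_gt0.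
have Zw : `|left_lim Z w - Z u| <= e / 2.
  apply: (left_lim_near wu cZ w0) => x; rewrite subKr => /andP[ux xw].
  by apply: Zuv; rewrite (ltW ux) (lt_trans xw).
have Zw' : `|Z w - Z u| <= e / 2 by apply: Zuv; rewrite (ltW uw).
move: ew; rewrite /jump w0; apply/negP; rewrite -leNgt.
rewrite (le_trans (ler_distD (Z u) _ _))// [leRHS]splitr lerD//.
by rewrite distrC.
Qed.

Hypothesis aZ : approx_left pi Z.

(** Along an ultrafilter, the increments over a bad sequence of intervals tend to 0 or to the jump
    at a time in these intervals, which is at most [e]. The factor 2 leaves room for the passage to
    the limit. *)
Lemma small_oscillation e t : 0 < e -> 0 <= t -> \forall n \near \oo, forall i,
  (forall w, pi n i < w <= pi n i.+1 -> w <= t -> `|jump Z w| <= e) ->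
  `|Z (Num.min (pi n i.+1) t) - Z (Num.min (pi n i) t)| <= 2 * e.
Proof.
move=> e0 t0; apply: near_not_ultra => U UU ooU i nP.
have it : \forall n \near U, pi n (i n) < t.
  apply: filterS nP => n nPn; rewrite ltNge; apply/negP => ti; apply: nPn => _.
  rewrite !min_r ?subrr ?normr0 ?mulr_ge0// ?(ltW e0)//.
  by rewrite (le_trans ti)// ltW// part_pt_lt.
pose r_ n := pi n (i n); pose s_ n := Num.min (pi n (i n).+1) t.
suff [l le lZ] : exists2 l, `|l| <= e & Z (s_ n) - Z (r_ n) @[n --> U] --> l.
  have Zle : \forall n \near U, `|Z (s_ n) - Z (r_ n)| <= 2 * e.
    have /cvgrPdist_le/(_ _ e0) := lZ; apply: filterS => n ln.
    rewrite -[X in `|X|](subKr l) (le_trans (ler_normB _ _))// mulr_natl mulr2n.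
    by rewrite lerD.
  have [n [[nPn Zn] rt]] := filter_ex (filterI (filterI nP Zle) it).
  by apply: nPn => _; rewrite [Num.min (pi n (i n)) t]min_l ?(ltW rt).
have [W1|[w [/andP[w0 wt] wI W2]]] := interval_limits cZ aZ UU ooU it.
  have [l [rl sl]] := W1 _ _ (adapted_self cZ).
  by exists 0; rewrite ?normr0 ?(ltW e0)// -(subrr l); exact: cvgB.
have [rl sl] := W2 _ _ (adapted_self cZ).
exists (jump Z w); last by rewrite /jump w0; exact: cvgB.
have [n [nPn /andP[rw ws]]] := filter_ex (filterI nP wI).
have /not_implyP[+ _] := nPn; apply => //.
by rewrite rw (le_trans ws)// ge_min lexx.
Qed.

Hypotheses (C1 : condition_C1 pi Z) (C2 : condition_C2 pi Z).

Lemma near_injective (L : seq R) (t : R) : (forall x, x \in L -> 0 < x <= t) ->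
  (forall x, x \in L -> jump Z x != 0) -> 0 <= t ->
  \forall n \near \oo, {in L &, injective (part_idx (pi n))}.
Proof.
move=> Lt Lj t0.
suff : \forall n \near \oo, forall x, x \in L -> forall y, y \in L ->
    part_idx (pi n) x = part_idx (pi n) y -> x = y.
  by apply: filterS => n H x y xL yL; exact: H.
apply: near_all_seq => x xL; apply: near_all_seq => y yL.
have jx : 0 < `|jump Z x| by rewrite normr_gt0 Lj.
have jy : 0 < `|jump Z y| by rewrite normr_gt0 Lj.
(* Half of the smaller jump, so that both jumps strictly exceed the threshold. *)
pose e := Num.min `|jump Z x| `|jump Z y| / 2.
have m0 : 0 < Num.min `|jump Z x| `|jump Z y| by rewrite lt_min jx.
have [mx my] : Num.min `|jump Z x| `|jump Z y| <= `|jump Z x| /\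
    Num.min `|jump Z x| `|jump Z y| <= `|jump Z y| by rewrite !ge_min !lexx orbT.
have e0 : 0 < e by rewrite divr_gt0.
apply: filterS (C1 t0 e0) => n Cn xy.
have /andP[x0 xt] := Lt _ xL; have /andP[y0 yt] := Lt _ yL.
apply: (Cn (part_idx (pi n) x)) => //; rewrite /big_jumps /=.
- by rewrite /e; lra.
- by rewrite /e; lra.
- exact: part_idxP.
- by rewrite xy; exact: part_idxP.
Qed.

(** [condition_C2] concerns the increment; adding the limit at the lower point gives the one at the
    upper point. *)
Lemma upper_limit u v : 0 < u -> u <= v -> jump Z u != 0 ->
  Z (Num.min (upper_pt (pi n) u) v) @[n --> \oo] --> Z u.
Proof.
move=> u0 uv ju.
have : incr Z v (lower_pt (pi n) u) (upper_pt (pi n) u) + Z (lower_pt (pi n) u)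
    @[n --> \oo] --> jump Z u + left_lim Z u.
  by apply: cvgD; [exact: C2|exact: aZ].
rewrite /jump u0 subrK; apply: cvg_trans; apply: near_eq_cvg; apply: nearW => n.
rewrite /incr (_ : Num.min (lower_pt (pi n) u) v = lower_pt (pi n) u) ?subrK//.
apply: min_l; have /andP[/ltW ru _] := part_idxP (pi n) u0; exact: le_trans ru uv.
Qed.

End jumps_along_partitions.

(** * From sums of remainders to a sum over jumps *)

Section sums_of_remainders.
Variables (R : realType) (E F G : completeNormedModType R).
Variables (A : R -> F) (X : R -> E) (pi : nat -> time_partition R).
Variable Phi : F * E -> F * E -> G.
Let Z t := (A t, X t).
Hypotheses (cA : cadlag A) (cX : cadlag X).
Hypotheses (C1 : condition_C1 pi Z) (C2 : condition_C2 pi Z) (aZ : approx_left pi Z).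
Hypothesis Phi_diag : forall z, Phi z z = 0.
Let size2 (z z' : F * E) : R := `|z'.1 - z.1| + `|z'.2 - z.2| ^+ 2.
Hypothesis Phi_bounded : forall t, 0 <= t -> exists2 L, 0 <= L & forall z z',
  box A X t z -> box A X t z' -> `|Phi z z'| <= L * size2 z z'.
Hypothesis Phi_small : forall t k, 0 <= t -> 0 < k -> exists2 d, 0 < d & forall z z',
  box A X t z -> box A X t z' -> `|z' - z| <= d -> `|Phi z z'| <= k * size2 z z'.
Hypothesis Phi_cvg : forall t (z_ z'_ : nat -> F * E) z z', 0 <= t ->
  (forall n, box A X t (z_ n)) -> (forall n, box A X t (z'_ n)) ->
  box A X t z -> box A X t z' -> z_ n @[n --> \oo] --> z -> z'_ n @[n --> \oo] --> z' ->
  Phi (z_ n) (z'_ n) @[n --> \oo] --> Phi z z'.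
Let lo n i t := Num.min (pi n i) t.
Hypothesis size2_bounded : forall t, 0 <= t -> exists2 M, 0 <= M & forall n K,
  t <= pi n K -> \sum_(0 <= i < K) size2 (Z (lo n i t)) (Z (lo n i.+1 t)) <= M.

Definition jump_remainder s := Phi (left_lim A s, left_lim X s) (Z s).

Let cZ : cadlag Z. Proof. exact: cadlag_pair. Qed.

Let lo_in n i t : 0 <= t -> 0 <= lo n i t <= t.
Proof. by move=> t0; rewrite le_min part_pt_ge0 t0 ge_min lexx orbT. Qed.

Let term n t i := Phi (Z (lo n i t)) (Z (lo n i.+1 t)).

Let jump0_remainder s : 0 < s -> jump Z s = 0 -> jump_remainder s = 0.
Proof.
move=> s0 jZ; rewrite /jump_remainder -left_lim_pair//.
by rewrite (jump0_left_lim s0 jZ) Phi_diag.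
Qed.

Let term_cvg t u : 0 < u <= t -> jump Z u != 0 ->
  term n t (part_idx (pi n) u) @[n --> \oo] --> jump_remainder u.
Proof.
move=> /andP[u0 ut] ju; have t0 : 0 <= t by rewrite (le_trans (ltW u0)).
rewrite /term; apply: (Phi_cvg t0).
- by move=> n; apply: path_in_box; exact: lo_in.
- by move=> n; apply: path_in_box; exact: lo_in.
- by apply: left_lim_in_box => //; rewrite u0.
- by apply: path_in_box; rewrite ltW.
- rewrite -left_lim_pair//; apply: cvg_trans (aZ u0); apply: near_eq_cvg; apply: nearW => n.
  rewrite /lo /lower_pt min_l//.
  by have /andP[/ltW ru _] := part_idxP (pi n) u0; exact: le_trans ru ut.
- exact: upper_limit.
Qed.

Let sum_terms_bounded t : 0 <= t -> exists2 M, 0 <= M & forall n K,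
  t <= pi n K -> \sum_(0 <= i < K) `|term n t i| <= M.
Proof.
move=> t0; have [L L0 PL] := Phi_bounded t0; have [M M0 sM] := size2_bounded t0.
exists (L * M) => [|n K tK]; first by rewrite mulr_ge0.
apply: (@le_trans _ _ (\sum_(0 <= i < K) L * size2 (Z (lo n i t)) (Z (lo n i.+1 t)))).
  by apply: ler_sum => i _; apply: PL; apply: path_in_box; exact: lo_in.
by rewrite -mulr_sumr ler_wpM2l// sM.
Qed.

(** For large [n] finitely many jump times lie in different intervals, so the sum of their norms is
    a limit of parts of the bounded sums over the partitions. Times without a jump of [Z] contribute
    0. *)
Lemma summable_jump_remainder : summable_jumps jump_remainder.
Proof.
move=> t t0; have [M M0 sM] := sum_terms_bounded t0.
exists M => F0 /andP[uF /allP Ft].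
pose L := [seq x <- F0 | jump Z x != 0].
have -> : \sum_(s <- F0) `|jump_remainder s| = \sum_(s <- L) `|jump_remainder s|.
  rewrite big_filter [LHS]big_seq [RHS]big_seq_cond (bigID (fun x => jump Z x != 0))/=.
  rewrite [X in _ + X]big1 ?addr0// => x /andP[/Ft /andP[x0 _]].
  by rewrite negbK => /eqP jx; rewrite jump0_remainder// normr0.
have Lt x : x \in L -> 0 < x <= t by rewrite mem_filter => /andP[_ /Ft].
have Lj x : x \in L -> jump Z x != 0 by rewrite mem_filter => /andP[].
have uL : uniq L by rewrite filter_uniq.
have sc : \sum_(s <- L) `|term n t (part_idx (pi n) s)| @[n --> \oo] -->
    \sum_(s <- L) `|jump_remainder s|.
  elim: L Lt Lj {uL} => [|x L IH] Lt Lj.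
    by under eq_fun do rewrite big_nil; rewrite big_nil; exact: cvg_cst.
  under eq_fun do rewrite big_cons; rewrite big_cons; apply: cvgD.
    apply: cvg_norm; apply: term_cvg; first by apply: Lt; rewrite mem_head.
    by apply: Lj; rewrite mem_head.
  by apply: IH => y yL; [apply: Lt|apply: Lj]; rewrite inE yL orbT.
apply: (ler_cvg_to sc (cvg_cst M)); have := near_injective C1 Lt Lj t0.
apply: filterS => n inj; have [K tK] := part_pt_unbounded (pi n) t.
rewrite (sum_reindex (fun i => `|term n t i|) uL Lt inj tK).
apply: le_trans (sM n K tK); rewrite [leRHS](bigID (fun i => i \in [seq part_idx (pi n) x | x <- L]))/=.
by rewrite lerDl sumr_ge0.
Qed.

(** [L] contains all jumps above [d / 2] and enough others to bring the jump sum close to [Gam t].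
    The intervals that meet [L] converge term by term; on the others [Z] moves by at most [d], so
    [Phi_small] applies. *)
Lemma sum_remainders_cvg (Gam : R -> G) t k : 0 <= t -> 0 < k ->
  (fun J : {fset R} => \sum_(s <- J | 0 < s <= t) jump_remainder s) @ @finsets R --> Gam t ->
  \forall n \near \oo, forall K, t <= pi n K ->
    `|\sum_(0 <= i < K) term n t i - Gam t| <= k.
Proof.
move=> t0 k0 Gt; have [M M0 sM] := size2_bounded t0.
(* The errors are [c * M] from the intervals that miss [L], [c] from those that meet it, and [c]
   from the distance to [Gam t]. *)
pose c := k / (M + 2); have M2 : 0 < M + 2 by rewrite ltr_wpDl.
have c0 : 0 < c by rewrite divr_gt0.
have [d d0 Pd] := Phi_small t0 c0.
have d2 : 0 < d / 2 by rewrite divr_gt0.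
have [J JP] := big_jumps_finite cZ d2 t0.
have /cvgrPdist_le/(_ _ c0)[J0 _ J0P] := Gt.
pose L := [seq x <- (J0 `|` [fset x in J])%fset | (0 < x <= t) && (jump Z x != 0)].
have Lt x : x \in L -> 0 < x <= t by rewrite mem_filter => /andP[/andP[]].
have Lj x : x \in L -> jump Z x != 0 by rewrite mem_filter => /andP[/andP[]].
have uL : uniq L by rewrite filter_uniq// fset_uniq.
have LG : `|Gam t - \sum_(s <- L) jump_remainder s| <= c.
  have := J0P (J0 `|` [fset x in J])%fset (fsubsetUl _ _).
  have -> : \sum_(s <- (J0 `|` [fset x in J])%fset | 0 < s <= t) jump_remainder s =
      \sum_(s <- L) jump_remainder s.
    rewrite big_filter (bigID (fun x => jump Z x != 0))/= [X in _ + X]big1 ?addr0//.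
    move=> x /andP[/andP[x0 _]]; rewrite negbK => /eqP; exact: jump0_remainder.
  by [].
have sc : \sum_(s <- L) term n t (part_idx (pi n) s) @[n --> \oo] -->
    \sum_(s <- L) jump_remainder s.
  elim: L Lt Lj {uL LG} => [|x L IH] Lt Lj.
    by under eq_fun do rewrite big_nil; rewrite big_nil; exact: cvg_cst.
  under eq_fun do rewrite big_cons; rewrite big_cons; apply: cvgD.
    apply: term_cvg; first by apply: Lt; rewrite mem_head.
    by apply: Lj; rewrite mem_head.
  by apply: IH => y yL; [apply: Lt|apply: Lj]; rewrite inE yL orbT.
have /cvgrPdist_le/(_ _ c0) nearL := sc.
have osc := small_oscillation cZ aZ d2 t0.
have inj := near_injective C1 Lt Lj t0.
near=> n => K tK.
have injn : {in L &, injective (part_idx (pi n))} by near: n.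
rewrite (bigID (fun i => i \in [seq part_idx (pi n) x | x <- L]))/=.
rewrite -(sum_reindex (term n t) uL Lt injn tK).
set S1 := \sum_(x <- L) _; set S2 := (X in S1 + X - _).
have S2c : `|S2| <= c * M.
  rewrite (le_trans (ler_norm_sum _ _ _))//.
  apply: (@le_trans _ _ (\sum_(0 <= i < K | i \notin [seq part_idx (pi n) x | x <- L])
      c * size2 (Z (lo n i t)) (Z (lo n i.+1 t)))).
    apply: ler_sum => i iL; apply: Pd; [apply: path_in_box; exact: lo_in..|].
    have oscn : forall i, (forall w, pi n i < w <= pi n i.+1 -> w <= t -> `|jump Z w| <= d / 2) ->
      `|Z (Num.min (pi n i.+1) t) - Z (Num.min (pi n i) t)| <= 2 * (d / 2) by near: n.
    have dE : 2 * (d / 2) = d by field.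
    rewrite -[leRHS]dE; apply: oscn => w iw wt; rewrite leNgt; apply/negP => dw.
    have w0 : 0 < w by case/andP : iw => iw _; apply: le_lt_trans iw; exact: part_pt_ge0.
    move/negP : iL; apply; apply/mapP; exists w; last by rewrite (part_idx_unique iw).
    rewrite mem_filter w0 wt/= -normr_gt0 (lt_trans d2 dw)/= !inE.
    by rewrite JP ?w0 ?orbT.
  rewrite -mulr_sumr ler_wpM2l// ?(ltW c0)//.
  apply: le_trans (sM n K tK).
  rewrite [leRHS](bigID (fun i => i \in [seq part_idx (pi n) x | x <- L]))/=.
  by rewrite lerDr sumr_ge0// => i _; rewrite addr_ge0// exprn_ge0.
have S1c : `|\sum_(s <- L) jump_remainder s - S1| <= c by rewrite /S1; near: n; exact: nearL.
rewrite (_ : S1 + S2 - Gam t = S2 - (\sum_(s <- L) jump_remainder s - S1) -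
    (Gam t - \sum_(s <- L) jump_remainder s)); last first.
  by move: (\sum_(s <- L) jump_remainder s) => u; vring.
have kE : k = c * M + c + c.
  by rewrite -addrA -mulr2n -[X in _ + X]mulr_natr -mulrDr divfK// gt_eqF.
rewrite kE; apply: (le_trans (ler_normB _ _)); apply: lerD; last exact: LG.
by apply: (le_trans (ler_normB _ _)); apply: lerD; [exact: S2c|exact: S1c].
Unshelve. all: by end_near. Qed.

End sums_of_remainders.

Section stopped_sums.
Variables (R : realType) (V : normedModType R) (p : time_partition R) (B : R -> V).

Lemma sum_telescope t K : 0 <= t -> t <= p K ->
  \sum_(0 <= i < K) (B (Num.min (p i.+1) t) - B (Num.min (p i) t)) = B t - B 0.
Proof.
move=> t0 tK; rewrite (telescope_sumr (fun i => B (Num.min (p i) t)))//.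
by rewrite min_r// part_pt0 min_l.
Qed.

Lemma sum_control w t K : control w B t -> 0 <= t -> t <= p K ->
  \sum_(0 <= i < K) `|B (Num.min (p i.+1) t) - B (Num.min (p i) t)| <= w t - w 0.
Proof.
move=> cw t0 tK.
apply: (@le_trans _ _ (\sum_(0 <= i < K) (w (Num.min (p i.+1) t) - w (Num.min (p i) t)))).
  apply: ler_sum => i _; apply: cw; first by rewrite le_min part_pt_ge0 t0.
    by rewrite le_min !ge_min lexx orbT (ltW (part_pt_lt p i)).
  by rewrite ge_min lexx orbT.
rewrite (telescope_sumr (fun i => w (Num.min (p i) t)))//.
by rewrite min_r// part_pt0 min_l.
Qed.

Lemma part_sum_increments (W : normedModType R) (Phi : R -> V -> W) t K : t <= p K ->
  (forall r, Phi r 0 = 0) ->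
  part_sum p (fun r s => Phi r (incr B t r s)) =
  \sum_(0 <= i < K) Phi (p i) (B (Num.min (p i.+1) t) - B (Num.min (p i) t)).
Proof.
move=> tK Phi0.
apply: (@part_sum_stopped _ p V W Phi (fun x y => B y - B x)) => // x.
by rewrite subrr.
Qed.

End stopped_sums.

(** * Riemann sums against A and against the quadratic variation of X *)

Section riemann_instances.
Variables (R : realType) (E F : completeNormedModType R).
Variables (alpha : crossnorm_family R) (alphaU : uniform_crossnorm alpha).
Variables (EE : completion (@alpha E E)) (m : mode) (pi : nat -> time_partition R).
Variables (X : R -> E) (QX : R -> EE) (A : R -> F).
Let Z t := (A t, X t).
Hypotheses (cX : cadlag X) (QXP : tensor_qv m pi X QX) (fX : finite_2variation pi X).
Hypotheses (cA : cadlag A) (fA : finite_variation A).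
Hypotheses (C2 : condition_C2 pi Z) (aZ : approx_left pi Z).

Let cZ : cadlag Z. Proof. exact: cadlag_pair. Qed.

Lemma sum_squares_bounded t : 0 <= t -> exists2 M, 0 <= M & forall n K, t <= pi n K ->
  \sum_(0 <= i < K) `|X (Num.min (pi n i.+1) t) - X (Num.min (pi n i) t)| ^+ 2 <= M.
Proof.
move=> t0; have := fX t0; set S := ereal_sup _ => Sfin.
have SE n K : t <= pi n K ->
    part_sum (pi n) (fun r s => `|incr X t r s| ^+ 2 : R^o) =
    \sum_(0 <= i < K) `|X (Num.min (pi n i.+1) t) - X (Num.min (pi n i) t)| ^+ 2.
  move=> tK; apply: (@part_sum_increments _ _ _ X R^o (fun _ v => `|v| ^+ 2)) => // r.
  by rewrite normr0 expr0n.
have SM n K : t <= pi n K -> ((\sum_(0 <= i < K)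
    `|X (Num.min (pi n i.+1) t) - X (Num.min (pi n i) t)| ^+ 2)%:E <= S)%E.
  by move=> tK; apply: ereal_sup_ubound; exists n => //; rewrite (SE n K).
have S0 : (0 <= S)%E.
  have [K tK] := part_pt_unbounded (pi 0) t.
  by apply: le_trans (SM 0 K tK); rewrite lee_fin sumr_ge0// => i _; rewrite exprn_ge0.
have Sf : S \is a fin_num by rewrite ge0_fin_numE.
exists (fine S) => [|n K tK]; first exact: fine_ge0.
by rewrite -lee_fin fineK// SM.
Qed.

Let lower_cvg u : 0 < u ->
  A (lower_pt (pi n) u) @[n --> \oo] --> left_lim A u /\
  X (lower_pt (pi n) u) @[n --> \oo] --> left_lim X u.
Proof.
move=> u0; have := aZ u0; rewrite left_lim_pair// => Zl.
by split; [exact: (cvg_comp _ _ Zl cvg_fst)|exact: (cvg_comp _ _ Zl cvg_snd)].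
Qed.

Let upper_cvg u v : 0 < u -> u <= v -> jump Z u != 0 ->
  A (Num.min (upper_pt (pi n) u) v) @[n --> \oo] --> A u /\
  X (Num.min (upper_pt (pi n) u) v) @[n --> \oo] --> X u.
Proof.
move=> u0 uv ju; have Zu := upper_limit aZ C2 u0 uv ju.
by split; [exact: (cvg_comp _ _ Zu cvg_fst)|exact: (cvg_comp _ _ Zu cvg_snd)].
Qed.

Let jump0_eq u : 0 < u -> jump Z u = 0 -> left_lim A u = A u /\ left_lim X u = X u.
Proof.
move=> u0 /(jump0_left_lim u0); rewrite left_lim_pair// => ZE.
by split; [exact: (congr1 fst ZE)|exact: (congr1 snd ZE)].
Qed.

Variable W : completeNormedModType R.

Lemma riemann_sums_path (h : F * E -> 'L(F, W)) (I : R -> W) :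
  compactly_continuous h -> sewing A (tv A) (h \o Z) I -> I 0 = 0 ->
  forall t, 0 <= t -> cvg_mode m (fun n =>
    part_sum (pi n) (fun r s => h (Z r) (incr A t r s))) (I t).
Proof.
move=> ch sI I0 t t0.
apply: (@riemann_sums_cvg _ _ _ _ Z pi m (h \o Z) A (tv A) I (fun x y => A y - A x)) => //.
- exact: compose_cadlag.
- by move=> u u0; exact: compose_approx_left.
- by move=> u u0; exact: compose_jump0.
- by move=> x; rewrite subrr.
- move=> u v u0 uv; apply: cvg_mode_norm; apply: cvg_near_cst; apply: nearW => n.
  have [K vK] := part_pt_unbounded (pi n) v.
  have H x : 0 <= x -> x <= pi n K ->
      part_sum (pi n) (fun r s => A (Num.min s x) - A (Num.min r x)) = A x - A 0.
    move=> x0 xK.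
    by rewrite (@part_sum_increments _ _ (pi n) A F (fun _ v => v) x K xK)// sum_telescope.
  by rewrite !H ?(le_trans uv)// ?(le_trans u0)// opprB addrA subrK.
- move=> s s0; exists (tv A s - tv A 0) => n; have [K sK] := part_pt_unbounded (pi n) s.
  rewrite (@part_sum_increments _ _ (pi n) A R^o (fun _ v => `|v|) s K sK); last by move=> _; exact: normr0.
  by apply: sum_control => //; exact: tv_control.
- move=> u v u0 uv ju; rewrite -(subrr (A u - left_lim A u)).
  have [Al _] := lower_cvg u0; have [Au _] := upper_cvg u0 (ltW uv) ju.
  by apply: cvgB; apply: cvgB => //; exact: cvg_cst.
- move=> u u0 ju; have [Al _] := lower_cvg u0; have [AE _] := jump0_eq u0 ju.
  by rewrite -(subrr (A u)) -{3}AE; apply: cvgB => //; exact: cvg_cst.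
- move=> s s0; have [M M0 AM] := cadlag_bounded cA s0.
  by exists (M + M) => x y xs ys; rewrite (le_trans (ler_normB _ _))// lerD// AM.
Qed.

(** Tensor squares are not additive when an interval is cut. At a jump of [Z], however, the square
    over the interval cut at [u] and the one over the interval stopped at [v] both tend to the
    square of the jump of [X]. Finite 2-variation bounds the sums of norms. *)
Lemma riemann_sums_qv (h : F * E -> 'L(EE, W)) (I : R -> W) :
  compactly_continuous h -> sewing QX (tv QX) (h \o Z) I -> I 0 = 0 ->
  forall t, 0 <= t -> cvg_mode m (fun n =>
    part_sum (pi n) (fun r s => h (Z r) (tp EE (incr X t r s) (incr X t r s)))) (I t).
Proof.
move=> ch sI I0 t t0; have [cQ fQ QXlim _] := QXP.
apply: (@riemann_sums_cvg _ _ _ _ Z pi m (h \o Z) QX (tv QX) I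
  (fun x y => tp EE (X y - X x) (X y - X x))) => //.
- exact: compose_cadlag.
- by move=> u u0; exact: compose_approx_left.
- by move=> u u0; exact: compose_jump0.
- by move=> x; rewrite subrr tp0l.
- by move=> u v u0 uv; apply: cvg_modeB; apply: QXlim => //; exact: le_trans uv.
- move=> s s0; have [M M0 XM] := sum_squares_bounded s0.
  exists M => n; have [K sK] := part_pt_unbounded (pi n) s.
  rewrite (@part_sum_increments _ _ (pi n) X R^o (fun _ v => `|tp EE v v|) s K sK); last first.
    by move=> _; rewrite tp0l normr0.
  apply: le_trans (XM n K sK); apply: ler_sum => i _.
  by rewrite expr2; exact: tp_le.
- move=> u v u0 uv ju.
  rewrite -(subrr (tp EE (X u - left_lim X u) (X u - left_lim X u))).
  have [_ Xl] := lower_cvg u0; have [_ Xu] := upper_cvg u0 (ltW uv) ju.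
  by apply: cvgB; apply: tp_cvg => //; apply: cvgB => //; exact: cvg_cst.
- move=> u u0 ju; have [_ Xl] := lower_cvg u0; have [_ XE] := jump0_eq u0 ju.
  have -> : (0 : EE) = tp EE (X u - left_lim X u) (X u - left_lim X u).
    by rewrite XE subrr tp0l.
  by apply: tp_cvg => //; apply: cvgB => //; exact: cvg_cst.
- move=> s s0; have [M M0 XM] := cadlag_bounded cX s0.
  exists ((M + M) * (M + M)) => x y xs ys; rewrite (le_trans (tp_le alphaU _ _ _))//.
  by apply: ler_pM => //; rewrite (le_trans (ler_normB _ _))// lerD// XM.
Qed.

End riemann_instances.

(** * The Ito formula and the quadratic variation of the integral *)

Section ito_formula.
Variables (R : realType) (E F G : completeNormedModType R).
Variables (alpha : crossnorm_family R) (alphaU : uniform_crossnorm alpha).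
Variables (EE : completion (@alpha E E)) (GG : completion (@alpha G G)).
Variables (m : mode) (pi : nat -> time_partition R).
Variables (X : R -> E) (QX : R -> EE) (A : R -> F).
Variables (f : F * E -> G) (Daf : F * E -> 'L(F, G)) (Dxf : F * E -> 'L(E, G)).
Variables (Dxxf : F * E -> 'L(E, 'L(E, G))) (D2f : F * E -> 'L(EE, G)).
Let Z t := (A t, X t).
Hypotheses (cX : cadlag X) (QXP : tensor_qv m pi X QX) (fX : finite_2variation pi X).
Hypotheses (cA : cadlag A) (fA : finite_variation A).
Hypotheses (CZ : condition_C pi Z) (aZ : approx_left pi Z).
Hypothesis dfa : forall a x, gateaux (fun b => f (b, x)) a (Daf (a, x)).
Hypothesis dfx : forall a x, gateaux (fun y => f (a, y)) x (Dxf (a, x)).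
Hypothesis dfxx : forall a x, gateaux (fun y => Dxf (a, y)) x (Dxxf (a, x)).
Hypotheses (cDaf : compactly_continuous Daf) (cDxf : compactly_continuous Dxf).
Hypothesis cD2f : compactly_continuous D2f.
Hypothesis D2fE : forall p y z, D2f p (cpl_inj EE (y \ox z)) = Dxxf p y z.

Let cZ : cadlag Z. Proof. exact: cadlag_pair. Qed.
Let C1 : condition_C1 pi Z. Proof. by case: CZ. Qed.
Let C2 : condition_C2 pi Z. Proof. by case: CZ. Qed.
Let rem := remainder f Daf Dxf D2f.
Let hD2 (z : F * E) : 'L(EE, G) := 2^-1 *: D2f z.

(** A compact set lies in the product of its two projections, which are compact. *)
Lemma f_continuous : compactly_continuous f.
Proof.
move=> K cK; pose K2 := [set z.1 | z in K] `*` [set z.2 | z in K].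
have cfst : compact [set z.1 | z in K].
  by apply: (@continuous_compact _ _ fst) => //; apply: continuous_subspaceT => z; exact: cvg_fst.
have csnd : compact [set z.2 | z in K].
  by apply: (@continuous_compact _ _ snd) => //; apply: continuous_subspaceT => z; exact: cvg_snd.
have KK2 : K `<=` K2 by move=> z Kz; split; exists z.
apply: (continuous_subspaceW KK2).
exact: (continuous_box alphaU dfa dfx dfxx cDaf cD2f D2fE cfst csnd).
Qed.

Let chD2 : compactly_continuous hD2.
Proof.
move=> K /cD2f /subspace_continuousP cK; apply/subspace_continuousP => z Kz.
by apply: cvgZr; exact: cK.
Qed.

Let lo n i t := Num.min (pi n i) t.
Let dA n i t := A (lo n i.+1 t) - A (lo n i t).
Let dX n i t := X (lo n i.+1 t) - X (lo n i t).

Let dX0 n i t : t <= pi n i -> dX n i t = 0.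
Proof.
by move=> ti; rewrite /dX /lo !min_r ?subrr// (le_trans ti)// ltW// part_pt_lt.
Qed.

Let dA0 n i t : t <= pi n i -> dA n i t = 0.
Proof.
by move=> ti; rewrite /dA /lo !min_r ?subrr// (le_trans ti)// ltW// part_pt_lt.
Qed.

Let lo_in n i t : 0 <= t -> 0 <= lo n i t <= t.
Proof. by move=> t0; rewrite le_min part_pt_ge0 t0 ge_min lexx orbT. Qed.

(** After [t] the increment vanishes, so it does not matter whether the point of evaluation is
    stopped. *)
Let Dx_lo n i t : Dxf (Z (pi n i)) (dX n i t) = Dxf (Z (lo n i t)) (dX n i t).
Proof.
have [ti|it] := leP t (pi n i); first by rewrite dX0// !bop0.
by rewrite [lo n i t]min_l ?(ltW it).
Qed.

Let size2_bounded t : 0 <= t -> exists2 M, 0 <= M & forall n K, t <= pi n K ->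
  \sum_(0 <= i < K) (`|dA n i t| + `|dX n i t| ^+ 2) <= M.
Proof.
move=> t0; have [M M0 XM] := sum_squares_bounded fX t0.
exists (tv A t - tv A 0 + M) => [|n K tK].
  by rewrite addr_ge0// subr_ge0 tv_mono.
rewrite big_split/= lerD//; last exact: XM.
by apply: sum_control => //; exact: tv_control.
Qed.

Let rem_bounded t : 0 <= t -> exists2 L, 0 <= L & forall z z',
  box A X t z -> box A X t z' -> `|rem z z'| <= L * (`|z'.1 - z.1| + `|z'.2 - z.2| ^+ 2).
Proof.
move=> t0; have [L L0 LP] := remainder_bounded alphaU dfa dfx dfxx cDaf cD2f D2fE
  (cadlag_compact cA t0) (cadlag_compact cX t0).
by exists L => // z z' [z1 z2] [z1' z2']; exact: LP.
Qed.

Let rem_small t k : 0 <= t -> 0 < k -> exists2 d, 0 < d & forall z z',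
  box A X t z -> box A X t z' -> `|z' - z| <= d ->
  `|rem z z'| <= k * (`|z'.1 - z.1| + `|z'.2 - z.2| ^+ 2).
Proof.
move=> t0 k0; have [d d0 dP] := remainder_small alphaU dfa dfx dfxx cDaf cD2f D2fE
  (cadlag_compact cA t0) (cadlag_compact cX t0) k0.
by exists d => // z z' [z1 z2] [z1' z2']; exact: dP.
Qed.

Let rem_cvg t (z_ z'_ : nat -> F * E) z z' : 0 <= t ->
  (forall n, box A X t (z_ n)) -> (forall n, box A X t (z'_ n)) ->
  box A X t z -> box A X t z' -> z_ n @[n --> \oo] --> z -> z'_ n @[n --> \oo] --> z' ->
  rem (z_ n) (z'_ n) @[n --> \oo] --> rem z z'.
Proof.
move=> t0 Kz_ Kz'_ Kz Kz' zz zz'.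
apply: (remainder_cvg alphaU cDaf cDxf cD2f (cadlag_compact cA t0) (cadlag_compact cX t0)) => //.
- exact: f_continuous (box_compact cA cX t0).
- exact: nearW.
- exact: nearW.
Qed.

Let jrem := jump_remainder A X rem.

Lemma increment_expansion n i t :
  f (Z (lo n i.+1 t)) - f (Z (lo n i t)) - Dxf (Z (pi n i)) (dX n i t) =
  Daf (Z (lo n i t)) (dA n i t) + hD2 (Z (lo n i t)) (tp EE (dX n i t) (dX n i t)) +
  rem (Z (lo n i t)) (Z (lo n i.+1 t)).
Proof.
rewrite Dx_lo /rem /remainder -/(dA n i t) -/(dX n i t).
rewrite -[hD2 _ _]/(2^-1 *: D2f (Z (lo n i t)) (tp EE (dX n i t) (dX n i t))).
by move: (Daf _ _) (Dxf _ _) (D2f _ _) => u1 u2 u3; vring.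
Qed.

(** [B] is the sum of [f (Z 0)], the two Stieltjes integrals and the jump sum [Gam] of the
    remainders; including [f (Z 0)] makes the Ito-Foellmer integral start at 0. *)
Lemma ito_decomposition : exists B : R -> G, [/\ cadlag B, finite_variation B,
  forall s, 0 < s ->
    jump B s = jump (f \o Z) s - Dxf (left_lim A s, left_lim X s) (jump X s) &
  forall t, 0 <= t -> cvg_mode m (fun n =>
    part_sum (pi n) (fun r s => Dxf (Z r) (incr X t r s))) (f (Z t) - B t)].
Proof.
have [cQ fQ _ jQ] := QXP.
have cH1 : cadlag (Daf \o Z) := compose_cadlag cA cX cDaf.
have cH2 : cadlag (hD2 \o Z) := compose_cadlag cA cX chD2.
have cwA t : control (tv A) A t := tv_control fA (t := t).
have cwQ t : control (tv QX) QX t := tv_control fQ (t := t).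
have [I1 [I10 sI1 _]] := stieltjes_exists cwA cH1.
have [I2 [I20 sI2 _]] := stieltjes_exists cwQ cH2.
have rem_diag z : rem z z = 0 by exact: remainder_diag.
have sj : summable_jumps jrem.
  exact: (summable_jump_remainder cA cX C1 C2 aZ rem_diag rem_bounded rem_cvg size2_bounded).
have [Gam [G0 Glim cG jG fG]] := jump_sum_exists sj.
have cI1 := sewing_cadlag cwA cH1 cA sI1.
have cI2 := sewing_cadlag cwQ cH2 cQ sI2.
have fI1 := sewing_finite_variation cwA cH1 sI1.
have fI2 := sewing_finite_variation cwQ cH2 sI2.
exists (fun t => f (Z 0) + I1 t + I2 t + Gam t); split.
- by do 2 apply: cadlagD => //; apply: cadlagD => //; exact: cadlag_cst.
- by do 2 apply: finite_variationD => //; apply: finite_variationD => //; exact: finite_variation_cst.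
(* The jumps of the two integrals are the terms in [Daf] and [D2f] that [remainder] subtracts; they
   cancel and leave the term in [Dxf]. *)
- move=> s s0.
  rewrite jumpD//; last by do 2 apply: cadlagD => //; exact: cadlag_cst.
  rewrite jumpD//; last by apply: cadlagD => //; exact: cadlag_cst.
  rewrite jumpD//; last exact: cadlag_cst.
  rewrite jump_cst add0r (sewing_jump cwA cH1 cA sI1 s0) (sewing_jump cwQ cH2 cQ sI2 s0).
  rewrite (compose_left_lim cA cX cDaf s0) (compose_left_lim cA cX chD2 s0) jG//.
  rewrite jQ ?(ltW s0)// -/(tp EE (jump X s) (jump X s)).
  rewrite /jrem /jump_remainder /rem /remainder /=.
  have -> : jump (f \o Z) s = f (Z s) - f (left_lim A s, left_lim X s).
    by rewrite /jump s0 (compose_left_lim cA cX f_continuous s0).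
  have -> : A s - left_lim A s = jump A s by rewrite /jump s0.
  have -> : X s - left_lim X s = jump X s by rewrite /jump s0.
  pose q := (left_lim A s, left_lim X s); pose xx := tp EE (jump X s) (jump X s).
  rewrite -[LHS]/(Daf q (jump A s) + 2^-1 *: D2f q xx + (f (Z s) - f q - Daf q (jump A s) -
    Dxf q (jump X s) - 2^-1 *: D2f q xx)) -/q.
  by move: (Daf _ _) (Dxf _ _) (D2f _ _) => u1 u2 u3; vring.
move=> t t0.
pose P1 n := part_sum (pi n) (fun r s => Daf (Z r) (incr A t r s)).
pose P2 n := part_sum (pi n) (fun r s => hD2 (Z r) (tp EE (incr X t r s) (incr X t r s))).
pose PX n := part_sum (pi n) (fun r s => Dxf (Z r) (incr X t r s)).
(* By [increment_expansion] this is the sum of the remainders over the n-th partition. *)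
pose Rm n := f (Z t) - f (Z 0) - P1 n - P2 n - PX n.
have c1 : cvg_mode m P1 (I1 t).
  exact: (riemann_sums_path m cX cA fA C2 aZ cDaf sI1 I10 t0).
have c2 : cvg_mode m P2 (I2 t).
  exact: (riemann_sums_qv alphaU cX QXP fX cA C2 aZ chD2 sI2 I20 t0).
have c3 : cvg_mode m Rm (Gam t).
  apply: cvg_mode_norm; apply/cvgrPdist_le => k k0.
  have := sum_remainders_cvg cA cX C1 C2 aZ rem_diag rem_small rem_cvg size2_bounded t0 k0 (Glim t t0).
  apply: filterS => n /(_ _ _) remK; have [K tK] := part_pt_unbounded (pi n) t.
  rewrite distrC; apply: le_trans (remK K tK).
  rewrite (_ : Rm n = \sum_(0 <= i < K) rem (Z (lo n i t)) (Z (lo n i.+1 t)))//.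
  rewrite /Rm /P1 /P2 /PX.
  rewrite (@part_sum_increments _ _ (pi n) A G (fun r v => Daf (Z r) v) t K tK); last by move=> r; exact: bop0.
  rewrite (@part_sum_increments _ _ (pi n) X G (fun r v => hD2 (Z r) (tp EE v v)) t K tK); last first.
    by move=> r; rewrite tp0l; exact: bop0.
  rewrite (@part_sum_increments _ _ (pi n) X G (fun r v => Dxf (Z r) v) t K tK); last by move=> r; exact: bop0.
  rewrite -(@sum_telescope _ _ (pi n) (f \o Z) t K t0 tK) -!sumrB; apply: eq_bigr => i _.
  have := increment_expansion n i t; rewrite -/(lo n i t) -/(lo n i.+1 t) -/(dA n i t) -/(dX n i t).
  have -> : Daf (Z (lo n i t)) (dA n i t) = Daf (Z (pi n i)) (dA n i t).
    have [ti|it] := leP t (pi n i); first by rewrite dA0// !bop0.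
    by rewrite [lo n i t]min_l ?(ltW it).
  have -> : hD2 (Z (lo n i t)) (tp EE (dX n i t) (dX n i t)) =
      hD2 (Z (pi n i)) (tp EE (dX n i t) (dX n i t)).
    have [ti|it] := leP t (pi n i); first by rewrite dX0// tp0l !bop0.
    by rewrite [lo n i t]min_l ?(ltW it).
  rewrite /comp; move: (Daf _ _) (Dxf _ _) (hD2 _ _) => u1 u2 u3 /eqP.
  rewrite [X in X == _]addrAC.
  move: (rem _ _) (f _) (f _) => u4 u5 u6 /eqP uE.
  rewrite -[u4](addrK (u1 + u3)) [u4 + _]addrC -uE; vring.
have -> : f (Z t) - (f (Z 0) + I1 t + I2 t + Gam t) =
    (f (Z t) - f (Z 0)) - I1 t - I2 t - Gam t by vring.
have -> : (fun n => part_sum (pi n) (fun r s => Dxf (Z r) (incr X t r s))) =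
    (fun n => (f (Z t) - f (Z 0)) - P1 n - P2 n - Rm n).
  by apply/funext => n; rewrite /Rm -/(PX n); vring.
by apply: cvg_modeB => //; apply: cvg_modeB => //; apply: cvg_modeB => //;
  apply: cvg_mode_norm; exact: cvg_cst.
Qed.

(** * The quadratic variation of the Ito-Foellmer integral *)

Section quadratic_variation.
Variable B : R -> G.
Hypotheses (cB : cadlag B) (fB : finite_variation B).
Hypothesis jB : forall s, 0 < s ->
  jump B s = jump (f \o Z) s - Dxf (left_lim A s, left_lim X s) (jump X s).
Let Y t := f (Z t) - B t.
Hypothesis ito : forall t, 0 <= t -> cvg_mode m (fun n =>
  part_sum (pi n) (fun r s => Dxf (Z r) (incr X t r s))) (Y t).

Let cY : cadlag Y.
Proof. exact: (cadlagB (compose_cadlag cA cX f_continuous) cB). Qed.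

Let jY s : 0 < s -> jump Y s = Dxf (left_lim A s, left_lim X s) (jump X s).
Proof.
move=> s0; rewrite (jumpB s (compose_cadlag cA cX f_continuous) cB) jB//.
by rewrite opprB addrC subrK.
Qed.

Let jX0 s : jump Z s = 0 -> jump X s = 0.
Proof. by rewrite jump_pair// => -[]. Qed.

(** If [Z] is constant on [a, b[, stopping at [x] or at [a] gives the same approximating sums, so
    their limits [Y x] and [Y a] coincide by uniqueness in either mode. *)
Lemma ito_integral_adapted : adapted Z Y.
Proof.
split=> // [u u0 /jX0 jX|a b a0 Zc x /andP[ax xb]]; first by rewrite jY// jX bop0.
have Zmin y : Z (Num.min y x) = Z (Num.min y a).
  have [ya|ay] := leP y a; first by rewrite min_l// (le_trans ya).
  apply: Zc; rewrite le_min (ltW ay) ax/=.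
  by rewrite (le_lt_trans _ xb)// ge_min lexx orbT.
apply: (cvg_mode_unique (ito (le_trans a0 ax))).
have := ito a0; congr (cvg_mode m _ (Y a)); apply/funext => n.
congr (part_sum (pi n) _); apply/funext => r; apply/funext => s.
by have /(congr1 snd)/= Es := Zmin s; have /(congr1 snd)/= Er := Zmin r; rewrite /incr Es Er.
Qed.

Let dY n i t := Y (lo n i.+1 t) - Y (lo n i t).
Let rho n i t := dY n i t - Dxf (Z (pi n i)) (dX n i t).

Lemma rho_small t e : 0 <= t -> 0 < e -> \forall n \near \oo, forall i, `|rho n i t| <= e.
Proof.
move=> t0 e0; apply: near_not_ultra => U UU ooU i nP.
have it : \forall n \near U, pi n (i n) < t.
  apply: filterS nP => n nPn; rewrite ltNge; apply/negP => ti; apply: nPn.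
  rewrite /rho /dY /dX /lo !min_r// ?(le_trans ti (ltW (part_pt_lt _ _)))//.
  by rewrite !subrr bop0 subrr normr0 ltW.
have aX : adapted Z X.
  split=> // [u u0 /jX0//|a b a0 Zc x xab]; exact: (congr1 snd (Zc x xab)).
have aH := compose_adapted cA cX cDxf.
pose r_ n := pi n (i n); pose s_ n := Num.min (pi n (i n).+1) t.
suff rho0 : Y (s_ n) - Y (r_ n) - Dxf (Z (r_ n)) (X (s_ n) - X (r_ n)) @[n --> U] --> 0.
  have /cvgr0Pnorm_le/(_ _ e0) rhoe := rho0.
  have [n [[nPn rn] rt]] := filter_ex (filterI (filterI nP rhoe) it).
  apply: nPn; move: rn; rewrite /rho /dY /dX /lo [Num.min (pi n (i n)) t]min_l ?(ltW rt)//.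
have [W1|[w [/andP[w0 wt] wI W2]]] := interval_limits cZ aZ UU ooU it.
  have [y [yr ys]] := W1 _ _ ito_integral_adapted.
  have [x [xr xs]] := W1 _ _ aX; have [h [hr _]] := W1 _ _ aH.
  have -> : (0 : G) = y - y - h (x - x) by rewrite !subrr bop0 subrr.
  by apply: cvgB; [exact: cvgB|apply: bop_cvg hr _; exact: cvgB].
have [yr ys] := W2 _ _ ito_integral_adapted.
have [xr xs] := W2 _ _ aX; have [hr _] := W2 _ _ aH.
have -> : (0 : G) = Y w - left_lim Y w - left_lim (Dxf \o Z) w (X w - left_lim X w).
  have := jY w0; rewrite {1}/jump w0 => ->.
  by rewrite (compose_left_lim cA cX cDxf w0) {1}/jump w0 subrr.
by apply: cvgB; [exact: cvgB|apply: bop_cvg hr _; exact: cvgB].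
Qed.

(** By the expansion, [rho] consists of terms bounded by the increment of A plus the squared
    increment of X, minus the increment of [B], which has finite variation. *)
Lemma rho_summable t : 0 <= t -> exists2 M, 0 <= M & forall n K, t <= pi n K ->
  \sum_(0 <= i < K) `|rho n i t| <= M.
Proof.
move=> t0; have [M M0 sM] := size2_bounded t0; have [L L0 rL] := rem_bounded t0.
have cbox := box_compact cA cX t0.
have [M1 M10 M1P] := compact_norm_bound cbox (cDaf cbox).
have [M2 M20 M2P] := compact_norm_bound cbox (chD2 cbox).
have inb n i : box A X t (Z (lo n i t)) by apply: path_in_box; exact: lo_in.
exists ((M1 + M2 + L) * M + (tv B t - tv B 0)) => [|n K tK].
  by rewrite addr_ge0// ?subr_ge0 ?tv_mono// mulr_ge0// !addr_ge0.
apply: (@le_trans _ _ (\sum_(0 <= i < K) ((M1 + M2 + L) * (`|dA n i t| + `|dX n i t| ^+ 2) +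
    `|B (lo n i.+1 t) - B (lo n i t)|))); last first.
  rewrite big_split/= -mulr_sumr lerD//.
    by rewrite ler_wpM2l ?addr_ge0// sM.
  by apply: sum_control => //; exact: tv_control.
apply: ler_sum => i _.
have -> : rho n i t = (Daf (Z (lo n i t)) (dA n i t) +
    hD2 (Z (lo n i t)) (tp EE (dX n i t) (dX n i t)) +
    rem (Z (lo n i t)) (Z (lo n i.+1 t))) - (B (lo n i.+1 t) - B (lo n i t)).
  rewrite -increment_expansion /rho /dY /Y; move: (Dxf _ _) => u1; vring.
apply: (le_trans (ler_normB _ _)); apply: lerD => //.
have d2 : 0 <= `|dX n i t| ^+ 2 by rewrite exprn_ge0.
have d1 : 0 <= `|dA n i t| by [].
have n1 : `|Daf (Z (lo n i t)) (dA n i t)| <= M1 * (`|dA n i t| + `|dX n i t| ^+ 2).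
  rewrite (le_trans (opnorm_le _ _))//; apply: ler_pM => //; first exact: opnorm_ge0.
    exact: M1P.
  by rewrite lerDl.
have n2 : `|hD2 (Z (lo n i t)) (tp EE (dX n i t) (dX n i t))| <=
    M2 * (`|dA n i t| + `|dX n i t| ^+ 2).
  rewrite (le_trans (opnorm_le _ _))//; apply: ler_pM => //; first exact: opnorm_ge0.
    exact: M2P.
  by rewrite (le_trans (tp_le alphaU _ _ _))// -expr2 lerDr.
have n3 := rL _ _ (inb n i) (inb n i.+1).
rewrite !mulrDl.
apply: (le_trans (ler_normD _ _)); apply: lerD; last exact: n3.
by apply: (le_trans (ler_normD _ _)); apply: lerD.
Qed.

(** The sums of the squares of [T], the value of [Dxf] on the increment of X, are Riemann sums for
    [QY]. Replacing [dY] by [T] costs the tensors of [rho] with [dY] and of [T] with [rho], whose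
    summed norms tend to 0. *)
Lemma ito_integral_qv (QY : R -> GG) :
  sewing QX (tv QX) (fun s => tensor_op EE GG (Dxf (Z s)) (Dxf (Z s))) QY -> QY 0 = 0 ->
  tensor_qv m pi Y QY.
Proof.
move=> sQ QY0; have [cQ fQ _ jQ] := QXP.
have cH : compactly_continuous (fun z : F * E => tensor_op EE GG (Dxf z) (Dxf z)).
  move=> K /cDxf /subspace_continuousP cK; apply/subspace_continuousP => z Kz.
  by apply: tensor_op_cvg => //; exact: cK.
have cHZ := compose_cadlag cA cX cH.
have cwQ t : control (tv QX) QX t := tv_control fQ (t := t).
split.
- exact: sewing_cadlag cwQ cHZ cQ sQ.
- exact: sewing_finite_variation cwQ cHZ sQ.
- move=> t t0; apply: cvg_mode_approx => e e0.
  pose ST n := part_sum (pi n) (fun r s =>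
    tensor_op EE GG (Dxf (Z r)) (Dxf (Z r)) (tp EE (incr X t r s) (incr X t r s))).
  have STc : cvg_mode m ST (QY t).
    exact: (riemann_sums_qv alphaU cX QXP fX cA C2 aZ cH sQ QY0 t0).
  exists (fun n => ST n - QY t).
    by rewrite -(subrr (QY t)); apply: cvg_modeB => //; apply: cvg_mode_norm; exact: cvg_cst.
  have [M1 M10 rM] := rho_summable t0; have [M2 M20 XM] := sum_squares_bounded fX t0.
  have cbox := box_compact cA cX t0.
  have [M M0 MP] := compact_norm_bound cbox (cDxf cbox).
  (* Each interval costs at most [eta] times twice the norm of [rho] plus [M ^+ 2] times the squared
     increment of X; summation gives [eta * C]. For this, [rho] is made smaller than [eta * eta]. *)
  pose C := 2 * M1 + M ^+ 2 * M2 + 1.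
  have C0 : 0 < C by rewrite ltr_wpDl// addr_ge0// mulr_ge0// exprn_ge0.
  pose eta := Num.min 1 (e / C).
  have eta0 : 0 < eta by rewrite lt_min ltr01 divr_gt0.
  have eta1 : eta <= 1 by rewrite ge_min lexx.
  have etae : eta * C <= e by rewrite -ler_pdivlMr// ge_min lexx orbT.
  have := rho_small t0 (mulr_gt0 eta0 eta0); apply: filterS => n rhon.
  have [K tK] := part_pt_unbounded (pi n) t.
  rewrite opprB addrA subrK.
  rewrite (@part_sum_increments _ _ (pi n) Y GG (fun r v => tp GG v v) t K tK); last by move=> r; exact: tp0l.
  rewrite /ST (@part_sum_increments _ _ (pi n) X GG
    (fun r v => tensor_op EE GG (Dxf (Z r)) (Dxf (Z r)) (tp EE v v)) t K tK); last first.
    by move=> r; rewrite tp0l bop0.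
  rewrite -sumrB (le_trans (ler_norm_sum _ _ _))//.
  apply: (@le_trans _ _ (\sum_(0 <= i < K)
    (eta * (2 * `|rho n i t|) + eta * (M ^+ 2 * `|dX n i t| ^+ 2)))); last first.
    rewrite big_split/= -!mulr_sumr -mulrDr (le_trans _ etae)//.
    rewrite ler_wpM2l ?(ltW eta0)// /C.
    have := rM n K tK; have := ler_wpM2l (exprn_ge0 2 M0) (XM n K tK).
    rewrite -/(lo n _ t); lra.
  apply: ler_sum => i _.
  rewrite tensor_op_tp// -/(lo n i t) -/(lo n i.+1 t) -/(dY n i t) -/(dX n i t).
  set T := Dxf (Z (pi n i)) (dX n i t).
  have TM : `|T| <= M * `|dX n i t|.
    rewrite /T Dx_lo (le_trans (opnorm_le _ _))// ler_wpM2r// MP//.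
    by apply: path_in_box; exact: lo_in.
  have rE : dY n i t - T = rho n i t by [].
  rewrite tpB rE; apply: (le_trans (ler_normD _ _)).
  have b1 := tp_le alphaU GG (rho n i t) (dY n i t).
  have b2 := tp_le alphaU GG T (rho n i t).
  have dYle : `|dY n i t| <= `|rho n i t| + `|T| by rewrite -(subrK T (dY n i t)) rE ler_normD.
  have r0 : 0 <= `|rho n i t| by []. have T0 : 0 <= `|T| by [].
  have x0 : 0 <= `|dX n i t| by [].
  have re := rhon i.
  move: b1 b2 dYle re r0 T0 x0 TM.
  move: (`|tp _ _ _|) (`|tp _ _ _|) (`|rho n i t|) (`|T|) (`|dY n i t|) (`|dX n i t|).
  move=> b c r T' y x b1 b2 yr re r0 T0 x0 TM.
  have y0 : r * y <= r * (r + T') by rewrite ler_wpM2l.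
  have rr : r * r <= eta * r.
    by rewrite ler_wpM2r// (le_trans re)// ler_piMr// ltW.
  have TT : T' ^+ 2 <= M ^+ 2 * x ^+ 2 by rewrite -exprMn lerXn2r ?nnegrE// mulr_ge0.
  (* AM-GM, using r <= eta ^ 2 *)
  have key : 2 * (r * T') <= eta * r + eta * T' ^+ 2.
    rewrite -(ler_pM2l eta0).
    have sq : 0 <= (r - eta * T') ^+ 2 by exact: sqr_ge0.
    have rr2 : r * r <= (eta * eta) * r by rewrite ler_wpM2r.
    have -> : eta * (2 * (r * T')) = r * r + eta * eta * T' ^+ 2 - (r - eta * T') ^+ 2 by ring.
    have -> : eta * (eta * r + eta * T' ^+ 2) = eta * eta * r + eta * eta * T' ^+ 2 by ring.
    lra.
  have TT2 : eta * T' ^+ 2 <= eta * (M ^+ 2 * x ^+ 2) by rewrite ler_wpM2l// ltW.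
  have -> : eta * (2 * r) = eta * r + eta * r by ring.
  have rT : r * (r + T') = r * r + r * T' by ring.
  have Tr : T' * r = r * T' by ring.
  lra.
- move=> t; rewrite le_eqVlt => /predU1P[<-|t0].
    by rewrite /jump ltxx -/(tp GG 0 0) tp0l.
  rewrite (sewing_jump cwQ cHZ cQ sQ t0) (compose_left_lim cA cX cH t0).
  by rewrite jQ ?(ltW t0)// -/(tp EE _ _) tensor_op_tp// jY.
Qed.

End quadratic_variation.

(** [QY] is built from the cadlag integrand along [Z]; by [compose_left_lim] its left limits are the
    integrand in the statement. *)
Lemma ito_follmer_decomposition : cadlag (fun t => f (A t, X t)) /\
  exists (Y C D : R -> G) (QY : R -> GG),
    [/\ forall t, 0 <= t -> f (A t, X t) = Y t + C t + D t,
        ito_follmer m pi Dxf A X Y,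
        [/\ cadlag Y, tensor_qv m pi Y QY &
          forall t, 0 <= t ->
            is_stieltjes QX
              (fun s => let T := Dxf (left_lim A s, left_lim X s) in
                        tensor_op EE GG T T)
              t (QY t)],
        {within `[0, +oo[, continuous C} /\ finite_variation C &
        purely_discontinuous D].
Proof.
have cfZ : cadlag (f \o Z) := compose_cadlag cA cX f_continuous.
split; first exact: cfZ.
have [B [cB fB jB ito]] := ito_decomposition.
have [C [D [BE cC fC dD]]] := continuous_discontinuous_decomposition cB fB.
have [cQ fQ _ jQ] := QXP.
have cH : compactly_continuous (fun z : F * E => tensor_op EE GG (Dxf z) (Dxf z)).
  move=> K /cDxf /subspace_continuousP cK; apply/subspace_continuousP => z Kz.
  by apply: tensor_op_cvg => //; exact: cK.
have cwQ t : control (tv QX) QX t := tv_control fQ (t := t).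
have [QY [QY0 sQY QYlim]] := stieltjes_exists cwQ (compose_cadlag cA cX cH).
exists (fun t => f (Z t) - B t), C, D, QY; split => //.
- by move=> t _; rewrite -addrA -BE subrK.
- split; first exact: cadlagB.
    exact: (ito_integral_qv cB fB jB ito sQY QY0).
  move=> t t0; have [h [hin he hI]] := QYlim t t0.
  apply: (is_stieltjesI cQ fQ t0 _ hin he hI) => s /andP[s0 st].
  by rewrite (compose_left_lim cA cX cH s0).
Qed.

End ito_formula.

(* Bounded bilinear maps E x E -> G are written as elements B of 'L(E, 'L(E, G))
   and correspond to y \ox z |-> B y z on the projective tensor product. *)
Theorem corollary6p2 (R : realType) (E F G : completeNormedModType R)
    (alpha : crossnorm_family R) (alphaU : uniform_crossnorm alpha)
    (EE : completion (@alpha E E)) (GG : completion (@alpha G G))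
    (m : mode) (pi : nat -> time_partition R)
    (X : R -> E) (QX : R -> EE) (A : R -> F)
    (f : F * E -> G) (Daf : F * E -> 'L(F, G)) (Dxf : F * E -> 'L(E, G))
    (Dxxf : F * E -> 'L(E, 'L(E, G))) :
  cadlag X -> tensor_qv m pi X QX -> finite_2variation pi X ->
  cadlag A -> finite_variation A ->
  condition_C pi (fun t => (A t, X t)) ->
  approx_left pi (fun t => (A t, X t)) ->
  (forall a x, gateaux (fun b => f (b, x)) a (Daf (a, x))) ->
  (forall a x, gateaux (fun y => f (a, y)) x (Dxf (a, x))) ->
  (forall a x, gateaux (fun y => Dxf (a, y)) x (Dxxf (a, x))) ->
  compactly_continuous Daf ->
  compactly_continuous Dxf ->
  (exists D2f : F * E -> 'L(EE, G), compactly_continuous D2f /\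
     forall p y z, D2f p (cpl_inj EE (y \ox z)) = Dxxf p y z) ->
  cadlag (fun t => f (A t, X t)) /\
  exists (Y C D : R -> G) (QY : R -> GG),
    [/\ forall t, 0 <= t -> f (A t, X t) = Y t + C t + D t,
        ito_follmer m pi Dxf A X Y,
        [/\ cadlag Y, tensor_qv m pi Y QY &
          forall t, 0 <= t ->
            is_stieltjes QX
              (fun s => let T := Dxf (left_lim A s, left_lim X s) in
                        tensor_op EE GG T T)
              t (QY t)],
        {within `[0, +oo[, continuous C} /\ finite_variation C &
        purely_discontinuous D].
Proof.
move=> cX QXP fX cA fA CZ aZ dfa dfx dfxx cDaf cDxf [D2f [cD2f D2fE]].
exact: (ito_follmer_decomposition alphaU GG cX QXP fX cA fA CZ aZ dfa dfx dfxx cDaf cDxf cD2f D2fE).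
Qed.
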